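(* Let $\ell_T(r)=\mathbb E[e^{-rT_1}]$ and let $\mathcal S$ be the space of all bounded functions $f$ on $[0,\infty)$ with values in $\bigl[0,(1-\ell_T(r))^{-1}\bigr]$. Then the value function $v$ is the unique solution in $\mathcal S$ to the dynamic programming equation $$v(z) = \mathbf 1_{\{z>d\}}+ \inf_{b\in[0,1]} \mathbb E\bigl[e^{-r T_1}\,v(\Delta_{z}^b(T_1))\bigr]\qquad\text{for all } z\geq 0,$$ where $\Delta_z^b$ denotes the drawdown process with initial drawdown $z$ under the constant strategy $B_t=b$.
   Context: Setting. On a complete probability space $(\Omega,\mathcal F,\mathbb P)$ let $W$ be a standard Brownian motion and $N=\{N_t\}_{t\ge0}$ an ordinary renewal process independent of $W$, with arrival times $0=T_0<T_1<T_2<\cdots$, whose i.i.d. interarrival times $T_{k+1}-T_k$ have a common distribution $F$. $\{\mathcal F_t\}_{t\ge 0}$ is the smallest right-continuous filtration to which $W$ and $N$ are adapted. Fix real constants $\eta<\theta$, $\sigma>0$, a critical level $d>0$ and a preference (discount) factor $r>0$. For $b\in[0,1]$ put $\mu(b)=\eta-(1-b)\theta$ and $\sigma(b)=\sigma b$. Strategies. $\mathcal B$ is the set of all processes $B_t=\sum_{k=0}^\infty b_k\mathbf 1_{[T_k,T_{k+1})}(t)=b_{N_t}$, where each $b_k$ is an $\mathcal F_{T_k}$-measurable random variable with values in $[0,1]$. Drawdown. For $B\in\mathcal B$ let $X_0^B(t)=\int_0^t\mu(B_s)\,ds+\int_0^t\sigma(B_s)\,dW_s$. For $z\ge0$ the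 drawdown process with initial drawdown $z$ is $\Delta_z^B(t)=\max\{z,\sup_{0\le s\le t}X_0^B(s)\}-X_0^B(t)$. For constant $b\in[0,1]$, $\Delta_z^b$ denotes $\Delta_z^B$ with $B_t=b$ for all $t$. Value function. $v^B(z)=\mathbb E\bigl[\sum_{k=0}^\infty e^{-rT_k}\mathbf 1_{\{\Delta_z^B(T_k)>d\}}\bigr]$ and $v(z)=\inf_{B\in\mathcal B}v^B(z)$ for $z\ge0$. *)

(* Defs.v *)
From HB Require Import structures.
From mathcomp Require Export all_boot all_order all_algebra.
From mathcomp Require Export all_classical all_reals all_analysis.
From mathcomp Require Export measurable_realfun.
Export Order.TTheory GRing.Theory Num.Theory.
Export numFieldNormedType.Exports.

Set Implicit Arguments.
Unset Strict Implicit.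
Unset Printing Implicit Defensive.

Local Open Scope classical_set_scope.
Local Open Scope ring_scope.

(* Time is the half-line [0, +oo[ of R : realType; processes are functions
   X : R -> Omega -> _ whose values at negative times are never used. *)

(** Sigma-algebras and independence *)

Definition sigma_generated (d0 d1 : measure_display) (Omega : measurableType d0)
    (E : measurableType d1) (I : Type) (D : set I) (X : I -> Omega -> E) :
    set (set Omega) :=
  <<s \bigcup_(i in D) preimage_set_system setT (X i) measurable >>.

Definition independent_systems (d0 : measure_display) (Omega : measurableType d0)
    (R : realType) (P : probability Omega R) (G H : set (set Omega)) : Prop :=
  forall A B, G A -> H B -> P (A `&` B) = (P A * P B)%E.

(* Mutual independence of the random variables X 0, X 1, ...; taking some of
   the Borel sets A k equal to setT gives the product rule for every finite
   subfamily. *)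
Definition mutually_independent (d0 : measure_display)
    (Omega : measurableType d0) (R : realType) (P : probability Omega R)
    (X : nat -> Omega -> R) : Prop :=
  forall (n : nat) (A : nat -> set R), (forall k, measurable (A k)) ->
    P (\bigcap_(k in `I_n) (X k @^-1` A k)) =
    (\prod_(k < n) P (X k @^-1` A k))%E.

(** Brownian motion and renewal process *)

(* [normal_prob 0 s] takes the standard deviation [s] as second parameter. *)
Record standard_brownian_motion (d0 : measure_display)
    (Omega : measurableType d0) (R : realType) (P : probability Omega R)
    (W : R -> Omega -> R) : Prop := StandardBrownianMotion {
  bm_measurable : forall t, 0 <= t -> measurable_fun setT (W t) ;
  bm_start : {ae P, forall w, W 0 w = 0} ;
  bm_continuous :
    {ae P, forall w, {within `[0, +oo[%classic, continuous (W ^~ w)}} ;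
  bm_gaussian : forall s t, 0 <= s -> s < t ->
    forall A : set R, measurable A ->
      P ((fun w => W t w - W s w) @^-1` A) = normal_prob 0 (Num.sqrt (t - s)) A ;
  bm_independent : forall tau : nat -> R,
    0 <= tau 0%N -> (forall k, tau k <= tau k.+1) ->
    mutually_independent P (fun k w => W (tau k.+1) w - W (tau k) w)
}.

Record renewal_times (d0 : measure_display) (Omega : measurableType d0)
    (R : realType) (P : probability Omega R) (F : probability (measurableTypeR R) R)
    (T : nat -> Omega -> R) : Prop := RenewalTimes {
  rt_measurable : forall k, measurable_fun setT (T k) ;
  rt_start : forall w, T 0%N w = 0 ;
  rt_increasing : forall k w, T k w < T k.+1 w ;
  rt_law : forall k (A : set R), measurable A ->
    P ((fun w => T k.+1 w - T k w) @^-1` A) = F A ;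
  rt_independent : mutually_independent P (fun k w => T k.+1 w - T k w)
}.

(* N_t is the number of k >= 1 with T_k <= t. It is extended-real valued because
   T_k --> +oo only holds almost surely. *)
Definition counting_process (Omega : Type) (R : realType)
    (T : nat -> Omega -> R) (t : R) (w : Omega) : \bar R :=
  (\sum_(0 <= k <oo) (T k.+1 w <= t)%R%:R%:E)%E.

(** The filtration generated by W and N *)

Definition filtration (d0 : measure_display) (Omega : measurableType d0)
    (R : realType) (G : R -> set (set Omega)) : Prop :=
  [/\ forall t, 0 <= t -> sigma_algebra setT (G t),
      forall t, 0 <= t -> G t `<=` measurable
    & forall s t, 0 <= s -> s <= t -> G s `<=` G t].

Definition right_continuous_filtration (Omega : Type) (R : realType)
    (G : R -> set (set Omega)) : Prop :=
  forall t, 0 <= t -> G t = \bigcap_(s in `]t, +oo[) G s.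

Definition adapted (d1 : measure_display) (Omega : Type) (R : realType)
    (E : measurableType d1) (G : R -> set (set Omega)) (X : R -> Omega -> E) :
    Prop :=
  forall t, 0 <= t -> forall A : set E, measurable A -> G t (X t @^-1` A).

Definition smallest_filtration (d0 : measure_display)
    (Omega : measurableType d0) (R : realType)
    (W : R -> Omega -> R) (T : nat -> Omega -> R) (t : R) : set (set Omega) :=
  [set A | forall G : R -> set (set Omega),
    filtration G -> right_continuous_filtration G ->
    adapted G W -> adapted G (counting_process T) -> G t A].

Definition stopped_sigma_algebra (d0 : measure_display)
    (Omega : measurableType d0) (R : realType) (G : R -> set (set Omega))
    (tau : Omega -> R) : set (set Omega) :=
  [set A | measurable A /\
    forall t, 0 <= t -> G t (A `&` [set w | tau w <= t])].

(** Strategies *)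

Definition step_process (Omega : Type) (R : realType) (T : nat -> Omega -> R)
    (b : nat -> Omega -> R) (t : R) (w : Omega) : R :=
  limn (series (fun k => b k w * \1_(`[T k w, T k.+1 w[%classic) t)).

Definition strategies (d0 : measure_display) (Omega : measurableType d0)
    (R : realType) (W : R -> Omega -> R) (T : nat -> Omega -> R) :
    set (R -> Omega -> R) :=
  [set B | exists b : nat -> Omega -> R,
    [/\ forall k w, 0 <= b k w <= 1,
        forall k (A : set R), measurable A ->
          stopped_sigma_algebra (smallest_filtration W T) (T k) (b k @^-1` A)
      & B = step_process T b]].

(** Surplus, drawdown and value function *)

Definition drift (R : realType) (eta theta b : R) : R := eta - (1 - b) * theta.

Definition volatility (R : realType) (sigma b : R) : R := sigma * b.

(* Ito integral over [0, t] of an integrand which is constant on every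
   [T_k, T_(k+1)[. *)
Definition ito_integral (Omega : Type) (R : realType) (T : nat -> Omega -> R)
    (H W : R -> Omega -> R) (t : R) (w : Omega) : R :=
  limn (series (fun k => H (T k w) w *
    (W (Num.min t (T k.+1 w)) w - W (Num.min t (T k w)) w))).

Definition surplus (Omega : Type) (R : realType) (eta theta sigma : R)
    (W : R -> Omega -> R) (T : nat -> Omega -> R) (B : R -> Omega -> R)
    (t : R) (w : Omega) : R :=
  \int[lebesgue_measure]_(s in `[0, t]) drift eta theta (B s w) +
  ito_integral T (fun s w' => volatility sigma (B s w')) W t w.

Definition drawdown (Omega : Type) (R : realType) (eta theta sigma : R)
    (W : R -> Omega -> R) (T : nat -> Omega -> R) (B : R -> Omega -> R)
    (z t : R) (w : Omega) : R :=
  let X := surplus eta theta sigma W T B in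
  Num.max z (sup [set X s w | s in `[0, t]]) - X t w.

Definition strategy_value (d0 : measure_display) (Omega : measurableType d0)
    (R : realType) (P : probability Omega R) (eta theta sigma dcrit r : R)
    (W : R -> Omega -> R) (T : nat -> Omega -> R) (B : R -> Omega -> R)
    (z : R) : \bar R :=
  (\int[P]_w \sum_(0 <= k <oo)
    (expR (- r * T k w) *
     (dcrit < drawdown eta theta sigma W T B z (T k w) w)%R%:R)%:E)%E.

Definition value_function (d0 : measure_display) (Omega : measurableType d0)
    (R : realType) (P : probability Omega R) (eta theta sigma dcrit r : R)
    (W : R -> Omega -> R) (T : nat -> Omega -> R) (z : R) : \bar R :=
  ereal_inf [set strategy_value P eta theta sigma dcrit r W T B z
            | B in strategies W T].

(** The dynamic programming equation *)

Definition laplace_T1 (d0 : measure_display) (Omega : measurableType d0)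
    (R : realType) (P : probability Omega R) (r : R) (T : nat -> Omega -> R) : R :=
  fine 'E_P[fun w => expR (- r * T 1%N w)].

Definition bounded_space (R : realType) (c : R) : set (R -> \bar R) :=
  [set f | forall z, 0 <= z -> (0 <= f z <= c%:E)%E].

(* For a nonnegative f that is not measurable, the integral below is the
   library's, i.e. the supremum of the integrals of simple functions below
   the integrand. *)
Definition dynamic_programming_equation (d0 : measure_display)
    (Omega : measurableType d0) (R : realType) (P : probability Omega R)
    (eta theta sigma dcrit r : R) (W : R -> Omega -> R) (T : nat -> Omega -> R)
    (f : R -> \bar R) : Prop :=
  forall z, 0 <= z ->
    f z = ((dcrit < z)%R%:R%:E +
      ereal_inf [set \int[P]_w ((expR (- r * T 1%N w))%:E *
          f (drawdown eta theta sigma W T (fun _ _ => b) z (T 1%N w) w))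
        | b in `[0%R, 1%R]])%E.

(* Main.v *)
(* The operator of the dynamic programming equation contracts by the factor
   E[exp(- r T_1)] < 1, also on non-measurable functions, because the lower
   integral is subadditive when one summand is measurable; this gives uniqueness.
   The drawdown is nondecreasing in its initial value, so the operator preserves
   nondecreasing functions and has a nondecreasing, hence measurable, fixed point
   w. The pair of T_(k+1) - T_k and the path W_(T_k + u) - W_(T_k) is independent
   of F_(T_k) and its law does not depend on k. Hence, by Fubini, conditioning
   e^(- r T_(k+1)) w(drawdown at T_(k+1)) on F_(T_k) evaluates the one-step cost
   of w at the current drawdown and control. Iterating the equation for w along
   an arbitrary strategy bounds its value from below by w(z); along the feedback
   strategy b_k = beta(drawdown at T_k), with beta a measurable
   epsilon-minimizer, the same iteration bounds it from above by w(z) up to a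
   multiple of epsilon. *)

From HB Require Import structures.
Require Import Defs.
From mathcomp Require Import lra ring.

Set Implicit Arguments.
Unset Strict Implicit.
Unset Printing Implicit Defensive.

Local Open Scope classical_set_scope.
Local Open Scope ring_scope.

(** * Lower integrals and the discounted operator *)

(** Null sets shape the proof. Paths of [W] are continuous only almost surely, while
    [smallest_filtration] is not completed, and a strategy needs each [b k] to be measurable for
    exactly this filtration. The drawdown is therefore replaced by a version built from limits
    superior along grids; it is defined at every outcome, adapted, and equal to the drawdown on
    continuous paths. The independence from the past at [T k] is a strong Markov property for the
    joint filtration of [W] and the counting process, proved by discretizing [T k]. The danger is
    that the past at [T k] might reveal something about the gap in progress. Right-continuity only
    lets it look ahead by an arbitrarily short time, which stays before the next arrival because
    gaps are strictly positive. The noise of a cycle is recorded on a countable grid, so that its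
    space is a countable product; continuity recovers the suprema. The bound of the space is the sum
    of the expected discounts [l ^+ k], the value of being critical at every arrival. *)

Section lower_integral.
Local Open Scope ereal_scope.
Context d (X : measurableType d) (R : realType).
Variable mu : {measure set X -> \bar R}.
Implicit Types f g : X -> \bar R.
Import HBNNSimple.

Lemma ge0_le_integral_nomeas f g : (forall x, 0 <= f x) ->
  (forall x, f x <= g x) -> \int[mu]_x f x <= \int[mu]_x g x.
Proof.
move=> f0 fg; have g0 x : 0 <= g x by exact: le_trans (fg x).
rewrite !ge0_integralTE//; apply: le_ereal_sup => _ [h /= hf <-].
by exists h => //= x; exact: le_trans (fg x).
Qed.

(** Reduces a bound on a lower integral to measurable minorants, for which the integral is
    additive. *)
Lemma integral_le_of_minorants f (c : \bar R) : (forall x, 0 <= f x) ->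
  (forall h : X -> R, measurable_fun setT h -> (forall x, (0 <= h x)%R) ->
    (forall x, (h x)%:E <= f x) -> \int[mu]_x (h x)%:E <= c) ->
  \int[mu]_x f x <= c.
Proof.
move=> f0 H; rewrite ge0_integralTE//; apply: ge_ereal_sup => _ [h /= hf <-].
rewrite -integralT_nnsfun; apply: H => //.
Qed.

(** A measurable minorant set to 0 on the null set keeps its integral and remains a minorant. *)
Lemma ge0_integral_restrict_nomeas f (N : set X) : measurable N -> mu N = 0 ->
  (forall x, 0 <= f x) -> \int[mu]_x f x = \int[mu]_x (f \_ (~` N)) x.
Proof.
move=> mN N0 f0.
have r0 x : 0 <= (f \_ (~` N)) x by rewrite patchE; case: ifP.
apply/eqP; rewrite eq_le; apply/andP; split; last first.
  by apply: ge0_le_integral_nomeas => // x; rewrite patchE; case: ifP.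
apply: integral_le_of_minorants => // h mh h0 hf.
rewrite (ge0_negligible_integral mN)//; first last.
- by move=> x _; rewrite lee_fin.
- exact/measurable_EFinP.
rewrite setTD integral_mkcond.
apply: ge0_le_integral_nomeas => x; rewrite !patchE; case: ifP => //.
by rewrite lee_fin.
Qed.

(** Justifies the replacement of formulas that hold only on continuous paths, also inside integrands
    not known to be measurable. *)
Lemma eq_integral_off_null f g (N : set X) : measurable N -> mu N = 0 ->
  (forall x, ~ N x -> f x = g x) -> \int[mu]_x f x = \int[mu]_x g x.
Proof.
move=> mN N0 fg; rewrite integralE [RHS]integralE.
have E (s : (X -> \bar R) -> X -> \bar R) : (forall u x, 0 <= s u x) ->
    (forall u v x, u x = v x -> s u x = s v x) ->
    \int[mu]_x s f x = \int[mu]_x s g x.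
  move=> s0 se; rewrite (ge0_integral_restrict_nomeas mN)//.
  rewrite [RHS](ge0_integral_restrict_nomeas mN)//.
  apply: eq_integral => x _; rewrite !patchE; case: ifPn => //.
  by rewrite inE => Nx; apply: se; exact: fg.
congr (_ - _); first by apply: (E (fun u => u^\+)) => // u v x uv; rewrite !funeposE uv.
by apply: (E (fun u => u^\-)) => // u v x uv; rewrite !funenegE uv.
Qed.

(** If a measurable [s] lies below [f + h], then the positive part of [s - h] is a minorant of [f];
    it is measurable because [h] is. *)
Lemma integral_le_add_nomeas f (h : X -> R) : measurable_fun setT h ->
  (forall x, (0 <= h x)%R) -> (forall x, 0 <= f x) ->
  \int[mu]_x (f x + (h x)%:E) <= \int[mu]_x f x + \int[mu]_x (h x)%:E.
Proof.
move=> mh h0 f0.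
apply: integral_le_of_minorants => [x|s ms s0 sf].
  by rewrite adde_ge0// lee_fin.
pose u x := Num.max (s x - h x)%R 0%R.
have mu_ : measurable_fun setT u.
  by apply: measurable_maxr => //; exact: measurable_funB.
have u0 x : (0 <= u x)%R by rewrite /u le_max lexx orbT.
have suh x : (s x <= u x + h x)%R by rewrite /u -lerBlDr le_max lexx.
apply: (@le_trans _ _ (\int[mu]_x ((u x)%:E + (h x)%:E))).
  by apply: ge0_le_integral_nomeas => x; rewrite ?lee_fin// -EFinD lee_fin.
rewrite ge0_integralD//.
- apply: leeD => //; apply: ge0_le_integral_nomeas => x; first by rewrite lee_fin.
  rewrite /u; case: (leP (s x - h x)%R 0%R) => // _.
  by rewrite EFinB leeBlDr.
- by move=> x _; rewrite lee_fin.
- exact/measurable_EFinP.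
- by move=> x _; rewrite lee_fin.
- exact/measurable_EFinP.
Qed.

Lemma measure_eq_off_null (A B N : set X) : measurable A -> measurable B ->
  measurable N -> mu N = 0 -> (forall x, ~ N x -> (A x <-> B x)) -> mu A = mu B.
Proof.
move=> mA mB mN N0 AB.
rewrite -[A]setIT -[B]setIT -!integral_indic//.
apply: (eq_integral_off_null mN N0) => x /AB h; rewrite !indicE.
by have -> : (x \in A) = (x \in B) by apply/idP/idP; rewrite !inE => /h.
Qed.

End lower_integral.

(** * The discounted operator: contraction and fixed points *)

Section discounted_operator.
Local Open Scope ereal_scope.
Context d (X : measurableType d) (R : realType).
Variables (P : probability X R) (c : R).
Variables (e : X -> R) (K : R -> R -> X -> R) (N : set X).
Hypothesis me : measurable_fun setT e.
Hypothesis e0 : forall x, (0 <= e x)%R.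
Hypothesis intE : \int[P]_x (e x)%:E \is a fin_num.
Hypotheses (mN : measurable N) (PN : P N = 0).
Hypothesis K0 : forall (z : R) b x, (0 <= z)%R -> ~ N x -> (0 <= K z b x)%R.
Hypothesis Kle : forall (z z' : R) b x, (z <= z')%R -> (K z b x <= K z' b x)%R.

Let l := fine (\int[P]_x (e x)%:E).
Hypothesis l1 : (l < 1)%R.

(** Here [e] stands for the discount at the first arrival and [K z b] for the drawdown there. [K] is
    non-negative only off [N], since on an irregular path the supremum in the drawdown may be a
    default value. *)
Definition dp_cost (f : R -> \bar R) (z b : R) :=
  \int[P]_x ((e x)%:E * f (K z b x)).

Definition dp_inf (f : R -> \bar R) (z : R) :=
  ereal_inf [set dp_cost f z b | b in `[0%R, 1%R]].

Definition dp_op (f : R -> \bar R) (z : R) : \bar R :=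
  (c < z)%R%:R%:E + dp_inf f z.

Let lE : \int[P]_x (e x)%:E = l%:E.
Proof. by rewrite /l fineK. Qed.

Lemma dp_l_ge0 : (0 <= l)%R.
Proof. by rewrite -lee_fin -lE integral_ge0// => x _; rewrite lee_fin. Qed.

(** Cutting the integrand off on [N] makes it non-negative everywhere, as the lemmas on lower
    integrals require. *)
Lemma dp_costE (f : R -> \bar R) z b :
  dp_cost f z b = \int[P]_x ((fun x => (e x)%:E * f (K z b x)) \_ (~` N)) x.
Proof.
apply: (eq_integral_off_null mN) => // x Nx.
by rewrite patchE ifT// inE.
Qed.

Lemma dp_cost_ge0 (f : R -> \bar R) z b : (0 <= z)%R ->
  (forall y : R, (0 <= y)%R -> 0 <= f y) -> 0 <= dp_cost f z b.
Proof.
move=> z0 f0; rewrite dp_costE integral_ge0// => x _.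
rewrite patchE; case: ifPn => //; rewrite inE => Nx.
by rewrite mule_ge0 ?lee_fin// f0// K0.
Qed.

(** The contraction estimate, one-sided so that no extended reals are subtracted. The error term
    [a * e] is the measurable summand to which subadditivity of the lower integral applies. *)
Lemma dp_cost_le (f g : R -> \bar R) (a : R) z b : (0 <= z)%R -> (0 <= a)%R ->
  (forall y : R, (0 <= y)%R -> 0 <= f y) -> (forall y : R, (0 <= y)%R -> 0 <= g y) ->
  (forall y : R, (0 <= y)%R -> f y <= g y + a%:E) ->
  dp_cost f z b <= dp_cost g z b + (l * a)%:E.
Proof.
move=> z0 a0 f0 g0 fg; rewrite dp_costE [dp_cost g z b]dp_costE.
have -> : (l * a)%:E = \int[P]_x (a * e x)%:E.
  under eq_integral do rewrite EFinM.
  rewrite ge0_integralZl_EFin//.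
  - by rewrite lE -EFinM mulrC.
  - by move=> x _; rewrite lee_fin.
  - exact/measurable_EFinP.
apply: le_trans; last apply: integral_le_add_nomeas.
- apply: ge0_le_integral_nomeas => x; rewrite !patchE; case: ifPn => [|_].
  + by rewrite inE => Nx; rewrite mule_ge0 ?lee_fin// f0// K0.
  + by [].
  + rewrite inE => Nx; apply: (@le_trans _ _ ((e x)%:E * (g (K z b x) + a%:E))).
      by apply: lee_pmul => //; rewrite ?lee_fin ?f0 ?fg ?K0.
    by rewrite ge0_muleDr// ?lee_fin// ?g0 ?K0// EFinM (muleC a%:E).
  + by rewrite add0e lee_fin mulr_ge0.
- exact: measurable_funM.
- by move=> x; rewrite mulr_ge0.
- move=> x; rewrite patchE; case: ifPn => //; rewrite inE => Nx.
  by rewrite mule_ge0 ?lee_fin// g0// K0.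
Qed.


Lemma dp_cost_mono (f : R -> \bar R) z z' b : (0 <= z)%R -> (z <= z')%R ->
  (forall y : R, (0 <= y)%R -> 0 <= f y) ->
  (forall y y' : R, (0 <= y)%R -> (y <= y')%R -> f y <= f y') ->
  dp_cost f z b <= dp_cost f z' b.
Proof.
move=> z0 zz' f0 fle; rewrite !dp_costE.
apply: ge0_le_integral_nomeas => x; rewrite !patchE; case: ifPn => //.
  by rewrite inE => Nx; rewrite mule_ge0 ?lee_fin// f0// K0.
rewrite inE => Nx; apply: lee_pmul; rewrite ?lee_fin//.
  by rewrite f0// K0.
by rewrite fle ?K0 ?Kle.
Qed.

Lemma dp_inf_ge0 (f : R -> \bar R) z : (0 <= z)%R ->
  (forall y : R, (0 <= y)%R -> 0 <= f y) -> 0 <= dp_inf f z.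
Proof.
by move=> z0 f0; apply/ereal_infP => _ [b _ <-]; exact: dp_cost_ge0.
Qed.

Lemma dp_inf_lb (f : R -> \bar R) z b : (0 <= b <= 1)%R ->
  dp_inf f z <= dp_cost f z b.
Proof. by move=> b01; apply: ereal_inf_lbound; exists b. Qed.

Lemma dp_inf_le (f g : R -> \bar R) (a : R) z : (0 <= z)%R -> (0 <= a)%R ->
  (forall y : R, (0 <= y)%R -> 0 <= f y) -> (forall y : R, (0 <= y)%R -> 0 <= g y) ->
  (forall y : R, (0 <= y)%R -> f y <= g y + a%:E) ->
  dp_inf f z <= dp_inf g z + (l * a)%:E.
Proof.
move=> z0 a0 f0 g0 fg; rewrite -leeBlDr//.
apply/ereal_infP => _ [b b01 <-]; rewrite leeBlDr//.
apply: le_trans (dp_cost_le _ z0 a0 f0 g0 fg); apply: dp_inf_lb.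
by move: b01 => /=; rewrite in_itv.
Qed.

Lemma dp_inf_mono (f : R -> \bar R) z z' : (0 <= z)%R -> (z <= z')%R ->
  (forall y : R, (0 <= y)%R -> 0 <= f y) ->
  (forall y y' : R, (0 <= y)%R -> (y <= y')%R -> f y <= f y') ->
  dp_inf f z <= dp_inf f z'.
Proof.
move=> z0 zz' f0 fle; apply/ereal_infP => _ [b /= b01 <-].
apply: le_trans (dp_cost_mono _ z0 zz' f0 fle); apply: dp_inf_lb.
by move: b01; rewrite in_itv.
Qed.

Let C := ((1 - l)^-1)%R.

Let C0 : (0 < C)%R.
Proof. by rewrite invr_gt0 subr_gt0. Qed.

(** A cost of at most 1 now and of at most [l * C] later add up to at most [C]; this is why [C]
    bounds the space. *)
Let CE : (1 + l * C = C)%R.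
Proof.
have : (C * (1 - l) = 1)%R by rewrite mulVf// subr_eq0 gt_eqF.
by rewrite mulrBr mulr1 => /eqP; rewrite subr_eq => /eqP; rewrite mulrC => <-.
Qed.

(** Comparison with the zero function, which has cost 0 and which [f] exceeds by at most [C]. *)
Lemma dp_inf_bounded (f : R -> \bar R) z : bounded_space C f -> (0 <= z)%R ->
  0 <= dp_inf f z <= (l * C)%:E.
Proof.
move=> fS z0; have f0 y : (0 <= y)%R -> 0 <= f y by case/fS/andP.
rewrite dp_inf_ge0//=.
apply: (@le_trans _ _ (dp_inf (cst 0) z + (l * C)%:E)).
  apply: dp_inf_le => //; first exact: ltW.
  by move=> y /fS /andP[_]; rewrite add0e.
rewrite -[leRHS]add0e leeD2r//.
apply: (@le_trans _ _ (dp_cost (cst 0) z 0)); first by apply: dp_inf_lb; rewrite lexx ler01.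
by rewrite /dp_cost integral0_eq// => x _; rewrite mule0.
Qed.

Lemma dp_op_bounded (f : R -> \bar R) : bounded_space C f -> bounded_space C (dp_op f).
Proof.
move=> fS z z0; have /andP[i0 iC] := dp_inf_bounded fS z0.
rewrite adde_ge0 ?lee_fin//= -CE EFinD leeD// lee_fin.
by case: (_ < _)%R.
Qed.

Lemma dp_op_le (f g : R -> \bar R) (a : R) z : (0 <= z)%R -> (0 <= a)%R ->
  (forall y : R, (0 <= y)%R -> 0 <= f y) -> (forall y : R, (0 <= y)%R -> 0 <= g y) ->
  (forall y : R, (0 <= y)%R -> f y <= g y + a%:E) ->
  dp_op f z <= dp_op g z + (l * a)%:E.
Proof. by move=> *; rewrite /dp_op -addeA leeD2l// dp_inf_le. Qed.

Lemma dp_op_mono (f : R -> \bar R) z z' : (0 <= z)%R -> (z <= z')%R ->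
  (forall y : R, (0 <= y)%R -> 0 <= f y) ->
  (forall y y' : R, (0 <= y)%R -> (y <= y')%R -> f y <= f y') ->
  dp_op f z <= dp_op f z'.
Proof.
move=> z0 zz' f0 fle; apply: leeD; last exact: dp_inf_mono.
rewrite lee_fin; case: (ltP c z) => // cz.
by rewrite (lt_le_trans cz zz').
Qed.

(** Starts from [f <= g + C]; applying the operator [n] times to both sides shrinks the error to
    [l ^+ n * C]. *)
Lemma dp_fixpoint_le (f g : R -> \bar R) : bounded_space C f -> bounded_space C g ->
  (forall z : R, (0 <= z)%R -> f z = dp_op f z) ->
  (forall z : R, (0 <= z)%R -> g z = dp_op g z) ->
  forall z : R, (0 <= z)%R -> f z <= g z.
Proof.
move=> fS gS ff gg.
have f0 y : (0 <= y)%R -> 0 <= f y by case/fS/andP.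
have g0 y : (0 <= y)%R -> 0 <= g y by case/gS/andP.
have le_n n z : (0 <= z)%R -> f z <= g z + (l ^+ n * C)%:E.
  elim: n z => [|n ih] z z0.
    by rewrite expr0 mul1r; apply: le_trans (leeDr _ (g0 _ z0)); case/fS/andP : z0.
  rewrite ff// gg// exprS -mulrA; apply: dp_op_le => //.
  by rewrite mulr_ge0 ?exprn_ge0 ?dp_l_ge0// ltW.
move=> z z0; apply/lee_addgt0Pr => _/posnumP[eps].
have cvgC : (l ^+ n * C)%R @[n --> \oo] --> (0 : R)%R.
  rewrite -[X in _ --> X](mul0r C); apply: cvgMl.
  by apply: cvg_expr; rewrite ger0_norm ?dp_l_ge0.
have /cvgrPdist_lt /(_ _ (gt0 eps)) [n _ /(_ n (leqnn n))] := cvgC.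
rewrite sub0r normrN => h; apply: (le_trans (le_n n _ z0)).
by rewrite leeD2l// lee_fin; apply: ltW; apply: le_lt_trans h; rewrite ler_norm.
Qed.

Lemma dp_fixpoint_unique (f g : R -> \bar R) : bounded_space C f -> bounded_space C g ->
  (forall z : R, (0 <= z)%R -> f z = dp_op f z) ->
  (forall z : R, (0 <= z)%R -> g z = dp_op g z) ->
  forall z : R, (0 <= z)%R -> f z = g z.
Proof.
by move=> fS gS ff gg z z0; apply/eqP; rewrite eq_le !dp_fixpoint_le.
Qed.

(* Knaster-Tarski in the lattice of monotone functions; monotonicity makes the
   fixed point measurable. *)
Lemma dp_fixpoint_exists : exists w : R -> \bar R,
  [/\ bounded_space C w,
      forall y y' : R, (0 <= y)%R -> (y <= y')%R -> w y <= w y'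
    & forall z : R, (0 <= z)%R -> w z = dp_op w z].
Proof.
(* The subsolutions. Their supremum [w] is again one, as the operator is monotone; so is its image
   under the operator, which therefore lies below [w]. *)
pose A := [set f : R -> \bar R | [/\ bounded_space C f,
  forall y y' : R, (0 <= y)%R -> (y <= y')%R -> f y <= f y'
  & forall z : R, (0 <= z)%R -> f z <= dp_op f z]].
pose w z := ereal_sup [set f z | f in A].
have A0 : A (cst 0).
  split => //; first by move=> z _; rewrite lexx lee_fin ltW.
  by move=> z z0; rewrite adde_ge0 ?lee_fin// dp_inf_ge0.
have wub f z : A f -> f z <= w z by move=> Af; apply: ereal_sup_ubound; exists f.
have wS : bounded_space C w.
  move=> z z0; rewrite (wub _ z A0)/=; apply: ge_ereal_sup => _ [f [fS _ _] <-].
  by case/fS/andP : z0.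
have wmono y y' : (0 <= y)%R -> (y <= y')%R -> w y <= w y'.
  move=> y0 yy'; apply: ge_ereal_sup => _ [f Af <-].
  by apply: le_trans (wub _ y' Af); case: Af => _ + _; exact.
have w0 y : (0 <= y)%R -> 0 <= w y by case/wS/andP.
have wop z : (0 <= z)%R -> w z <= dp_op w z.
  move=> z0; apply: ge_ereal_sup => _ [f /[dup] Af [fS fm ff] <-].
  apply: (le_trans (ff _ z0)).
  suff : dp_op f z <= dp_op w z + (l * 0)%:E by rewrite mulr0 adde0.
  apply: dp_op_le => //; first by move=> y /fS /andP[].
  by move=> y y0; rewrite adde0; exact: wub.
have opw z : (0 <= z)%R -> 0 <= dp_op w z by move/(dp_op_bounded wS)/andP => [].
exists w; split => // z z0; apply/eqP; rewrite eq_le wop//=.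
apply: wub; split; first exact: dp_op_bounded.
  by move=> y y' y0 yy'; exact: dp_op_mono.
move=> y y0.
suff : dp_op w y <= dp_op (dp_op w) y + (l * 0)%:E by rewrite mulr0 adde0.
apply: dp_op_le => //.
by move=> y' y'0; rewrite adde0 wop.
Qed.

End discounted_operator.

(** * Sigma-algebras as plain sets of events *)

Section sigma_algebra_facts.
Context (X : Type) (G : set (set X)).
Hypothesis sG : sigma_algebra setT G.

Lemma salg_C (A : set X) : G A -> G (~` A).
Proof. by case: sG => _ + _ GA => /(_ _ GA); rewrite setTD. Qed.

Lemma salg_0 : G set0. Proof. by case: sG. Qed.

Lemma salg_T : G setT. Proof. by rewrite -setC0; apply: salg_C; exact: salg_0. Qed.

Lemma salg_U (F : nat -> set X) : (forall n, G (F n)) -> G (\bigcup_n F n).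
Proof. by case: sG => _ _; exact. Qed.

Lemma salg_I (A B : set X) : G A -> G B -> G (A `&` B).
Proof.
move=> GA GB; rewrite -(setCK (_ `&` _)) setCI; apply: salg_C.
rewrite -bigcup2E; apply: salg_U => -[|[|n]] /=; try exact: salg_C.
exact: salg_0.
Qed.

Lemma salg_Icap (F : nat -> set X) : (forall n, G (F n)) -> G (\bigcap_n F n).
Proof.
move=> GF; rewrite -(setCK (\bigcap_n _)) setC_bigcap; apply: salg_C.
by apply: salg_U => n; apply: salg_C.
Qed.

Lemma salg_U_cond (Q : set nat) (F : nat -> set X) :
  (forall n, Q n -> G (F n)) -> G (\bigcup_(n in Q) F n).
Proof.
move=> GF; rewrite bigcup_mkcond; apply: salg_U => n.
by case: ifPn => [|_]; [rewrite inE; exact: GF|exact: salg_0].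
Qed.

Lemma salg_D (A B : set X) : G A -> G B -> G (A `\` B).
Proof. by move=> GA GB; apply: salg_I => //; exact: salg_C. Qed.

End sigma_algebra_facts.

(** Lets the closure lemmas for measurable functions be applied to a sub-sigma-algebra given as a
    set of events. *)
Lemma measurable_fun_salgE (X : pointedType) (G : set (set X)) d (Y : measurableType d)
  (f : X -> Y) : sigma_algebra setT G ->
  measurable_fun (setT : set (g_sigma_algebraType G)) f <->
  (forall A, measurable A -> G (f @^-1` A)).
Proof.
move=> sG; split=> [mf A mA|Gf mT A mA].
  by have := mf measurableT _ mA; rewrite setTI /measurable /= sigma_algebra_id.
by rewrite setTI /measurable /= sigma_algebra_id//; exact: Gf.
Qed.

Section pi_lambda.
Context d (Omega : measurableType d) (R : realType) (P : probability Omega R).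

(* The Dynkin class argument behind both independence ([f = g = id]) and
   identification of laws ([A = setT]). *)
Lemma product_rule_generated (X : Type) (G : set (set X)) (f g : Omega -> X)
    (A : set Omega) : measurable A -> setI_closed G ->
  (forall E, G E -> [/\ measurable (f @^-1` E), measurable (g @^-1` E)
     & P (A `&` f @^-1` E) = (P A * P (g @^-1` E))%E]) ->
  forall E, <<s G >> E -> [/\ measurable (f @^-1` E), measurable (g @^-1` E)
     & P (A `&` f @^-1` E) = (P A * P (g @^-1` E))%E].
Proof.
move=> mA GI HG E; rewrite -setI_closed_g_dynkin_g_sigma_algebra//.
move=> /(_ [set E | [/\ measurable (f @^-1` E), measurable (g @^-1` E)
  & P (A `&` f @^-1` E) = (P A * P (g @^-1` E))%E]]); apply; split; last by [].
split => /=.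
- rewrite !preimage_setT; split => //.
  by rewrite setIT -[P setT]/(P [set: Omega]) probability_setT mule1.
- move=> B [mf mg PB] /=; rewrite -!preimage_setC; split; [exact: measurableC|exact: measurableC|].
  rewrite -setDE measureD//; last by rewrite -ge0_fin_numE ?fin_num_measure.
  transitivity (P A - P A * P (g @^-1` B))%E; first by congr (_ - _)%E.
  rewrite -setTD measureD//; last by rewrite -ge0_fin_numE ?fin_num_measure.
  rewrite setTI; transitivity (P A * (1 - P (g @^-1` B)))%E.
    by rewrite muleBr ?mule1 ?fin_num_measure// fin_num_adde_defl ?fin_num_measure.
  by congr (_ * (_ - _))%E; rewrite -[LHS](@probability_setT _ _ _ P).
- move=> F tF HF /=; rewrite !preimage_bigcup.
  have mf n : measurable (f @^-1` F n) by case: (HF n).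
  have mg n : measurable (g @^-1` F n) by case: (HF n).
  split; [exact: bigcupT_measurable|exact: bigcupT_measurable|].
  rewrite setI_bigcupr.
  rewrite measure_bigcup//; last 2 first.
  + by move=> n _; apply: measurableI.
  + apply/trivIsetP => i j _ _ ij; rewrite -subset0 => x [[_ fi] [_ fj]].
    by move/trivIsetP : tF => /(_ i j I I ij); rewrite -subset0; apply; split; [exact: fi|exact: fj].
  rewrite measure_bigcup//; last first.
    apply/trivIsetP => i j _ _ ij; rewrite -subset0 => x [fi fj].
    by move/trivIsetP : tF => /(_ i j I I ij); rewrite -subset0; apply; split; [exact: fi|exact: fj].
  have PA : P A = (fine (P A))%:E by rewrite fineK// fin_num_measure.
  rewrite PA -nneseriesZl//; apply: eq_eseriesr => n _.
  by rewrite -PA; case: (HF n).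
Qed.

End pi_lambda.

(** * Independence of the Brownian increments *)

Section cylinders.
Context (R : realType).

(** Conditions are indexed by coordinates and not by positions in [l], so repetitions in [l] are
    harmless. *)
Definition cylinder (I : eqType) : set (set (I -> R)) :=
  [set E | exists (l : seq I) (A : I -> set R),
    (forall i, measurable (A i)) /\ E = [set y | forall i, i \in l -> A i (y i)]].

(** The product sigma-algebra. *)
Definition path_space (I : eqType) := g_sigma_algebraType (@cylinder I).

Lemma cylinder_setI (I : eqType) : setI_closed (@cylinder I).
Proof.
move=> _ _ [l1 [A1 [mA1 ->]]] [l2 [A2 [mA2 ->]]].
pose B (l : seq I) (A : I -> set R) i := if i \in l then A i else setT.
exists (l1 ++ l2), (fun i => B l1 A1 i `&` B l2 A2 i); split.
  by move=> i; apply: measurableI; rewrite /B; case: ifP.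
apply/seteqP; split => y /=.
  move=> [h1 h2] i _; rewrite /B; split; case: ifP => // il; [exact: h1|exact: h2].
move=> h; split => i il.
  by have := h i; rewrite mem_cat il /= => /(_ isT) []; rewrite /B il.
by have := h i; rewrite mem_cat il orbT /= => /(_ isT) []; rewrite /B il.
Qed.

Lemma measurable_coord (I : eqType) (i : I) :
  measurable_fun (setT : set (path_space I)) (fun y : path_space I => y i).
Proof.
move=> _ A mA; rewrite setTI; apply: sub_sigma_algebra.
exists [:: i], (fun=> A); split => //; apply/seteqP; split => y /=.
  by move=> Ay j; rewrite inE => /eqP ->.
by apply; rewrite inE.
Qed.

Lemma measurable_fun_path d (X : measurableType d) (I : eqType) (f : X -> path_space I) :
  (forall i, measurable_fun setT (fun x => f x i)) -> measurable_fun setT f.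
Proof.
move=> mf; apply: (@measurability _ _ _ (path_space I) setT f (@cylinder I)) => //.
move=> _ [_ [l [A [mA ->]]] <-]; rewrite setTI.
elim: l => [|i l ih].
  rewrite [X in measurable X](_ : _ = setT)//.
  by apply/seteqP; split.
rewrite [X in measurable X](_ : _ = ((fun x => f x i) @^-1` A i) `&`
  (f @^-1` [set y | forall i, i \in l -> A i (y i)])).
  by apply: measurableI => //; rewrite -[X in measurable X]setTI; exact: mf.
apply/seteqP; split => x /=.
  move=> h; split; first by apply: h; rewrite inE eqxx.
  by move=> j jl; apply: h; rewrite inE jl orbT.
by move=> [h1 h2] j; rewrite inE => /orP[/eqP ->//|]; exact: h2.
Qed.

End cylinders.

Section grouping.
Context d (Omega : measurableType d) (R : realType) (P : probability Omega R).

Definition first_events (X : nat -> Omega -> R) (N : nat) : set (set Omega) :=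
  [set E | exists A : nat -> set R, (forall k, measurable (A k)) /\
    E = \bigcap_(k in `I_N) (X k @^-1` A k)].

Lemma first_events_setI X N : setI_closed (first_events X N).
Proof.
move=> _ _ [A [mA ->]] [B [mB ->]]; exists (fun k => A k `&` B k); split.
  by move=> k; exact: measurableI.
apply/seteqP; split => w /=.
  by move=> [h1 h2] k kN; split; [exact: h1|exact: h2].
by move=> h; split => k kN; have [] := h k kN.
Qed.

Lemma measurable_first_events X N : (forall k, measurable_fun setT (X k)) ->
  first_events X N `<=` measurable.
Proof.
move=> mX _ [A [mA ->]]; apply: fin_bigcap_measurable; first exact: finite_II.
by move=> k _; rewrite -[X in measurable X]setTI; exact: mX.
Qed.

(** On cylinders only finitely many variables occur and the finite product rule applies; Dynkin
    arguments extend it first in [E], then in [A]. For gaps, [X'] is [X] itself; for Brownian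
    increments it is the sequence started at time 0. *)
Lemma independent_tail (X X' : nat -> Omega -> R) (N : nat) :
  (forall k, measurable_fun setT (X k)) -> (forall k, measurable_fun setT (X' k)) ->
  mutually_independent P X -> mutually_independent P X' ->
  (forall k A, measurable A -> P (X (N + k)%N @^-1` A) = P (X' k @^-1` A)) ->
  forall A E, <<s first_events X N >> A -> <<s @cylinder R nat >> E ->
  P (A `&` (fun w k => X (N + k)%N w) @^-1` E) =
  (P A * P ((fun w k => X' k w) @^-1` E))%E.
Proof.
move=> mX mX' iX iX' XX' A E sA sE.
have mY : measurable_fun setT (fun w => (fun k => X (N + k)%N w) : path_space R nat).
  by apply: measurable_fun_path => k; exact: mX.
have mY' : measurable_fun setT (fun w => (fun k => X' k w) : path_space R nat).
  by apply: measurable_fun_path => k; exact: mX'.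
have mYE E' : <<s @cylinder R nat >> E' -> measurable ((fun w k => X (N + k)%N w) @^-1` E').
  by move=> sE'; rewrite -[X in measurable X]setTI; exact: mY.
have mYE' E' : <<s @cylinder R nat >> E' -> measurable ((fun w k => X' k w) @^-1` E').
  by move=> sE'; rewrite -[X in measurable X]setTI; exact: mY'.
have base B : first_events X N B ->
    P (B `&` (fun w k => X (N + k)%N w) @^-1` E) =
    (P B * P ((fun w k => X' k w) @^-1` E))%E.
  move=> FB; have mB := measurable_first_events mX FB.
  have [|_ _ //] := @product_rule_generated _ _ _ P _ (@cylinder R nat)
    (fun w k => X (N + k)%N w) (fun w k => X' k w) B mB (@cylinder_setI R nat) _ _ sE.
  move=> E' cE'; split; [by apply: mYE; exact: sub_sigma_algebra|
    by apply: mYE'; exact: sub_sigma_algebra|].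
  case: cE' => l [C [mC ->]]; case: FB => D [mD ->{B mB}].
  pose n := (\max_(k <- l) k).+1.
  have ln k : k \in l -> (k < n)%N by move=> kl; rewrite ltnS leq_bigmax_seq.
  pose C' k := if k \in l then C k else setT.
  have mC' k : measurable (C' k) by rewrite /C'; case: ifP.
  have CC' (Z : nat -> Omega -> R) :
      (fun w k => Z k w) @^-1` [set y | forall i, i \in l -> C i (y i)] =
      \bigcap_(k in `I_n) (Z k @^-1` C' k).
    apply/seteqP; split => w /=.
      by move=> h k _; rewrite /C' /=; case: ifP => // kl; exact: h.
    by move=> h k kl; have := h k (ln _ kl); rewrite /C' kl.
  rewrite (CC' X') (CC' (fun k => X (N + k)%N)).
  pose H k := if (k < N)%N then D k else C' (k - N)%N.
  have NkN k : (N + k < N)%N = false by rewrite ltnNge leq_addr.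
  have mH k : measurable (H k) by rewrite /H; case: ifP.
  transitivity (P (\bigcap_(k in `I_(N + n)) (X k @^-1` H k))).
    congr (P _); apply/seteqP; split => w /=.
      move=> [h1 h2] k; rewrite /H /=; case: (ltnP k N) => [kN _|Nk kn]; first exact: (h1 k kN).
      have knN : (k - N < n)%N by rewrite ltn_subLR.
      by have := h2 (k - N)%N knN; rewrite /= subnKC.
    move=> h; split => k /= kn.
      by have := h k; rewrite /H /= kn; apply; rewrite ltn_addr.
    have := h (N + k)%N; rewrite /H /= NkN addKn; apply.
    by rewrite ltn_add2l.
  rewrite iX// iX'// iX// big_split_ord/=; congr (_ * _)%E.
    by apply: eq_bigr => k _; rewrite /H /= ltn_ord.
  apply: eq_bigr => k _; by rewrite /H /= NkN addKn XX'.
(* The second Dynkin argument produces the probability of the tail event as a factor; this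
   identifies it. *)
have law : P ((fun w k => X (N + k)%N w) @^-1` E) = P ((fun w k => X' k w) @^-1` E).
  have := base setT; rewrite setTI -[P setT]/(P [set: Omega]) probability_setT mul1e; apply.
  by exists (fun=> setT); split=> //; apply/seteqP; split.
have [|_ _] := @product_rule_generated _ _ _ P _ (first_events X N) id id
  _ (mYE _ sE) (@first_events_setI X N) _ _ sA.
  move=> B FB; rewrite preimage_id; have mB := measurable_first_events mX FB; split=> //.
  by rewrite setIC base// law muleC.
by rewrite preimage_id setIC muleC law.
Qed.

End grouping.

(** Indexed by pairs and not by rationals, so that the successor of a given time in the grid of mesh
    [1 / (m + 1)] has an explicit index. *)
Definition grid_time (R : realType) (q : nat * nat) : R := q.2%:R / q.1.+1%:R.

Lemma grid_time_ge0 (R : realType) q : 0 <= grid_time R q.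
Proof. by rewrite /grid_time divr_ge0. Qed.

(** The product of the denominators puts finitely many grid times on one uniform grid, where the
    noise is a function of consecutive increments. *)
Lemma grid_times_common (R : realType) (l : seq (nat * nat)) :
  exists D : nat, exists j : nat * nat -> nat, (0 < D)%N /\
  forall q, q \in l -> grid_time R q = (j q)%:R / D%:R.
Proof.
pose D := (\prod_(q <- l) q.1.+1)%N.
have D0 : (0 < D)%N by rewrite prodn_gt0.
exists D, (fun q => q.2 * (D %/ q.1.+1))%N; split=> // q ql.
have dv : (q.1.+1 %| D)%N by rewrite /D (big_rem q ql) /= dvdn_mulr.
have {2}-> : D = (D %/ q.1.+1 * q.1.+1)%N by rewrite divnK.
have D1 : ((D %/ q.1.+1)%N%:R : R) != 0.
  by rewrite pnatr_eq0 -lt0n divn_gt0// dvdn_leq.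
have q1 : (q.1.+1%:R : R) != 0 by rewrite pnatr_eq0.
rewrite /grid_time !natrM; apply/eqP; rewrite eqr_div ?mulf_neq0//.
by rewrite mulrA.
Qed.

(** * Brownian increments after a deterministic time *)

Section brownian_noise.
Context d (Omega : measurableType d) (R : realType) (P : probability Omega R).
Context (W : R -> Omega -> R).
Hypothesis bmW : standard_brownian_motion P W.

Definition brownian_noise (s : R) (w : Omega) : path_space R (nat * nat)%type :=
  fun q => W (s + grid_time R q) w - W s w.

Definition past_events (s : R) : set (set Omega) :=
  [set E | exists (l : seq R) (A : R -> set R),
    [/\ forall u, u \in l -> 0 <= u <= s, forall u, measurable (A u) &
    E = [set w | forall u, u \in l -> A u (W u w)]]].

Lemma past_events_setI s : setI_closed (past_events s).
Proof.
move=> _ _ [l1 [A1 [h1 mA1 ->]]] [l2 [A2 [h2 mA2 ->]]].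
pose B (l : seq R) (A : R -> set R) i := if i \in l then A i else setT.
exists (l1 ++ l2), (fun i => B l1 A1 i `&` B l2 A2 i); split.
- by move=> u; rewrite mem_cat => /orP[/h1|/h2].
- by move=> i; apply: measurableI; rewrite /B; case: ifP.
apply/seteqP; split => y /=.
  move=> [k1 k2] i _; rewrite /B; split; case: ifP => // il; [exact: k1|exact: k2].
move=> h; split => i il.
  by have := h i; rewrite mem_cat il /= => /(_ isT) []; rewrite /B il.
by have := h i; rewrite mem_cat il orbT /= => /(_ isT) []; rewrite /B il.
Qed.

Lemma measurable_finite_events (I : eqType) (Z : I -> Omega -> R) (l : seq I) (A : I -> set R) :
  (forall i, i \in l -> measurable_fun setT (Z i)) -> (forall i, measurable (A i)) ->
  measurable [set w | forall i, i \in l -> A i (Z i w)].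
Proof.
move=> mZ mA; elim: l mZ => [|i l ih] mZ.
  by rewrite [X in measurable X](_ : _ = setT)//; apply/seteqP; split.
rewrite [X in measurable X](_ : _ = (Z i @^-1` A i) `&`
  [set w | forall i, i \in l -> A i (Z i w)]).
  apply: measurableI; last by apply: ih => j jl; apply: mZ; rewrite inE jl orbT.
  by rewrite -[X in measurable X]setTI; apply: mZ => //; rewrite inE eqxx.
apply/seteqP; split => x /=.
  move=> h; split; first by apply: h; rewrite inE eqxx.
  by move=> j jl; apply: h; rewrite inE jl orbT.
by move=> [h1 h2] j; rewrite inE => /orP[/eqP ->//|]; exact: h2.
Qed.

Lemma measurable_past_events s : past_events s `<=` measurable.
Proof.
move=> _ [l [A [hl mA ->]]]; apply: measurable_finite_events => // u /hl /andP[u0 _].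
exact: (bm_measurable bmW).
Qed.

Lemma measurable_brownian_noise s : 0 <= s -> measurable_fun setT (brownian_noise s).
Proof.
move=> s0; apply: measurable_fun_path => q; apply: measurable_funB.
  by apply: (bm_measurable bmW); rewrite addr_ge0// grid_time_ge0.
exact: (bm_measurable bmW).
Qed.

Let mnoise s E : 0 <= s -> <<s @cylinder R (nat * nat)%type >> E ->
  measurable (brownian_noise s @^-1` E).
Proof.
by move=> s0 sE; rewrite -[X in measurable X]setTI; exact: measurable_brownian_noise.
Qed.

Let telescope (tau : nat -> R) (n i : nat) w :
  \sum_(k < i) (W (tau (n + k.+1)%N) w - W (tau (n + k)%N) w) =
  W (tau (n + i)%N) w - W (tau n) w.
Proof.
elim: i => [|i ih]; first by rewrite big_ord0 addn0 subrr.
by rewrite big_ord_recr /= ih; ring.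
Qed.


(** The Markov property at a fixed time. On generating events, one sequence of times runs through
    the past times and then through [s + k / D]; the past depends on its first increments, the noise
    on the later ones, whose law does not depend on [s]. *)
Lemma brownian_noise_independent (s : R) A E : 0 <= s -> <<s past_events s >> A ->
  <<s @cylinder R (nat * nat)%type >> E ->
  P (A `&` brownian_noise s @^-1` E) = (P A * P (brownian_noise 0 @^-1` E))%E.
Proof.
move=> s0 sA sE.
have main B E' : past_events s B -> @cylinder R (nat * nat)%type E' ->
    P (B `&` brownian_noise s @^-1` E') = (P B * P (brownian_noise 0 @^-1` E'))%E.
  move=> pB cE'; have mB := measurable_past_events pB.
  have mE' t : 0 <= t -> measurable (brownian_noise t @^-1` E').
    by move=> t0; apply: mnoise => //; exact: sub_sigma_algebra.
  case: pB mB => l [C [hl mC BE]] mB; case: cE' mE' => l2 [C2 [mC2 E'E]] mE'.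
  have [D [j [D0 hj]]] := grid_times_common R l2.
  have DR0 : (0 : R) < D%:R by rewrite ltr0n.
  (* With 0 added, each past value of [W] is a sum of increments, up to the null set where [W 0] is
     not 0. *)
  pose l' := sort <=%O (0 :: l).
  have sl' : sorted <=%O l' by apply: sort_sorted; exact: le_total.
  pose N := size l'.
  (* The index [N] gives [s] itself, so the increments with index below [N] are exactly those before
     [s]. *)
  pose tau k := if (k < N)%N then nth 0 l' k else s + (k - N)%:R / D%:R.
  have l's u : u \in l' -> 0 <= u <= s.
    by rewrite mem_sort inE => /orP[/eqP ->|/hl//]; rewrite lexx s0.
  have tauN k : tau (N + k)%N = s + k%:R / D%:R.
    by rewrite /tau ltnNge leq_addr /= addKn.
  have N0 : (0 < N)%N by rewrite /N size_sort.
  have tau0 : tau 0%N = 0.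
    rewrite /tau N0; have n0 : nth 0 l' 0 \in l' by rewrite mem_nth.
    apply/eqP; rewrite eq_le; case/andP : (l's _ n0) => -> _; rewrite andbT.
    have zl : 0 \in l' by rewrite mem_sort inE eqxx.
    rewrite -[leRHS](nth_index 0 zl); apply: le_sorted_leq_nth => //.
      by rewrite inE index_mem.
  have tau_nd k : tau k <= tau k.+1.
    rewrite /tau; case: ltnP => kN; case: ltnP => kN1.
    - by apply: le_sorted_leq_nth => //; rewrite inE.
    - apply: (@le_trans _ _ s); last by rewrite lerDl divr_ge0.
      by have /l's/andP[] : nth 0 l' k \in l' by rewrite mem_nth.
    - by move: kN; rewrite leqNgt (ltn_trans _ kN1).
    - by rewrite lerD2l ler_pM2r ?invr_gt0// ler_nat leq_sub2r.
  pose X k w := W (tau k.+1) w - W (tau k) w.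
  have tau_ge0 k : 0 <= tau k.
    by elim: k => [|k ih]; [rewrite tau0|exact: le_trans (tau_nd k)].
  have mX k : measurable_fun setT (X k).
    by apply: measurable_funB; exact: (bm_measurable bmW).
  have iX : mutually_independent P X.
    by apply: (bm_independent bmW); rewrite ?tau0.
  pose tau' (k : nat) : R := k%:R / D%:R.
  pose X' k w := W (tau' k.+1) w - W (tau' k) w.
  have tau'_ge0 k : 0 <= tau' k by rewrite divr_ge0.
  have tau'_lt k : tau' k < tau' k.+1.
    by rewrite ltr_pM2r ?invr_gt0// ltr_nat.
  have mX' k : measurable_fun setT (X' k).
    by apply: measurable_funB; exact: (bm_measurable bmW).
  have iX' : mutually_independent P X'.
    by apply: (bm_independent bmW) => // k; exact: ltW.
  (* Past times may repeat; from [s] on they increase strictly, as the Gaussian law requires. *)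
  have XX' k V : measurable V -> P (X (N + k)%N @^-1` V) = P (X' k @^-1` V).
    move=> mV.
    have lt1 : tau (N + k)%N < tau (N + k).+1.
      by rewrite -addnS !tauN ltrD2l; exact: tau'_lt.
    rewrite (bm_gaussian bmW (tau_ge0 (N + k)%N) lt1 mV).
    rewrite (bm_gaussian bmW (tau'_ge0 k) (tau'_lt k) mV).
    by rewrite -addnS !tauN opprD addrACA subrr add0r.
  (* [B] is almost surely the event [B'] on the increments, since [W 0 = 0] a.s. *)
  pose B' := [set w | forall i : nat, i \in iota 0 N ->
    (if nth 0 l' i \in l then C (nth 0 l' i) else setT) (\sum_(k < i) X k w)].
  have sB' : <<s first_events X N >> B'.
    have -> : B' = \bigcap_i [set w | (i < N)%N ->
      (if nth 0 l' i \in l then C (nth 0 l' i) else setT) (\sum_(k < i) X k w)].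
      apply/seteqP; split => w /=.
        by move=> h i _ iN; apply: h; rewrite mem_iota.
      by move=> h i; rewrite mem_iota add0n => /= iN; exact: h.
    have sS := smallest_sigma_algebra setT (first_events X N).
    apply: salg_Icap => // i.
    have [iN|iN] := ltnP i N; last first.
      rewrite [X in <<s _ >> X](_ : _ = setT); first exact: salg_T.
      by apply/seteqP; split.
    rewrite [X in <<s _ >> X](_ : _ = (fun w => \sum_(k < i) X k w) @^-1`
      (if nth 0 l' i \in l then C (nth 0 l' i) else setT)); last first.
      by apply/seteqP; split => w /=; [exact|move=> ? _].
    apply: (proj1 (measurable_fun_salgE (fun w => \sum_(k < i) X k w) sS) _ _); last by case: ifP.
    apply: measurable_sum => k.
    apply: (proj2 (measurable_fun_salgE (X k) sS)) => V mV.
    apply: sub_sigma_algebra.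
    exists (fun k' => if k' == k :> nat then V else setT); split.
      by move=> k'; case: ifP.
    apply/seteqP; split => w /=.
      by move=> Vw k' _ /=; case: eqP => //= ->.
    have kN : (k < N)%N by exact: ltn_trans iN.
    by move=> /(_ k kN) /=; rewrite eqxx.
  have mB' : measurable B' by exact: (smallest_sub (@sigma_algebra_measurable _ Omega) (@measurable_first_events _ _ R X N mX)).
  pose V2 := [set y : nat -> R | forall q, q \in l2 -> C2 q (\sum_(k < j q) y k)].
  have sV2 : <<s @cylinder R nat >> V2.
    have -> : V2 = (fun y : path_space R nat => (fun q => \sum_(k < j q) y k) : path_space R (nat * nat)%type) @^-1` E'.
      by rewrite E'E.
    rewrite -[X in <<s _ >> X]setTI.
    have : measurable_fun setT (fun y : path_space R nat => (fun q => \sum_(k < j q) y k) : path_space R (nat * nat)%type).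
      apply: measurable_fun_path => q; apply: measurable_sum => k.
      exact: measurable_coord.
    by apply => //; rewrite E'E; apply: sub_sigma_algebra; exists l2, C2.
  have noiseE (Z : nat -> Omega -> R) t : 0 <= t ->
      (forall i w, \sum_(k < i) Z k w = W (t + i%:R / D%:R) w - W t w) ->
      brownian_noise t @^-1` E' = (fun w k => Z k w) @^-1` V2.
    move=> t0 hZ; rewrite E'E; apply/seteqP; split => w /= h q ql.
      by rewrite hZ -hj//; exact: h.
    by have := h q ql; rewrite hZ -hj.
  have nS : brownian_noise s @^-1` E' = (fun w k => X (N + k)%N w) @^-1` V2.
    apply: noiseE => // i w; under eq_bigr do rewrite /X -addnS.
    by rewrite telescope tauN -[in W (tau N) w](addn0 N) tauN mul0r addr0.
  have n0 : brownian_noise 0 @^-1` E' = (fun w k => X' k w) @^-1` V2.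
    apply: noiseE => // i w; rewrite add0r.
    elim: i => [|i ih]; first by rewrite big_ord0 /tau' mul0r subrr.
    by rewrite big_ord_recr /= ih /X' /tau'; ring.
  have [M [mM M0 hM]] := bm_start bmW.
  have W0 w : ~ M w -> W 0 w = 0.
    by move=> Mw; apply: contrapT => h; apply: Mw; exact: hM.
  have BB' w : ~ M w -> B w <-> B' w.
    move=> /W0 w0; have sumX i : (i < N)%N -> \sum_(k < i) X k w = W (nth 0 l' i) w.
      move=> iN; have tE : tau i = nth 0 l' i by rewrite /tau iN.
      have := telescope tau 0 i w; rewrite tau0 w0 subr0 add0n tE => <-.
      by apply: eq_bigr => k _; rewrite add0n.
    rewrite BE; split => /= h.
      move=> i; rewrite mem_iota add0n => /= iN; case: ifP => // il.
      by rewrite sumX//; exact: h.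
    move=> u ul; have ul' : u \in l' by rewrite mem_sort inE ul orbT.
    have iN : (index u l' < N)%N by rewrite index_mem.
    have := h (index u l'); rewrite mem_iota add0n => /(_ iN).
    by rewrite nth_index// ul sumX// nth_index.
  have -> : P B = P B' by exact: (measure_eq_off_null mB mB' mM M0 BB').
  rewrite n0 -(independent_tail mX mX' iX iX' XX' sB' sV2) -nS.
  apply: (measure_eq_off_null _ _ mM M0).
  - by apply: measurableI => //; exact: mE'.
  - by apply: measurableI => //; exact: mE'.
  - by move=> w /BB' h; split => -[/h].
have base B : past_events s B ->
    P (B `&` brownian_noise s @^-1` E) = (P B * P (brownian_noise 0 @^-1` E))%E.
  move=> pB; have mB := measurable_past_events pB.
  have [|_ _ //] := @product_rule_generated _ _ _ P _ (@cylinder R (nat * nat)%type)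
    (brownian_noise s) (brownian_noise 0) B mB (@cylinder_setI R _) _ _ sE.
  move=> E' cE'; split; [apply: mnoise => //; exact: sub_sigma_algebra|
    apply: mnoise => //; exact: sub_sigma_algebra|exact: main].
have law : P (brownian_noise s @^-1` E) = P (brownian_noise 0 @^-1` E).
  have := base setT; rewrite setTI -[P setT]/(P [set: Omega]) probability_setT mul1e; apply.
  exists [::], (fun=> setT); split => //.
  by apply/seteqP; split.
have [|_ _] := @product_rule_generated _ _ _ P _ (past_events s) id id
  _ (mnoise s0 sE) (@past_events_setI s) _ _ sA.
  move=> B pB; rewrite preimage_id; have mB := measurable_past_events pB; split=> //.
  by rewrite setIC base// law muleC.
by rewrite preimage_id setIC muleC law.
Qed.

End brownian_noise.

(** * Approximation along grids and measurability tools *)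

Section grid.
Context (R : realType).

(** The first point of the grid of mesh [1 / (m + 1)] strictly after [u]. Approximation from the
    right fits a right-continuous filtration. *)
Definition grid_succ (m : nat) (u : R) : R := (Num.truncn (u * m.+1%:R)).+1%:R / m.+1%:R.

Lemma grid_succ_gt m u : 0 <= u -> u < grid_succ m u.
Proof.
move=> u0; rewrite ltr_pdivlMr// ?ltr0n//.
by have /Num.Theory.truncn_itv /andP[] : 0 <= u * m.+1%:R by rewrite mulr_ge0.
Qed.

Lemma grid_succ_le m u : 0 <= u -> grid_succ m u <= u + m.+1%:R^-1.
Proof.
move=> u0; rewrite /grid_succ -natr1 mulrDl mul1r lerD2r ler_pdivrMr ?ltr0n//.
by have /Num.Theory.truncn_itv /andP[] : 0 <= u * m.+1%:R by rewrite mulr_ge0.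
Qed.

Lemma cvg_grid_succ u : 0 <= u -> grid_succ m u @[m --> \oo] --> u.
Proof.
move=> u0; apply: (@squeeze_cvgr _ _ _ _ (cst u) (fun m => u + m.+1%:R^-1)).
- by apply: nearW => m; rewrite ltW ?grid_succ_gt//= grid_succ_le.
- exact: cvg_cst.
- by rewrite -[X in _ --> X]addr0; apply: cvgD; [exact: cvg_cst|exact: cvg_harmonic].
Qed.

Lemma within_cvg_seq (f : R -> R) (v : nat -> R) (u : R) :
  {within `[0, +oo[%classic, continuous f} -> 0 <= u -> (forall m, 0 <= v m) ->
  v m @[m --> \oo] --> u -> f (v m) @[m --> \oo] --> f u.
Proof.
move=> /subspace_continuousP fc u0 v0 vu.
have fu : f @ within `[0, +oo[%classic (nbhs u) --> f u.
  by apply: fc; rewrite /= in_itv /= andbT.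
apply: (cvg_comp v f _ fu) => A; rewrite /within /= => /vu [n _ nA].
by exists n => // m /nA; apply; rewrite /= in_itv /= andbT.
Qed.

Lemma measurable_truncn : measurable_fun (setT : set R) (fun u => (Num.truncn u)%:R : R).
Proof.
apply: nondecreasing_measurable => // x y xy.
by rewrite ler_nat; apply: Num.Theory.le_truncn.
Qed.

Lemma measurable_truncn_eq d (X : measurableType d) (U : X -> R) j :
  measurable_fun setT U -> measurable [set x | Num.truncn (U x) = j].
Proof.
move=> mU.
have m1 : measurable_fun setT (fun x => (Num.truncn (U x))%:R : R).
  exact: measurableT_comp measurable_truncn mU.
rewrite [X in measurable X](_ : _ = (fun x => (Num.truncn (U x))%:R : R) @^-1` [set j%:R]).
  by rewrite -[X in measurable X]setTI; exact: m1.
by apply/seteqP; split=> x /= [] => [->//|/eqP]; rewrite eqr_nat => /eqP.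
Qed.

(** With [k] the cell of a random time, this samples a process at a random grid point. *)
Lemma measurable_fun_index d d' (X : measurableType d) (Y : measurableType d')
  (k : X -> nat) (h : nat -> X -> Y) :
  (forall j, measurable [set x | k x = j]) -> (forall j, measurable_fun setT (h j)) ->
  measurable_fun setT (fun x => h (k x) x).
Proof.
move=> mk mh _ A mA; rewrite setTI.
rewrite [X in measurable X](_ : _ = \bigcup_j ([set x | k x = j] `&` h j @^-1` A)).
  apply: bigcupT_measurable => j; apply: measurableI => //.
  by rewrite -[X in measurable X]setTI; exact: mh.
by apply/seteqP; split=> x /= => [Ax|[j _ [<-]]//]; exists (k x).
Qed.

(** [I] is enumerated by its codes; a number that codes nothing contributes [-oo], which does not
    affect the supremum. *)
Lemma measurable_ereal_sup d (X : measurableType d) (I : countType) (f : I -> X -> \bar R) :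
  (forall i, measurable_fun setT (f i)) ->
  measurable_fun setT (fun x => ereal_sup [set f i x | i in setT]).
Proof.
move=> mf; pose g n x := if @unpickle I n is Some i then f i x else -oo%E.
rewrite [X in measurable_fun _ X](_ : _ = (fun x => esups (g^~ x) 0%N)).
  by apply: measurable_fun_esups => n; rewrite /g; case: unpickle.
apply/funext => x; apply/eqP; rewrite eq_le; apply/andP; split.
  apply: ge_ereal_sup => _ [i _ <-]; apply: ereal_sup_ubound.
  by exists (pickle i) => //; rewrite /g pickleK.
apply: ge_ereal_sup => _ [n _ <-]; rewrite /g; case: unpickle => [i|].
  by apply: ereal_sup_ubound; exists i.
exact: leNye.
Qed.

End grid.

Section random_time.
Context d (Omega : measurableType d) (R : realType) (P : probability Omega R).
Context (W : R -> Omega -> R) (N0 : set Omega).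
Hypothesis Pc : measure_is_complete P.
Hypothesis mW : forall t, 0 <= t -> measurable_fun setT (W t).
Hypotheses (mN0 : measurable N0) (PN0 : P N0 = 0%E).
Hypothesis Wc : forall w, ~ N0 w -> {within `[0, +oo[%classic, continuous (W ^~ w)}.

(** The samples of [W] at the grid points after [U] are measurable, and their limit superior is [W]
    at [U] off [N0]. Completeness of [P] transfers measurability across [N0]. *)
Lemma measurable_random_time (U : Omega -> R) : measurable_fun setT U ->
  (forall w, 0 <= U w) -> measurable_fun setT (fun w => W (U w) w).
Proof.
move=> mU U0.
pose f m w := (W (grid_succ m (U w)) w)%:E.
have mf m : measurable_fun setT (f m).
  apply/measurable_EFinP.
  apply: (@measurable_fun_index _ _ _ _ (fun w => Num.truncn (U w * m.+1%:R))
    (fun j w => W (j.+1%:R / m.+1%:R) w)).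
    by move=> j; apply: measurable_truncn_eq; exact: measurable_funM.
  by move=> j; apply: mW; rewrite divr_ge0.
apply/measurable_EFinP.
apply: (@ae_measurable_fun _ _ _ P Pc setT (fun w => limn_esup (f^~ w))); last first.
  exact: measurable_fun_limn_esup.
exists N0; split=> // w /= h; apply: contrapT => Nw; apply: h => _.
have : f m w @[m --> \oo] --> (W (U w) w)%:E.
  apply: cvg_EFin; first by apply: nearW.
  apply: (@within_cvg_seq _ (W^~ w) _ _ (Wc Nw)) => //.
    by move=> m; rewrite divr_ge0.
  exact: cvg_grid_succ.
by move=> /cvg_limn_einf_sup [_ ->].
Qed.

End random_time.

Lemma sigma_generated_salg d0 d1 (Omega : measurableType d0) (E : measurableType d1)
  (I : Type) (D : set I) (X : I -> Omega -> E) : sigma_algebra setT (sigma_generated D X).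
Proof. exact: smallest_sigma_algebra. Qed.

Lemma sigma_generated_mem d0 d1 (Omega : measurableType d0) (E : measurableType d1)
  (I : Type) (D : set I) (X : I -> Omega -> E) i A : D i -> measurable A ->
  sigma_generated D X (X i @^-1` A).
Proof.
move=> Di mA; apply: sub_sigma_algebra; exists i => //.
by exists A => //; rewrite setTI.
Qed.

(** * Renewal times and the noise after an arrival *)

Section renewal.
Context d (Omega : measurableType d) (R : realType) (P : probability Omega R).
Context (F : probability (measurableTypeR R) R) (T : nat -> Omega -> R).
Hypothesis rtT : renewal_times P F T.

Definition gap (k : nat) (w : Omega) : R := T k.+1 w - T k w.

Lemma gap_gt0 k w : 0 < gap k w.
Proof. by rewrite subr_gt0 (rt_increasing rtT). Qed.

Lemma measurable_gap k : measurable_fun setT (gap k).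
Proof. by apply: measurable_funB; exact: (rt_measurable rtT). Qed.

Lemma renewal_sum k w : T k w = \sum_(j < k) gap j w.
Proof.
elim: k => [|k ih]; first by rewrite big_ord0 (rt_start rtT).
by rewrite big_ord_recr /= -ih /gap addrC subrK.
Qed.

Lemma renewal_le j k w : (j <= k)%N -> T j w <= T k w.
Proof.
elim: k => [|k ih]; first by rewrite leqn0 => /eqP ->.
rewrite leq_eqVlt => /orP[/eqP ->//|]; rewrite ltnS => /ih h.
by apply: (le_trans h); apply: ltW; exact: (rt_increasing rtT).
Qed.

Lemma renewal_ge0 k w : 0 <= T k w.
Proof. by rewrite -(rt_start rtT w) renewal_le. Qed.

Lemma counting_processE k t w : t < T k.+1 w ->
  counting_process T t w = (\sum_(j < k) ((T j.+1 w <= t)%R%:R : R))%:E.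
Proof.
move=> tT; rewrite /counting_process (nneseries_split 0 k)//.
rewrite add0n eseries0 ?adde0; last first.
  move=> i ki _; rewrite leNgt (lt_le_trans tT)//.
  by apply: renewal_le; rewrite ltnS.
by rewrite big_mkord sumEFin.
Qed.

(** The duality that makes arrival times measurable for the counting process. *)
Lemma counting_process_ge k t w : (k.+1%:R%:E <= counting_process T t w)%E = (T k.+1 w <= t).
Proof.
apply/idP/idP => h.
  rewrite leNgt; apply/negP => tT; move: h; rewrite (counting_processE tT) lee_fin.
  apply/negP; rewrite -ltNge (@le_lt_trans _ _ k%:R)// ?ltr_nat//.
  rewrite -[X in _ <= X%:R](card_ord k) -sum1_card natr_sum ler_sum// => i _.
  by rewrite ler_nat leq_b1.
have nn i : (0 <= (T i.+1 w <= t)%R%:R%:E :> \bar R)%E by rewrite lee_fin.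
apply: (@le_trans _ _ (\sum_(0 <= j < k.+1) (T j.+1 w <= t)%R%:R%:E)%E).
  rewrite big_mkord sumEFin lee_fin -[X in X%:R <= _](card_ord k.+1) -sum1_card natr_sum.
  by apply: ler_sum => i _; rewrite (le_trans _ h)// renewal_le.
exact: nneseries_lim_ge.
Qed.

Lemma renewal_counting_measurable k (A : set R) : measurable A ->
  sigma_generated `[0, +oo[ (counting_process T) (T k @^-1` A).
Proof.
have sN := sigma_generated_salg `[0, +oo[ (counting_process T).
move: A; apply/(measurable_fun_salgE _ sN).
apply: (measurability _ (RGenOInfty.measurableE R)) => _ [_ [a ->] <-].
rewrite setTI /measurable /= sigma_algebra_id//.
have -> : T k @^-1` `]a, +oo[ = ~` [set w | T k w <= a].
  by apply/seteqP; split=> w /=; rewrite in_itv /= andbT; [move=> + h; rewrite ltNge h|move=> /negP; rewrite -ltNge].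
apply: (salg_C sN).
have [a0|a0] := ltP a 0.
  rewrite [X in sigma_generated _ _ X](_ : _ = set0); first exact: (salg_0 sN).
  by apply/seteqP; split => w //= h; have := renewal_ge0 k w; rewrite leNgt (le_lt_trans h).
case: k => [|k].
  rewrite [X in sigma_generated _ _ X](_ : _ = setT); first exact: (salg_T sN).
  by apply/seteqP; split => w //= _; rewrite (rt_start rtT).
rewrite [X in sigma_generated _ _ X](_ : _ = counting_process T a @^-1` [set x | (k.+1%:R%:E <= x)%E]).
  apply: sigma_generated_mem; first by rewrite /= in_itv /= andbT.
  rewrite [X in measurable X](_ : _ = `[k.+1%:R%:E, +oo[%classic); first exact: emeasurable_itv.
  by apply/seteqP; split => x /=; rewrite in_itv /= andbT.
by apply/seteqP; split => w /=; rewrite counting_process_ge.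
Qed.

Lemma first_gaps_counting_measurable k :
  <<s first_events gap k >> `<=` sigma_generated `[0, +oo[ (counting_process T).
Proof.
have sN := sigma_generated_salg `[0, +oo[ (counting_process T).
apply: smallest_sub => // _ [A [mA ->]].
elim: k => [|k ih].
  rewrite [X in sigma_generated _ _ X](_ : _ = setT); first exact: (salg_T sN).
  by apply/seteqP; split.
rewrite [X in sigma_generated _ _ X](_ : _ = (\bigcap_(k0 in `I_k) (gap k0 @^-1` A k0)) `&` gap k @^-1` A k).
  apply: (salg_I sN) => //.
  move: (A k) (mA k); apply/(measurable_fun_salgE _ sN).
  by apply: measurable_funB; apply/(measurable_fun_salgE _ sN); exact: renewal_counting_measurable.
apply/seteqP; split => w /=.
  move=> h; split; last exact: (h k (ltnSn k)).
  by move=> j jk; apply: (h j); exact: ltnW.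
move=> [h1 h2] j /=; rewrite ltnS leq_eqVlt => /orP[/eqP ->//|jk]; exact: (h1 j jk).
Qed.

Lemma first_gaps_renewal k j (A : set R) : (j <= k)%N -> measurable A ->
  <<s first_events gap k >> (T j @^-1` A).
Proof.
move=> jk; have sN := smallest_sigma_algebra setT (first_events gap k).
move: A; apply/(measurable_fun_salgE _ sN).
rewrite (_ : T j = fun w => \sum_(i < j) gap i w); last first.
  by apply/funext => w; exact: renewal_sum.
apply: measurable_sum => i.
apply: (proj2 (measurable_fun_salgE (gap i) sN)) => V mV; apply: sub_sigma_algebra.
exists (fun k' => if k' == i :> nat then V else setT); split.
  by move=> k'; case: ifP.
apply/seteqP; split => w /=.
  by move=> Vw k' _ /=; case: eqP => //= ->.
by move=> /(_ i (leq_trans (ltn_ord i) jk)) /=; rewrite eqxx.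
Qed.

Lemma gap_law k (A : set R) : measurable A -> P (gap k @^-1` A) = F A.
Proof. exact: (rt_law rtT). Qed.

(** The event on the gap [k] is a cylinder on coordinate 0 of the tail that starts at [k]. *)
Lemma gap_independent k A (B : set R) : <<s first_events gap k >> A -> measurable B ->
  P (A `&` gap k @^-1` B) = (P A * P (gap 0 @^-1` B))%E.
Proof.
move=> sA mB.
pose E := (fun y : path_space R nat => y 0%N) @^-1` B.
have sE : <<s @cylinder R nat >> E.
  by rewrite -[E]setTI; exact: (@measurable_coord R nat 0%N measurableT B mB).
have := @independent_tail _ _ _ P gap gap k measurable_gap measurable_gap
  (rt_independent rtT) (rt_independent rtT) _ A E sA sE.
rewrite /E /preimage /= addn0; apply => j V mV.
by rewrite !gap_law.
Qed.

End renewal.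

(** * Joint past of the Brownian motion and the renewal process *)

Section joint_past.
Context d (Omega : measurableType d) (R : realType) (P : probability Omega R).
Context (W : R -> Omega -> R).
Context (F : probability (measurableTypeR R) R) (T : nat -> Omega -> R).
Hypothesis bmW : standard_brownian_motion P W.
Hypothesis rtT : renewal_times P F T.
Hypothesis WN : independent_systems P (sigma_generated `[0, +oo[ W)
    (sigma_generated `[0, +oo[ (counting_process T)).

(** The first [k] gaps are included even if they end after [s]. Independence of [W] and the counting
    process makes this harmless, and it decouples the Brownian time from the arrival index. *)
Definition joint_events (s : R) (k : nat) : set (set Omega) :=
  [set A `&` B | A in past_events W s & B in first_events (gap T) k].

Definition joint_past s k := <<s joint_events s k >>.

Lemma joint_past_salg s k : sigma_algebra setT (joint_past s k).
Proof. exact: smallest_sigma_algebra. Qed.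

Lemma joint_events_setI s k : setI_closed (joint_events s k).
Proof.
move=> _ _ [A1 pA1 [B1 fB1 <-]] [A2 pA2 [B2 fB2 <-]]; rewrite setIACA.
exists (A1 `&` A2); first exact: past_events_setI.
by exists (B1 `&` B2) => //; exact: first_events_setI.
Qed.

Lemma measurable_joint_events s k : joint_events s k `<=` measurable.
Proof.
move=> _ [A pA [B fB <-]]; apply: measurableI; first exact: (measurable_past_events bmW pA).
exact: (measurable_first_events (measurable_gap rtT) fB).
Qed.

Lemma measurable_joint_past s k : joint_past s k `<=` measurable.
Proof.
exact: (smallest_sub (@sigma_algebra_measurable _ Omega) (@measurable_joint_events s k)).
Qed.

Lemma past_sub_joint s k : <<s past_events W s >> `<=` joint_past s k.
Proof.
apply: sub_sigma_algebra2 => A pA; exists A => //; exists setT; last by rewrite setIT.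
by exists (fun=> setT); split=> //; apply/seteqP; split.
Qed.

Lemma first_gaps_sub_joint s k : <<s first_events (gap T) k >> `<=` joint_past s k.
Proof.
apply: sub_sigma_algebra2 => A pA; exists setT; last by exists A => //; rewrite setTI.
by exists [::], (fun=> setT); split => //; apply/seteqP; split.
Qed.

Lemma joint_past_le_gaps s k k' : (k <= k')%N -> joint_past s k `<=` joint_past s k'.
Proof.
move=> kk'; apply: sub_sigma_algebra2 => _ [A pA [B [C [mC ->]] <-]].
exists A => //; exists (\bigcap_(i in `I_k) (gap T i @^-1` C i)) => //.
exists (fun i => if (i < k)%N then C i else setT); split; first by move=> i; case: ifP.
apply/seteqP; split => w /= h i.
  by move=> ik' /=; case: ifP => // ik; exact: (h i ik).
by move=> ik; have := h i (leq_trans ik kk'); rewrite /= ik.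
Qed.

Let pastW s : <<s past_events W s >> `<=` sigma_generated `[0, +oo[ W.
Proof.
have sW := sigma_generated_salg `[0, +oo[ W.
apply: smallest_sub => // _ [l [A [hl mA ->]]].
elim: l hl => [|u l ih] hl.
  rewrite [X in sigma_generated _ _ X](_ : _ = setT); first exact: (salg_T sW).
  by apply/seteqP; split.
rewrite [X in sigma_generated _ _ X](_ : _ = (W u @^-1` A u) `&`
  [set w | forall v, v \in l -> A v (W v w)]).
  apply: (salg_I sW); last by apply: ih => v vl; apply: hl; rewrite inE vl orbT.
  apply: sigma_generated_mem => //; rewrite /= in_itv /= andbT.
  by have /hl/andP[] : u \in u :: l by rewrite inE eqxx.
apply/seteqP; split => x /=.
  move=> h; split; first by apply: h; rewrite inE eqxx.
  by move=> j jl; apply: h; rewrite inE jl orbT.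
by move=> [h1 h2] j; rewrite inE => /orP[/eqP ->//|]; exact: h2.
Qed.

Let noiseW s E : 0 <= s -> <<s @cylinder R (nat * nat)%type >> E ->
  sigma_generated `[0, +oo[ W (brownian_noise W s @^-1` E).
Proof.
move=> s0; have sW := sigma_generated_salg `[0, +oo[ W.
have memW t : 0 <= t ->
    measurable_fun (setT : set (g_sigma_algebraType (sigma_generated `[0, +oo[ W))) (W t).
  move=> t0; apply: (proj2 (measurable_fun_salgE (W t) sW)) => A mA.
  by apply: sigma_generated_mem => //; rewrite /= in_itv /= andbT.
have mn : measurable_fun (setT : set (g_sigma_algebraType (sigma_generated `[0, +oo[ W)))
    (brownian_noise W s).
  apply: measurable_fun_path => q; apply: measurable_funB; apply: memW => //.
  by rewrite addr_ge0// grid_time_ge0.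
exact: (proj1 (measurable_fun_salgE (brownian_noise W s) sW) mn E).
Qed.

Let mnoise s E : 0 <= s -> <<s @cylinder R (nat * nat)%type >> E ->
  measurable (brownian_noise W s @^-1` E).
Proof.
move=> s0 sE; rewrite -[X in measurable X]setTI.
exact: (measurable_brownian_noise bmW s0 measurableT sE).
Qed.

(** On generating events, independence of [W] and the counting process splits off the gaps, the
    Markov property splits off the noise, and independence again reunites gaps and past. *)
Lemma joint_past_noise s k A E : 0 <= s -> joint_past s k A ->
  <<s @cylinder R (nat * nat)%type >> E ->
  P (A `&` brownian_noise W s @^-1` E) = (P A * P (brownian_noise W 0 @^-1` E))%E.
Proof.
move=> s0 jA sE.
have base B : joint_events s k B ->
    P (B `&` brownian_noise W s @^-1` E) = (P B * P (brownian_noise W 0 @^-1` E))%E.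
  move=> [A1 /sub_sigma_algebra-/(_ setT) pA1 [A2 /sub_sigma_algebra-/(_ setT) fA2 <-]].
  have nA2 := first_gaps_counting_measurable rtT fA2.
  rewrite setIAC WN//; last first.
    by apply: (salg_I (sigma_generated_salg _ _)); [exact: (pastW pA1)|exact: (noiseW s0 sE)].
  rewrite (brownian_noise_independent bmW)// (WN (pastW pA1) nA2).
  by rewrite muleAC.
have law : P (brownian_noise W s @^-1` E) = P (brownian_noise W 0 @^-1` E).
  have := base setT; rewrite setTI -[P setT]/(P [set: Omega]) probability_setT mul1e; apply.
  exists setT; first by exists [::], (fun=> setT); split => //; apply/seteqP; split.
  exists setT; last by rewrite setTI.
  by exists (fun=> setT); split=> //; apply/seteqP; split.
have [|_ _] := @product_rule_generated _ _ _ P _ (joint_events s k) id id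
  _ (mnoise s0 sE) (@joint_events_setI s k) _ _ jA.
  move=> B jB; rewrite preimage_id; have mB := measurable_joint_events jB; split=> //.
  by rewrite setIC base// law muleC.
by rewrite preimage_id setIC muleC law.
Qed.

(** The gap [k] comes after the first [k] gaps, so independence of the gaps applies once the
    Brownian factor is split off. *)
Lemma joint_past_gap s k A B : 0 <= s -> joint_past s k A -> measurable B ->
  P (A `&` gap T k @^-1` B) = (P A * P (gap T 0 @^-1` B))%E.
Proof.
move=> s0 jA mB.
have sN := sigma_generated_salg `[0, +oo[ (counting_process T).
have gN j : sigma_generated `[0, +oo[ (counting_process T) (gap T j @^-1` B).
  move: B mB; apply/(measurable_fun_salgE _ sN).
  by apply: measurable_funB; apply/(measurable_fun_salgE _ sN); exact: (renewal_counting_measurable rtT).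
have mgap j : measurable (gap T j @^-1` B).
  by rewrite -[X in measurable X]setTI; exact: (measurable_gap rtT).
have base C : joint_events s k C ->
    P (C `&` gap T k @^-1` B) = (P C * P (gap T 0 @^-1` B))%E.
  move=> [A1 /sub_sigma_algebra-/(_ setT) pA1 [A2 /sub_sigma_algebra-/(_ setT) fA2 <-]].
  have nA2 := first_gaps_counting_measurable rtT fA2.
  rewrite -setIA (WN (pastW pA1)); last exact: (salg_I sN).
  by rewrite (gap_independent rtT)// (WN (pastW pA1) nA2) muleA.
have law : P (gap T k @^-1` B) = P (gap T 0 @^-1` B).
  by rewrite !(gap_law rtT).
have [|_ _] := @product_rule_generated _ _ _ P _ (joint_events s k) id id
  _ (mgap k) (@joint_events_setI s k) _ _ jA.
  move=> C jC; rewrite preimage_id; have mC := measurable_joint_events jC; split=> //.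
  by rewrite setIC base// law muleC.
by rewrite preimage_id setIC muleC law.
Qed.

Lemma gap_noise0 B E : measurable B -> <<s @cylinder R (nat * nat)%type >> E ->
  P (gap T 0 @^-1` B `&` brownian_noise W 0 @^-1` E) =
  (P (gap T 0 @^-1` B) * P (brownian_noise W 0 @^-1` E))%E.
Proof.
move=> mB sE; apply: (joint_past_noise (k := 1)) => //.
apply: first_gaps_sub_joint; apply: sub_sigma_algebra.
exists (fun=> B); split => //; apply/seteqP; split=> w /=; last by move=> /(_ 0%N); exact.
by move=> Bw k; rewrite /= ltnS leqn0 => /eqP ->.
Qed.

(** The natural filtration without right limits: having explicit generators, it can be handled by
    generator arguments. *)
Definition observed (s : R) : set (set Omega) :=
  <<s sigma_generated `[0, s] W `|` sigma_generated `[0, s] (counting_process T) >>.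

Lemma observed_salg s : sigma_algebra setT (observed s).
Proof. exact: smallest_sigma_algebra. Qed.

Lemma observed_le s t : s <= t -> observed s `<=` observed t.
Proof.
move=> st; apply: sub_sigma_algebra2 => A [h|h]; [left|right]; move: A h;
  apply: sub_sigma_algebra2 => A [u /=]; rewrite in_itv /= => /andP[u0 us] h;
  exists u => //=; by rewrite in_itv /= u0 (le_trans us).
Qed.

Let mcount t : measurable_fun setT (counting_process T t).
Proof.
apply: ge0_emeasurable_sum => [k w _ _|k _].
  by rewrite lee_fin.
apply/measurable_EFinP.
rewrite (_ : (fun _ => _) = \1_[set w | T k.+1 w <= t]); last first.
  by apply/funext => w; rewrite indicE mem_setE.
apply: measurable_indic; rewrite [X in measurable X](_ : _ = T k.+1 @^-1` `]-oo, t]).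
  by rewrite -[X in measurable X]setTI; apply: (rt_measurable rtT).
by apply/seteqP; split=> w /=; rewrite in_itv.
Qed.

Lemma observed_measurable s : observed s `<=` measurable.
Proof.
apply: smallest_sub; first exact: sigma_algebra_measurable.
move=> A [|]; move: A; apply: smallest_sub; try exact: sigma_algebra_measurable.
  move=> A0 [u /=]; rewrite in_itv /= => /andP[u0 _] [B mB <-].
  exact: (bm_measurable bmW u0 measurableT mB).
by move=> _ [u /= _] [B mB <-]; exact: (mcount u measurableT mB).
Qed.

(** The right limits of [observed] are one of the filtrations intersected in [smallest_filtration];
    the strictly later time absorbs the limit. *)
Lemma smallest_filtration_observed t s : 0 <= t -> t < s ->
  smallest_filtration W T t `<=` observed s.
Proof.
move=> t0 ts A.
pose G u : set (set Omega) := \bigcap_(v in `]u, +oo[) observed v.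
have sG u : sigma_algebra setT (G u).
  split.
  - by move=> v _; exact: (salg_0 (observed_salg v)).
  - by move=> B GB v uv; rewrite setTD; apply: (salg_C (observed_salg v)); exact: GB.
  - by move=> B GB v uv; apply: (salg_U (observed_salg v)) => n; exact: GB.
have Gob u v : u < v -> G u `<=` observed v.
  by move=> uv B; apply; rewrite /= in_itv /= andbT.
have obG u : observed u `<=` G u.
  move=> B oB v /=; rewrite in_itv /= andbT => uv.
  exact: observed_le (ltW uv) _ oB.
move=> /(_ G) h; apply: (Gob _ _ ts); apply: h.
- split=> // [u u0|u v u0 uv].
    by apply: (subset_trans (Gob u (u + 1) _)); [rewrite ltrDl|exact: observed_measurable].
  by move=> B GB x /=; rewrite in_itv /= andbT => vx; apply: GB; rewrite /= in_itv /= andbT (le_lt_trans uv).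
- move=> u u0; apply/seteqP; split=> B GB.
    move=> v /=; rewrite in_itv /= andbT => uv.
    by move=> x /=; rewrite in_itv /= andbT => vx; apply: GB; rewrite /= in_itv /= andbT (lt_trans uv).
  move=> v /=; rewrite in_itv /= andbT => uv.
  have [um mv] : u < (u + v) / 2 /\ (u + v) / 2 < v.
    by rewrite ltr_pdivlMr// ltr_pdivrMr//; split; lra.
  by apply: (GB ((u + v) / 2)) => /=; rewrite in_itv /= andbT.
- move=> u u0 B mB; apply: obG; apply: sub_sigma_algebra; left.
  by apply: sigma_generated_mem => //=; rewrite in_itv /= u0 lexx.
- move=> u u0 B mB; apply: obG; apply: sub_sigma_algebra; right.
  by apply: sigma_generated_mem => //=; rewrite in_itv /= u0 lexx.
Qed.

(* Before the next arrival, the counting process carries no information beyond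
   the past arrival times. *)
Lemma observed_before_arrival s k A : 0 <= s -> observed s A ->
  exists2 A', joint_past s k A' &
    A `&` [set w | s < T k.+1 w] = A' `&` [set w | s < T k.+1 w].
Proof.
move=> s0; set D := [set w | s < T k.+1 w]; have sJ := joint_past_salg s k.
pose Q := [set A | exists2 A', joint_past s k A' & A `&` D = A' `&` D].
have sQ : sigma_algebra setT Q.
  split.
  - by exists set0 => //; exact: (salg_0 sJ).
  - move=> B [B' jB' BB']; exists (~` B'); first exact: (salg_C sJ).
    rewrite setTD; apply/seteqP; split=> w [h Dw]; split=> // hB; apply: h.
      by have [] : (B `&` D) w by rewrite BB'.
    by have [] : (B' `&` D) w by rewrite -BB'.
  - move=> B /(_ _)/cid2-/all_sig2[B' jB' BB'].
    exists (\bigcup_n B' n); first exact: (salg_U sJ).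
    by rewrite !setI_bigcupl; apply: eq_bigcupr => n _; exact: BB'.
apply: (smallest_sub sQ) => {}A [|]; move: A; apply: (smallest_sub sQ).
  move=> A0 [u /=]; rewrite in_itv /= => /andP[u0 us] [B mB <-]; rewrite setTI.
  exists (W u @^-1` B) => //; apply: past_sub_joint; apply: sub_sigma_algebra.
  exists [:: u], (fun=> B); split => //; first by move=> v; rewrite inE => /eqP ->; rewrite u0.
  apply/seteqP; split=> w /=; last by move=> /(_ u); rewrite inE eqxx; exact.
  by move=> h v; rewrite inE => /eqP ->.
move=> A0 [u /=]; rewrite in_itv /= => /andP[u0 us] [B mB <-]; rewrite setTI.
(* Equals the counting process at [u] as long as [s < T k.+1], and depends on the first [k] gaps
   only. *)
pose f w := (\sum_(j < k) ((T j.+1 w <= u)%R%:R : R))%:E.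
exists (f @^-1` B).
  apply: first_gaps_sub_joint.
  have sF := smallest_sigma_algebra setT (first_events (gap T) k).
  move: B mB; apply/(measurable_fun_salgE _ sF); apply/measurable_EFinP.
  apply: measurable_sum => j.
  rewrite (_ : (fun _ => _) = \1_[set w | T j.+1 w <= u]); last first.
    by apply/funext => w; rewrite indicE mem_setE.
  apply: measurable_indic; rewrite /measurable /= sigma_algebra_id//.
  rewrite [X in <<s _ >> X](_ : _ = T j.+1 @^-1` `]-oo, u]).
    exact: (first_gaps_renewal rtT).
  by apply/seteqP; split=> w /=; rewrite in_itv.
by apply/seteqP; split=> w [/= h Dw]; split => //; move: h;
  rewrite /f /= (counting_processE rtT (k := k))// (le_lt_trans us).
Qed.

End joint_past.

(** * Limits of probabilities of events *)

Section event_limits.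
Context d (Omega : measurableType d) (R : realType) (P : probability Omega R).
Context (N : set Omega).
Hypotheses (mN : measurable N) (PN : P N = 0%E).

Lemma cvg_probability_eventually (B_ : nat -> set Omega) (B : set Omega) :
  (forall m, measurable (B_ m)) -> measurable B ->
  (forall w, ~ N w -> \forall m \near \oo, B_ m w <-> B w) ->
  P (B_ m) @[m --> \oo] --> P B.
Proof.
move=> mB_ mB BB.
have E (A : set Omega) : measurable A -> P A = (\int[P]_w (\1_A w)%:E)%E.
  by move=> mA; rewrite integral_indic// setIT.
rewrite E//; under eq_fun do rewrite E//.
have [|||||_ _ //] := @dominated_convergence _ _ _ P setT measurableT
  (fun m w => (\1_(B_ m) w)%:E) (fun w => (\1_B w)%:E) (cst 1%E).
- by move=> n; apply/measurable_EFinP; exact: measurable_indic.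
- by apply/measurable_EFinP; exact: measurable_indic.
- exists N; split => // w /= h; apply: contrapT => Nw; apply: h => _.
  apply: cvg_near_cst; have := BB _ Nw; apply: filterS => m h.
  rewrite !indicE; suff -> : (w \in B_ m) = (w \in B) by [].
  by apply/idP/idP; rewrite !inE => /h.
- by apply/integrableP; split => //; rewrite integral_cst//= normr1 mul1e
   -[P setT]/(P [set: Omega]) probability_setT ltry.
- exists set0; split => // w /= h; exfalso; apply: h => n _.
  by rewrite /= lee_fin ger0_norm ?indicE// lern1 leq_b1.
Qed.

(** A Fatou-type bound from one inclusion only: intersected with [B], the events satisfy the
    two-sided version. *)
Lemma probability_le_limit (B_ : nat -> set Omega) (B : set Omega) (c : \bar R) :
  (forall m, measurable (B_ m)) -> measurable B ->
  (forall w, ~ N w -> B w -> \forall m \near \oo, B_ m w) ->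
  P (B_ m) @[m --> \oo] --> c -> (P B <= c)%E.
Proof.
move=> mB_ mB BB Pc.
have mI m : measurable (B_ m `&` B) by exact: measurableI.
have h : P (B_ m `&` B) @[m --> \oo] --> P B.
  apply: cvg_probability_eventually => // w Nw.
  have [Bw|Bw] := pselect (B w); last by apply: nearW => m; split => // -[].
  by have := BB _ Nw Bw; apply: filterS => m Bm; split.
rewrite -(cvg_lim _ h)// -(cvg_lim _ Pc)//; apply: lee_lim.
- by apply/cvg_ex; exists (P B).
- by apply/cvg_ex; exists c.
- by apply: nearW => m; apply: le_measure; rewrite ?inE//; exact: subIsetl.
Qed.

End event_limits.

(** Sums product rules over the values of a discretized random time: [C j] fixes the value, and the
    factor [c] does not depend on it. *)
Lemma mixture_rule d (Omega : measurableType d) (R : realType) (P : probability Omega R)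
  (C D : nat -> set Omega) (c : \bar R) : c \is a fin_num ->
  (forall j, measurable (C j)) -> (forall j, measurable (D j)) ->
  trivIset setT C -> (forall j, P (C j `&` D j) = (P (C j) * c)%E) ->
  P (\bigcup_j (C j `&` D j)) = (P (\bigcup_j C j) * c)%E.
Proof.
move=> cfin mC mD tC CD.
rewrite measure_bigcup//; last 2 first.
- by move=> j _; exact: measurableI.
- exact: trivIset_setIr.
rewrite measure_bigcup// muleC -[c]fineK// -nneseriesZl//.
by apply: eq_eseriesr => j _; rewrite fineK// muleC; exact: CD.
Qed.

(** * Boxes generating the product sigma-algebra *)

Section upper_boxes.
Context (R : realType) (I : eqType).

(** Strict inequalities persist along converging sequences; the margin [c] serves to compare open
    with closed boxes. *)
Definition upper_box (c : R) (l : seq (I * R)) : set (I -> R) :=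
  [set y | forall p, p \in l -> p.2 + c < y p.1].

Definition closed_upper_box (c : R) (l : seq (I * R)) : set (I -> R) :=
  [set y | forall p, p \in l -> p.2 + c <= y p.1].

Definition upper_boxes : set (set (I -> R)) := [set upper_box 0 l | l in setT].

Lemma upper_boxes_setI : setI_closed upper_boxes.
Proof.
move=> _ _ [l1 _ <-] [l2 _ <-]; exists (l1 ++ l2) => //.
apply/seteqP; split=> y /=.
  by move=> h; split=> p pl; apply: h; rewrite mem_cat pl ?orbT.
by move=> [h1 h2] p; rewrite mem_cat => /orP[/h1|/h2].
Qed.

Let cyl_all (Q : I * R -> set R) (l : seq (I * R)) : (forall p, measurable (Q p)) ->
  <<s @cylinder R I >> [set y | forall p, p \in l -> Q p (y p.1)].
Proof.
move=> mQ; have sC := smallest_sigma_algebra setT (@cylinder R I).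
elim: l => [|p l ih].
  rewrite [X in <<s _ >> X](_ : _ = setT); first exact: (salg_T sC).
  by apply/seteqP; split.
rewrite [X in <<s _ >> X](_ : _ = (fun y : path_space R I => y p.1) @^-1` Q p `&`
    [set y | forall p, p \in l -> Q p (y p.1)]).
  apply: (salg_I sC) => //; have := @measurable_coord R I p.1 measurableT _ (mQ p).
  by rewrite setTI.
apply/seteqP; split => x /=.
  move=> h; split; first by apply: h; rewrite inE eqxx.
  by move=> j jl; apply: h; rewrite inE jl orbT.
by move=> [h1 h2] j; rewrite inE => /orP[/eqP ->//|]; exact: h2.
Qed.

Lemma upper_box_cylinder c l : <<s @cylinder R I >> (upper_box c l).
Proof.
have := @cyl_all (fun p => `]p.2 + c, +oo[%classic) l (fun p => measurable_itv _).
by congr (<<s _ >> _); apply/seteqP; split=> y h p /h /=; rewrite in_itv /= andbT.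
Qed.

Lemma closed_upper_box_cylinder c l : <<s @cylinder R I >> (closed_upper_box c l).
Proof.
have := @cyl_all (fun p => `[p.2 + c, +oo[%classic) l (fun p => measurable_itv _).
by congr (<<s _ >> _); apply/seteqP; split=> y h p /h /=; rewrite in_itv /= andbT.
Qed.

Lemma cylinder_upper_boxes : <<s @cylinder R I >> `<=` <<s upper_boxes >>.
Proof.
have sU := smallest_sigma_algebra setT upper_boxes.
apply: smallest_sub => // _ [l [A [mA ->]]].
elim: l => [|i l ih].
  rewrite [X in <<s _ >> X](_ : _ = setT); first exact: (salg_T sU).
  by apply/seteqP; split.
rewrite [X in <<s _ >> X](_ : _ = (fun y : I -> R => y i) @^-1` A i `&`
    [set y | forall p, p \in l -> A p (y p)]).
  apply: (salg_I sU) => //; move: (A i) (mA i).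
  apply: (proj1 (measurable_fun_salgE (fun y : I -> R => y i) sU)).
  apply: (measurability _ (RGenOInfty.measurableE R)) => _ [_ [a ->] <-].
  rewrite setTI; apply: sub_sigma_algebra; apply: sub_sigma_algebra.
  exists [:: (i, a)] => //; apply/seteqP; split=> y /=.
    by move=> /(_ (i, a)); rewrite inE eqxx /= addr0 in_itv /= andbT; exact.
  by rewrite in_itv /= andbT => h p; rewrite inE => /eqP -> /=; rewrite addr0.
apply/seteqP; split => x /=.
  move=> h; split; first by apply: h; rewrite inE eqxx.
  by move=> j jl; apply: h; rewrite inE jl orbT.
by move=> [h1 h2] j; rewrite inE => /orP[/eqP ->//|]; exact: h2.
Qed.

(** Finitely many strict inequalities leave a common positive margin. *)
Lemma upper_box_bigcup l : upper_box 0 l = \bigcup_n upper_box (harmonic n) l.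
Proof.
apply/seteqP; split=> y; last first.
  move=> [n _ h] p /h; rewrite addr0; apply: le_lt_trans; rewrite lerDl.
  exact: harmonic_ge0.
move=> h; suff : \forall n \near \oo, upper_box (harmonic n) l y.
  by case=> n _ /(_ n (leqnn n)) hn; exists n.
elim: l h => [|p l ih] h; first by apply: nearW => n p.
have pp : 0 < y p.1 - p.2.
  by rewrite subr_gt0; have := h p; rewrite inE eqxx addr0; exact.
have := @cvg_harmonic R => /cvgrPdist_lt /(_ _ pp).
have {}/ih : upper_box 0 l y by move=> q ql; apply: h; rewrite inE ql orbT.
apply: filterS2 => n hl; rewrite sub0r normrN ger0_norm ?harmonic_ge0// => hp q.
rewrite inE => /orP[/eqP ->|/hl//].
by move: hp; rewrite ltrBrDl.
Qed.

End upper_boxes.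

(** * The strong Markov property at an arrival *)

Section noise_at_arrival.
Context d (Omega : measurableType d) (R : realType) (P : probability Omega R).
Context (W : R -> Omega -> R).
Context (F : probability (measurableTypeR R) R) (T : nat -> Omega -> R).
Hypothesis Pc : measure_is_complete P.
Hypothesis bmW : standard_brownian_motion P W.
Hypothesis rtT : renewal_times P F T.
Hypothesis WN : independent_systems P (sigma_generated `[0, +oo[ W)
    (sigma_generated `[0, +oo[ (counting_process T)).
Context (N0 : set Omega).
Hypotheses (mN0 : measurable N0) (PN0 : P N0 = 0%E).
Hypothesis Wc : forall w, ~ N0 w -> {within `[0, +oo[%classic, continuous (W ^~ w)}.

Let mW t : 0 <= t -> measurable_fun setT (W t).
Proof. exact: (bm_measurable bmW). Qed.

Definition arrival_noise k w := brownian_noise W (T k w) w.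

Lemma measurable_arrival_noise k : measurable_fun setT (arrival_noise k).
Proof.
apply: measurable_fun_path => q; apply: measurable_funB.
  apply: (measurable_random_time Pc mW mN0 PN0 Wc (U := fun w => T k w + grid_time R q)).
    by apply: measurable_funD => //; exact: (rt_measurable rtT).
  by move=> w; rewrite addr_ge0 ?(renewal_ge0 rtT)// grid_time_ge0.
apply: (measurable_random_time Pc mW mN0 PN0 Wc); first exact: (rt_measurable rtT).
exact: (renewal_ge0 rtT).
Qed.

(* [T k] is replaced by the deterministic time [node m j] when it lies in the
   cell [j / (m+1), (j+1) / (m+1)); there, [A] agrees with an event on which the
   later increments do not depend as soon as [node m j < T k.+1], which holds
   for [m] large enough. *)
Section fixed_arrival.
Variables (k : nat) (A : set Omega).
Hypothesis sA : stopped_sigma_algebra (smallest_filtration W T) (T k) A.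

Let mA : measurable A. Proof. by case: sA. Qed.

Let cell m w := Num.truncn (T k w * m.+1%:R).
(** The numerator is [j.+2] because [T k] is below [j.+1 / m.+1] on the cell and a strictly later
    time is needed to pass from the right-continuous filtration to [observed]. *)
Let node m j : R := j.+2%:R / m.+1%:R.

Let node_ge0 m j : 0 <= node m j. Proof. by rewrite divr_ge0. Qed.

Let cell_lt m j w : cell m w = j -> T k w < j.+1%:R / m.+1%:R.
Proof. by move=> <-; apply: grid_succ_gt; exact: (renewal_ge0 rtT). Qed.

Let mcell m j : measurable [set w | cell m w = j].
Proof. by apply: measurable_truncn_eq; apply: measurable_funM => //; exact: (rt_measurable rtT). Qed.

(** With [t] the end of the cell, the part of [A] where [T k <= t] is in the filtration at [t],
    hence in [observed] at the node, hence agrees before the next arrival with an event of the joint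
    past. *)
Let approx_exists m j : exists A', joint_past W T (node m j) k A' /\
  forall w, cell m w = j -> node m j < T k.+1 w -> (A' w <-> A w).
Proof.
have t0 : 0 <= j.+1%:R / m.+1%:R :> R by rewrite divr_ge0.
have fA := sA.2 _ t0.
have oA : observed W T (node m j) (A `&` [set w | T k w <= j.+1%:R / m.+1%:R]).
  apply: (smallest_filtration_observed bmW rtT) fA; rewrite ?divr_ge0//.
  by rewrite ltr_pM2r ?invr_gt0 ?ltr0n// ltr_nat.
have [A' jA' AA'] := observed_before_arrival rtT k (node_ge0 m j) oA.
exists A'; split => // w cw nw; split => h.
  by have : (A' `&` [set w | node m j < T k.+1 w]) w by []; rewrite -AA' => -[[]].
have : ((A `&` [set w | T k w <= j.+1%:R / m.+1%:R]) `&` [set w | node m j < T k.+1 w]) w.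
  by split => //; split => //=; apply: ltW; exact: cell_lt.
by rewrite AA' => -[].
Qed.

Let approx m j := sval (cid (approx_exists m j)).

Let piece m j := approx m j `&` [set w | cell m w = j].

Let Am m := \bigcup_j piece m j.

Let piece_joint m j : joint_past W T (node m j) k (piece m j).
Proof.
rewrite /piece /approx; case: cid => A' /= [jA' _].
have sJ := joint_past_salg W T (node m j) k.
apply: (salg_I sJ) => //; apply: first_gaps_sub_joint.
have mT : measurable_fun (setT : set (g_sigma_algebraType (first_events (gap T) k))) (T k).
  by move=> _ B mB; rewrite setTI; exact: (first_gaps_renewal rtT).
apply: (@measurable_truncn_eq R _ (g_sigma_algebraType (first_events (gap T) k))
  (fun w => T k w * m.+1%:R)).
exact: measurable_funM.
Qed.

Let mpiece m j : measurable (piece m j).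
Proof. exact: (measurable_joint_past bmW rtT (@piece_joint m j)). Qed.

Let Am_eventually w : \forall m \near \oo, Am m w <-> A w.
Proof.
have Tk : 0 < T k.+1 w - T k w by exact: (gap_gt0 rtT).
(* The node exceeds [T k] by at most two meshes, so it precedes the next arrival once these are
   shorter than the gap. *)
have : (2 * harmonic m : R) @[m --> \oo] --> 2 * (0 : R).
  by apply: cvgMr; exact: cvg_harmonic.
rewrite mulr0 => /cvgrPdist_lt /(_ _ Tk); apply: filterS => m.
rewrite sub0r normrN ger0_norm ?mulr_ge0 ?harmonic_ge0// => hm.
have nm : node m (cell m w) < T k.+1 w.
  have -> : node m (cell m w) = grid_succ m (T k w) + m.+1%:R^-1.
    by rewrite /node /grid_succ -[in LHS]natr1 mulrDl mul1r.
  have hm' : 2 * (m.+1%:R^-1 : R) < T k.+1 w - T k w := hm.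
  have := grid_succ_le m (renewal_ge0 rtT k w); move: hm'.
  by set e := m.+1%:R^-1; set g := grid_succ _ _; set a := T k w; set b := T k.+1 w; clearbody e g a b; lra.
rewrite /Am /piece; split.
  move=> [j _ []]; rewrite /approx; case: cid => A' /= [_ h] A'w cw.
  by apply/h => //; rewrite -cw.
move=> Aw; exists (cell m w) => //; split => //.
by rewrite /approx; case: cid => A' /= [_ h]; apply/h.
Qed.

Let tpiece m (B : set Omega) : trivIset setT (fun j => piece m j `&` B).
Proof.
by apply/trivIsetP => i j _ _ ij; apply/seteqP; split=> // w [[[_ /= ci] _] [[_ /= cj] _]];
  move: ij; rewrite -ci -cj eqxx.
Qed.

Let mgap B : measurable B -> measurable (gap T k @^-1` B).
Proof. by move=> mB; rewrite -[X in measurable X]setTI; exact: (measurable_gap rtT). Qed.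

Let Snoise m w := brownian_noise W (node m (cell m w)) w.

Let mSnoise m : measurable_fun setT (Snoise m).
Proof.
apply: (@measurable_fun_index _ _ _ _ (cell m) (fun j w => brownian_noise W (node m j) w)).
  exact: mcell.
by move=> j; exact: (measurable_brownian_noise bmW (node_ge0 m j)).
Qed.

Let Am_noise m (B : set R) E : measurable B -> <<s @cylinder R (nat * nat)%type >> E ->
  P (Am m `&` gap T k @^-1` B `&` Snoise m @^-1` E) =
  (P (Am m `&` gap T k @^-1` B) * P (brownian_noise W 0 @^-1` E))%E.
Proof.
move=> mB sE.
have mn s : 0 <= s -> measurable (brownian_noise W s @^-1` E).
  by move=> s0; rewrite -[X in measurable X]setTI; exact: (measurable_brownian_noise bmW s0 measurableT sE).
rewrite {2}/Am setI_bigcupl -(@mixture_rule _ _ _ _ _ (fun j => brownian_noise W (node m j) @^-1` E))//.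
- congr (P _); rewrite setI_bigcupl; apply: eq_bigcupr => j _.
  by apply/seteqP; split=> w [[[a cw] b] /=]; rewrite /Snoise cw.
- by apply: fin_num_measure; exact: mn.
- by move=> j; apply: measurableI => //; exact: mgap.
- by move=> j; apply: mn.
(* Taken with [k.+1] gaps, so that the event on the gap [k] belongs to the past. *)
- move=> j; apply: (joint_past_noise bmW rtT WN (k := k.+1)) => //.
  apply: (salg_I (joint_past_salg _ _ _ _)).
    exact: (joint_past_le_gaps (leqnSn k)).
  apply: first_gaps_sub_joint; apply: sub_sigma_algebra.
  exists (fun i => if i == k then B else setT); split; first by move=> i; case: ifP.
  apply/seteqP; split => w /=.
    by move=> Bw i _ /=; case: eqP => //= ->.
  by move=> /(_ k (ltnSn k)) /=; rewrite eqxx.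
Qed.

Let Am_gap m (B : set R) : measurable B ->
  P (Am m `&` gap T k @^-1` B) = (P (Am m) * P (gap T 0 @^-1` B))%E.
Proof.
move=> mB.
rewrite /Am setI_bigcupl; apply: mixture_rule => //.
- by rewrite fin_num_measure// -[X in measurable X]setTI; exact: (measurable_gap rtT).
- by move=> _; exact: mgap.
- by have := @tpiece m setT; under eq_fun do rewrite setIT.
- by move=> j; apply: (joint_past_gap bmW rtT WN (node_ge0 m j)).
Qed.

Let mAm m : measurable (Am m). Proof. exact: bigcupT_measurable. Qed.

(** The rule holds exactly for each [Am m], and these events converge to [A]. *)
Lemma arrival_gap_independent (B : set R) : measurable B ->
  P (A `&` gap T k @^-1` B) = (P A * P (gap T 0 @^-1` B))%E.
Proof.
move=> mB; have mg := mgap mB.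
have c1 : P (Am m `&` gap T k @^-1` B) @[m --> \oo] --> P (A `&` gap T k @^-1` B).
  apply: (cvg_probability_eventually mN0 PN0); try by move=> *; exact: measurableI.
  by move=> w _; have := Am_eventually w; apply: filterS => m h; split => -[/h].
have c2 : P (Am m `&` gap T k @^-1` B) @[m --> \oo] --> (P A * P (gap T 0 @^-1` B))%E.
  under eq_fun do rewrite Am_gap//.
  apply: cvgeZr; first by rewrite fin_num_measure// -[X in measurable X]setTI; exact: (measurable_gap rtT).
  apply: (cvg_probability_eventually mN0 PN0) => // w _; exact: Am_eventually.
by rewrite -(cvg_lim _ c1)// (cvg_lim _ c2).
Qed.

Let noise_cvg w q : ~ N0 w -> Snoise m w q @[m --> \oo] --> arrival_noise k w q.
Proof.
move=> Nw; have T0 := renewal_ge0 rtT k w.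
have cS : node m (cell m w) @[m --> \oo] --> T k w.
  have -> : (fun m => node m (cell m w)) = (fun m => grid_succ m (T k w) + harmonic m).
    by apply/funext => m; rewrite /node /grid_succ -[in LHS]natr1 mulrDl mul1r.
  by rewrite -[X in _ --> X]addr0; apply: cvgD; [exact: cvg_grid_succ|exact: cvg_harmonic].
apply: cvgB; apply: (@within_cvg_seq _ (W^~ w) _ _ (Wc Nw)) => //.
- by rewrite addr_ge0// grid_time_ge0.
- by move=> m; rewrite addr_ge0// grid_time_ge0.
- by apply: cvgD => //; exact: cvg_cst.
Qed.

Let Snoise_gt w q (a : R) : ~ N0 w -> a < arrival_noise k w q ->
  \forall m \near \oo, a < Snoise m w q.
Proof.
move=> Nw ha; have pos : 0 < arrival_noise k w q - a by rewrite subr_gt0.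
have /cvgrPdist_lt /(_ _ pos) := @noise_cvg w q Nw; apply: filterS => m.
by rewrite ltr_norml => /andP[_]; rewrite ltrD2l ltrN2.
Qed.

Let Snoise_lt w q (a : R) : ~ N0 w -> arrival_noise k w q < a ->
  \forall m \near \oo, Snoise m w q < a.
Proof.
move=> Nw ha; have pos : 0 < a - arrival_noise k w q by rewrite subr_gt0.
have /cvgrPdist_lt /(_ _ pos) := @noise_cvg w q Nw; apply: filterS => m.
by rewrite distrC ltr_norml => /andP[_]; rewrite ltrD2r.
Qed.

Let Snoise_box w c l : ~ N0 w -> upper_box c l (arrival_noise k w) ->
  \forall m \near \oo, upper_box c l (Snoise m w).
Proof.
move=> Nw; elim: l => [|p l ih] h; first by apply: nearW => m p.
have {}/ih : upper_box c l (arrival_noise k w).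
  by move=> q ql; apply: h; rewrite inE ql orbT.
have /(Snoise_gt Nw) : p.2 + c < arrival_noise k w p.1 by apply: h; rewrite inE eqxx.
apply: filterS2 => m hp hl q; rewrite inE => /orP[/eqP ->//|]; exact: hl.
Qed.

Lemma arrival_noise_independent (B : set R) E : measurable B ->
  <<s @cylinder R (nat * nat)%type >> E ->
  P (A `&` gap T k @^-1` B `&` arrival_noise k @^-1` E) =
  (P (A `&` gap T k @^-1` B) * P (brownian_noise W 0 @^-1` E))%E.
Proof.
move=> mB sE; have mg := mgap mB.
(* Indicators of boxes are only semicontinuous: open boxes give [<=], closed
   boxes give [>=] up to a margin [c], which then tends to 0. *)
pose D := A `&` gap T k @^-1` B; have mD : measurable D by exact: measurableI.
pose Dm m := Am m `&` gap T k @^-1` B.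
have mDm m : measurable (Dm m) by exact: measurableI.
have marr E' : <<s @cylinder R (nat * nat)%type >> E' -> measurable (arrival_noise k @^-1` E').
  by move=> sE'; rewrite -[X in measurable X]setTI; exact: (@measurable_arrival_noise k measurableT E' sE').
have mS m E' : <<s @cylinder R (nat * nat)%type >> E' -> measurable (Snoise m @^-1` E').
  by move=> sE'; rewrite -[X in measurable X]setTI; exact: (@mSnoise m measurableT E' sE').
have mn E' : <<s @cylinder R (nat * nat)%type >> E' -> measurable (brownian_noise W 0 @^-1` E').
  by move=> sE'; rewrite -[X in measurable X]setTI; exact: (measurable_brownian_noise bmW (lexx 0) measurableT sE').
have DmD w : \forall m \near \oo, Dm m w <-> D w.
  by have := Am_eventually w; apply: filterS => m h; split => -[/h].
have cDm : P (Dm m) @[m --> \oo] --> P D.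
  by apply: (cvg_probability_eventually mN0 PN0) => // w _; exact: DmD.
have cbox c l : P (Dm m `&` Snoise m @^-1` upper_box c l) @[m --> \oo] -->
    (P D * P (brownian_noise W 0 @^-1` upper_box c l))%E.
  have -> : (fun m => P (Dm m `&` Snoise m @^-1` upper_box c l)) =
      (fun m => P (Dm m) * P (brownian_noise W 0 @^-1` upper_box c l))%E.
    by apply/funext => m; apply: Am_noise => //; exact: upper_box_cylinder.
  apply: cvgeZr; last exact: cDm.
  by apply: fin_num_measure; apply: mn; exact: upper_box_cylinder.
have le_box l : (P (D `&` arrival_noise k @^-1` upper_box 0 l) <=
    P D * P (brownian_noise W 0 @^-1` upper_box 0 l))%E.
  apply: (probability_le_limit mN0 PN0 _ _ _ (cbox 0 l)).
  - by move=> m; apply: measurableI => //; apply: mS; exact: upper_box_cylinder.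
  - by apply: measurableI => //; apply: marr; exact: upper_box_cylinder.
  - move=> w Nw [Dw bw]; have := DmD w; have := Snoise_box Nw bw.
    by apply: filterS2 => m h1 h2; split=> //; exact/h2.
have ge_box c l : (P D * P (brownian_noise W 0 @^-1` upper_box c l) <=
    P (D `&` arrival_noise k @^-1` closed_upper_box c l))%E.
  have mDc : measurable (D `&` arrival_noise k @^-1` closed_upper_box c l).
    by apply: measurableI => //; apply: marr; exact: closed_upper_box_cylinder.
  have mDmc m : measurable (Dm m `&` Snoise m @^-1` upper_box c l).
    by apply: measurableI => //; apply: mS; exact: upper_box_cylinder.
  (* The lower bound is an upper bound for complements: noise outside the closed box violates some
     inequality strictly, hence so do its approximations. *)
  have : (P (~` (D `&` arrival_noise k @^-1` closed_upper_box c l)) <=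
      1 - P D * P (brownian_noise W 0 @^-1` upper_box c l))%E.
    apply: (@probability_le_limit _ _ _ P _ mN0 PN0
      (fun m => ~` (Dm m `&` Snoise m @^-1` upper_box c l))).
    - by move=> m; exact: measurableC.
    - exact: measurableC.
    - move=> w Nw; rewrite setCI => -[nD|nb].
        by have := DmD w; apply: filterS => m h [/h].
      have [p [pl /negP]] : exists p, p \in l /\ ~ (p.2 + c <= arrival_noise k w p.1).
        apply: contrapT => h; apply: nb => p pl; apply: contrapT => hp.
        by apply: h; exists p.
      rewrite -ltNge => /(Snoise_lt Nw); apply: filterS => m hm [_ /(_ p pl)].
      by move/(lt_trans hm); rewrite ltxx.
    - under eq_fun do rewrite probability_setC//.
      apply: cvgeB; [|exact: cvg_cst|exact: cbox].
      by rewrite fin_num_adde_defr.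
  rewrite probability_setC// leeD2lE//.
    by rewrite leeN2.
have eq_box l : P (D `&` arrival_noise k @^-1` upper_box 0 l) =
    (P D * P (brownian_noise W 0 @^-1` upper_box 0 l))%E.
  apply/eqP; rewrite eq_le le_box /=.
  have cL : (P D * P (brownian_noise W 0 @^-1` upper_box (harmonic n) l))%E @[n --> \oo] -->
      (P D * P (brownian_noise W 0 @^-1` upper_box 0 l))%E.
    apply: cvgeZl; first exact: fin_num_measure.
    rewrite upper_box_bigcup preimage_bigcup; apply: nondecreasing_cvg_mu.
    - by move=> n; apply: mn; exact: upper_box_cylinder.
    - by apply: bigcupT_measurable => n; apply: mn; exact: upper_box_cylinder.
    - move=> n m nm; apply/subsetPset => w h p /h; apply: le_lt_trans.
      by rewrite lerD2l lef_pV2 ?posrE ?ltr0n// ler_nat ltnS.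
  apply: (cvge_to_le cL); apply: nearW => n; apply: (le_trans (ge_box _ _)).
  apply: le_measure; rewrite ?inE.
  - by apply: measurableI => //; apply: marr; exact: closed_upper_box_cylinder.
  - by apply: measurableI => //; apply: marr; exact: upper_box_cylinder.
  - apply: setIS => w h p /h; rewrite addr0; apply: lt_le_trans.
    by rewrite ltrDl harmonic_gt0.
have sE' := cylinder_upper_boxes sE.
have [|_ _ //] := @product_rule_generated _ _ _ P _ (@upper_boxes R (nat * nat)%type)
  (arrival_noise k) (brownian_noise W 0) D mD (@upper_boxes_setI _ _) _ E sE'.
  move=> _ [l _ <-]; split; [apply: marr|apply: mn|exact: eq_box]; exact: upper_box_cylinder.
Qed.

End fixed_arrival.
End noise_at_arrival.

(** * Integration with an independent variable frozen *)

Section freezing.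
Context d d1 d2 (Omega : measurableType d) (X : measurableType d1) (Y : measurableType d2).
Context (R : realType) (P : probability Omega R).
Context (x : Omega -> X) (y y' : Omega -> Y) (H : X * Y -> \bar R).
Hypotheses (mx : measurable_fun setT x) (my : measurable_fun setT y)
  (my' : measurable_fun setT y').
Hypothesis xy : forall A B, measurable A -> measurable B ->
  P (x @^-1` A `&` y @^-1` B) = (P (x @^-1` A) * P (y' @^-1` B))%E.
Hypotheses (mH : measurable_fun setT H) (H0 : forall p, (0 <= H p)%E).

Let fx : {mfun Omega >-> X} := HB.pack x (isMeasurableFun.Build _ _ _ _ _ mx).
Let fy' : {mfun Omega >-> Y} := HB.pack y' (isMeasurableFun.Build _ _ _ _ _ my').
Let mz : measurable_fun setT (fun w => (x w, y w)).
Proof. exact: measurable_fun_pair. Qed.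
Let fz : {mfun Omega >-> (X * Y)%type} :=
  HB.pack (fun w => (x w, y w)) (isMeasurableFun.Build _ _ _ _ _ mz).

Let FE w : (\int[P]_w' H (x w, y' w') = fubini_F (distribution P fy') H (x w))%E.
Proof.
rewrite /fubini_F (ge0_integral_distribution (P := P) fy')//.
exact: measurableT_comp (pair1_measurable (x w)).
Qed.

Lemma measurable_frozen_integral :
  measurable_fun setT (fun w => \int[P]_w' H (x w, y' w'))%E.
Proof.
under eq_fun do rewrite FE.
apply: measurableT_comp mx => //.
exact: (measurable_fun_fubini_tonelli_F _ mH H0).
Qed.

(** By [xy], the law of [(x, y)] is the product of the laws of [x] and [y']; Tonelli's theorem then
    takes the place of conditional expectation. *)
Lemma integral_frozen :
  (\int[P]_w H (x w, y w) = \int[P]_w \int[P]_w' H (x w, y' w'))%E.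
Proof.
transitivity (\int[distribution P fz]_p H p)%E.
  by rewrite ge0_integral_distribution.
transitivity (\int[(distribution P fx \x distribution P fy')%E]_p H p)%E.
  apply: eq_measure_integral => A mA _; apply/esym; apply: product_measure_unique => //.
rewrite (fubini_tonelli1 _ mH H0) ge0_integral_distribution//; last first.
- by move=> p; exact: integral_ge0.
- exact: (measurable_fun_fubini_tonelli_F _ mH H0).
by apply: eq_integral => w _ /=; rewrite FE.
Qed.

End freezing.

Section renewed_noise.
Context d (Omega : measurableType d) (R : realType) (P : probability Omega R).
Context (W : R -> Omega -> R).
Context (F : probability (measurableTypeR R) R) (T : nat -> Omega -> R).
Hypothesis Pc : measure_is_complete P.
Hypothesis bmW : standard_brownian_motion P W.
Hypothesis rtT : renewal_times P F T.
Hypothesis WN : independent_systems P (sigma_generated `[0, +oo[ W)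
    (sigma_generated `[0, +oo[ (counting_process T)).
Context (N0 : set Omega).
Hypotheses (mN0 : measurable N0) (PN0 : P N0 = 0%E).
Hypothesis Wc : forall w, ~ N0 w -> {within `[0, +oo[%classic, continuous (W ^~ w)}.

Definition cycle_noise k w : R * path_space R (nat * nat)%type :=
  (gap T k w, arrival_noise W T k w).

Lemma measurable_cycle_noise k : measurable_fun setT (cycle_noise k).
Proof.
apply: measurable_fun_pair; first exact: (measurable_gap rtT).
exact: (measurable_arrival_noise Pc bmW rtT mN0 PN0 Wc k).
Qed.

(** On rectangles: the noise is split from past and gap, then the gap from the past, and the two
    factors are recombined by independence within the first cycle. *)
Lemma cycle_noise_independent k A E :
  stopped_sigma_algebra (smallest_filtration W T) (T k) A -> measurable E ->
  P (A `&` cycle_noise k @^-1` E) = (P A * P (cycle_noise 0 @^-1` E))%E.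
Proof.
move=> sA mE; have mA : measurable A by case: sA.
pose G := [set B `*` C | B in @measurable _ R & C in @measurable _ (path_space R (nat * nat)%type)].
have GI : setI_closed G.
  move=> _ _ [B1 mB1 [C1 mC1 <-]] [B2 mB2 [C2 mC2 <-]]; rewrite -setXI.
  exists (B1 `&` B2); first exact: measurableI.
  by exists (C1 `&` C2) => //; exact: measurableI.
have mc j E' : measurable E' -> measurable (cycle_noise j @^-1` E').
  by move=> mE'; rewrite -[X in measurable X]setTI; exact: (@measurable_cycle_noise j measurableT E' mE').
have mG E' : G E' -> measurable E'.
  by move=> [B mB [C mC <-]]; exact: measurableX.
have sE : <<s G >> E by move: mE; rewrite measurable_prod_measurableType.
have [|_ _ //] := @product_rule_generated _ _ _ P _ G (cycle_noise k) (cycle_noise 0) A mA GI _ E sE.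
  move=> E' GE'; split; [apply: mc; exact: mG|apply: mc; exact: mG|].
  case: GE' => B mB [C mC <-{E'}].
  have -> : cycle_noise 0 @^-1` (B `*` C) = gap T 0 @^-1` B `&` brownian_noise W 0 @^-1` C.
    by apply/seteqP; split=> w /=; rewrite /arrival_noise (rt_start rtT).
  have -> : cycle_noise k @^-1` (B `*` C) = gap T k @^-1` B `&` arrival_noise W T k @^-1` C by [].
  rewrite setIA (arrival_noise_independent Pc bmW rtT WN mN0 PN0 Wc sA)//.
  rewrite (arrival_gap_independent bmW rtT WN mN0 PN0 sA)//.
  by rewrite (gap_noise0 bmW rtT WN)// muleA.
Qed.

End renewed_noise.

(** * Surplus and drawdown over one cycle *)

(* Drawdown at the end of a cycle of length [tau] that starts with drawdown [z],
   when the surplus moves by [c * u + v * p u] during the first [u] time units. *)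
Definition cycle_step (R : realType) (c v z tau : R) (p : R -> R) : R :=
  fine (maxe z%:E (ereal_sup [set (c * Num.min (grid_time R q) tau +
    v * p (Num.min (grid_time R q) tau))%:E | q in [set: nat * nat]]))
  - (c * tau + v * p tau).

Lemma eq_cycle_step (R : realType) (c v z tau : R) (p p' : R -> R) : 0 <= tau ->
  (forall u, 0 <= u <= tau -> p u = p' u) ->
  cycle_step c v z tau p = cycle_step c v z tau p'.
Proof.
move=> t0 pp'; rewrite /cycle_step pp' ?lexx ?t0//; congr (fine (maxe _ (ereal_sup _)) - _).
apply/seteqP; split=> _ [q _ <-]; exists q => //; rewrite pp'//;
  by rewrite le_min grid_time_ge0 t0 ge_min lexx orbT.
Qed.

(** Grid points after [u], truncated at [tau], converge to [u], so continuity makes a countable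
    supremum suffice. The bound [M] makes the real supremum genuine. *)
Lemma ereal_sup_grid (R : realType) (Y : R -> R) (tau M : R) : 0 <= tau ->
  (forall (u : R) (s : nat -> R), 0 <= u <= tau -> (forall m, 0 <= s m <= tau) ->
    s m @[m --> \oo] --> u -> Y (s m) @[m --> \oo] --> Y u) ->
  (forall u, 0 <= u <= tau -> Y u <= M) ->
  ereal_sup [set (Y (Num.min (grid_time R q) tau))%:E | q in [set: nat * nat]] =
  (sup [set Y u | u in `[0, tau]])%:E.
Proof.
move=> t0 Yc YM.
have mint (q : nat * nat) : 0 <= Num.min (grid_time R q) tau <= tau.
  by rewrite le_min grid_time_ge0 t0 ge_min lexx orbT.
have hs : has_sup [set Y u | u in `[0, tau]].
  split; first by exists (Y 0), 0 => //=; rewrite in_itv /= lexx.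
  by exists M => ? [u /=]; rewrite in_itv /= => /YM h <-.
apply/eqP; rewrite eq_le; apply/andP; split.
  apply: ge_ereal_sup => _ [q _ <-]; rewrite lee_fin; apply: ub_le_sup; first exact: hs.2.
  by exists (Num.min (grid_time R q) tau) => //=; rewrite in_itv /=.
set S := ereal_sup _.
have YS u : 0 <= u <= tau -> ((Y u)%:E <= S)%E.
  move=> /[dup] utau /andP[u0 ut].
  have cs : Y (Num.min (grid_succ m u) tau) @[m --> \oo] --> Y u.
    apply: Yc => //.
      by move=> m; exact: (mint (m, (Num.truncn (u * m.+1%:R)).+1)).
    apply: (@squeeze_cvgr _ _ _ _ (cst u) (fun m => grid_succ m u)).
    - by apply: nearW => m; rewrite le_min ut ltW ?grid_succ_gt//= ge_min lexx.
    - exact: cvg_cst.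
    - exact: cvg_grid_succ.
  have cE : (Y (Num.min (grid_succ m u) tau))%:E @[m --> \oo] --> (Y u)%:E.
    by apply: cvg_EFin => //; exact: nearW.
  apply: (cvge_to_le cE); apply: nearW => m; apply: ereal_sup_ubound.
  by exists (m, (Num.truncn (u * m.+1%:R)).+1).
have S0 : ((Y 0)%:E <= S)%E by apply: YS; rewrite lexx.
case: S YS S0 => [s| |] YS S0; rewrite ?leey//.
rewrite lee_fin; apply: ge_sup; first exact: hs.1.
by move=> _ [u /= + <-]; rewrite in_itv /= => /YS.
Qed.

(** * Pathwise formulas for a piecewise constant control *)

Section piecewise_surplus.
Context (R : realType) (Omega : Type).
Context (eta theta sigma : R) (W : R -> Omega -> R) (T : nat -> Omega -> R).
Context (B : R -> Omega -> R) (b : nat -> R) (w : Omega).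
Hypothesis T0 : T 0%N w = 0.
Hypothesis TS : forall k, T k w < T k.+1 w.
(** Holds for constant strategies and for step processes, so one computation serves both the
    equation and the value function. *)
Hypothesis Bb : forall k s, T k w <= s < T k.+1 w -> B s w = b k.
Hypothesis Wc : {within `[0, +oo[%classic, continuous (W ^~ w)}.

Let c k := drift eta theta (b k).
Let v k := volatility sigma (b k).
Let X := surplus eta theta sigma W T B.
(** Contribution of the interval [j] up to time [t]; it vanishes when the interval starts after [t],
    both minima then being [t]. *)
Let part t j := c j * (Num.min t (T j.+1 w) - Num.min t (T j w)) +
  v j * (W (Num.min t (T j.+1 w)) w - W (Num.min t (T j w)) w).

Let Tle j k : (j <= k)%N -> T j w <= T k w.
Proof.
elim: k => [|k ih]; first by rewrite leqn0 => /eqP ->.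
rewrite leq_eqVlt => /orP[/eqP ->//|]; rewrite ltnS => /ih h.
exact: le_trans h (ltW (TS k)).
Qed.

Let Tge0 k : 0 <= T k w. Proof. by rewrite -T0 Tle. Qed.

Let ito_sum n t : t < T n w ->
  ito_integral T (fun s w' => volatility sigma (B s w')) W t w =
  \sum_(j < n) v j * (W (Num.min t (T j.+1 w)) w - W (Num.min t (T j w)) w).
Proof.
move=> tn; rewrite /ito_integral; apply: cvg_lim => //; apply: cvg_near_cst.
exists n => // m /= nm; rewrite /series /= (big_cat_nat _ nm)//= [X in _ + X]big1_seq ?addr0.
  rewrite big_mkord; apply: eq_bigr => j _; rewrite (@Bb j)// lexx /=.
  exact: TS.
move=> j; rewrite mem_index_iota => /andP[_ /andP[nj _]].
have tj : t <= T j w by apply: ltW; apply: (lt_le_trans tn); exact: Tle.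
by rewrite (min_idPl tj) (min_idPl (le_trans tj (ltW (TS j)))) subrr mulr0.
Qed.

Let itv_measure (a d t : R) : 0 <= a -> a < d -> 0 <= t ->
  \int[lebesgue_measure]_(s in `[0, t]) (\1_(`[a, d[%classic) s : R) =
  Num.min t d - Num.min t a.
Proof.
move=> a0 ad t0.
rewrite /Rintegral integral_indic//.
have lm b1 b2 x y : fine (lebesgue_measure [set` Interval (BSide b1 x) (BSide b2 y)]) =
    if x < y then y - x else 0 :> R.
  transitivity (fine (if x%:E < y%:E then y%:E - x%:E else 0)%E).
    exact: congr1 (lebesgue_measure_itv _).
  by rewrite lte_fin; case: ifP.
have [ta|at_] := ltP t a.
  rewrite (_ : _ `&` _ = set0) ?measure0.
    by rewrite (min_idPl (ltW (lt_trans ta ad))) subrr.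
  apply/seteqP; split=> s //=; rewrite !in_itv /= => -[/andP[h1 _] /andP[_ h2]].
  by move: ta; rewrite ltNge (le_trans h1 h2).
have [td|dt] := ltP t d.
  rewrite (_ : _ `&` _ = `[a, t]%classic).
    rewrite lm /=; case: ltP => // ta.
    by apply/eqP; rewrite eq_sym subr_eq0 eq_le at_ ta.
  apply/seteqP; split=> s /=; rewrite !in_itv /=.
    by move=> [/andP[-> _] /andP[_ ->]].
  by move=> /andP[h1 h2]; rewrite h1 h2 (le_lt_trans h2)// (le_trans a0).
rewrite (_ : _ `&` _ = `[a, d[%classic).
  by rewrite lm /= ad.
apply/seteqP; split=> s /=; rewrite !in_itv /=; first by case.
by move=> /andP[h1 h2]; rewrite h1 h2 (le_trans a0)//= (le_trans (ltW h2)).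
Qed.

(** Exactly one of the first [n] intervals contains a given [s <= t]. Working before some [T n]
    avoids [T k --> +oo], which holds only almost surely. *)
Let drift_sum n t : 0 <= t -> t < T n w ->
  \int[lebesgue_measure]_(s in `[0, t]) drift eta theta (B s w) =
  \sum_(j < n) c j * (Num.min t (T j.+1 w) - Num.min t (T j w)).
Proof.
move=> t0 tn.
have intc j : lebesgue_measure.-integrable `[0, t]
    (EFin \o (fun s => c j * \1_(`[T j w, T j.+1 w[%classic) s)).
  rewrite (_ : _ \o _ = (fun s => (c j)%:E * (\1_(`[T j w, T j.+1 w[%classic) s)%:E)%E)//.
  apply: integrableZl => //; apply: integrableS (integrable_indic_itv _ _ _ _) => //.
have intS m : lebesgue_measure.-integrable `[0, t]
    (EFin \o (fun s => \sum_(j < m) c j * \1_(`[T j w, T j.+1 w[%classic) s)).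
  rewrite (_ : _ \o _ = (fun s => \sum_(j < m) (c j * \1_(`[T j w, T j.+1 w[%classic) s)%:E)%E); last first.
    by apply/funext => s /=; rewrite sumEFin.
  by apply: integrable_sum => // j _; exact: intc.
transitivity (\int[lebesgue_measure]_(s in `[0, t])
    \sum_(j < n) c j * \1_(`[T j w, T j.+1 w[%classic) s).
  apply: eq_Rintegral => s; rewrite inE /= in_itv /= => /andP[s0 st].
  have : s < T n w by exact: le_lt_trans tn.
  elim: n {tn} => [|n ih]; first by rewrite T0 ltNge s0.
  have [sn _|ns sn1] := ltP s (T n w).
    rewrite big_ord_recr /= -ih// indicE memNset ?mulr0 ?addr0//.
    by rewrite /= in_itv /= => /andP[]; rewrite leNgt sn.
  rewrite big_ord_recr /= big1 ?add0r.
    by rewrite indicE mem_set ?mulr1 ?(@Bb n)//= ?in_itv/= ns.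
  move=> j _; rewrite indicE memNset ?mulr0//= in_itv /= => /andP[_].
  by rewrite ltNge (le_trans _ ns)// Tle.
elim: n {tn} => [|n ih]; first by rewrite big_ord0 -[RHS](Rintegral_set0 lebesgue_measure (fun=> 0));
  under eq_Rintegral do rewrite big_ord0; rewrite /Rintegral !integral0_eq.
under eq_Rintegral do rewrite big_ord_recr /=.
rewrite RintegralD//; last exact: intS.
rewrite ih big_ord_recr /= RintegralZl//.
  by rewrite itv_measure.
exact: integrableS (integrable_indic_itv _ _ _ _).
Qed.

Lemma surplus_sum n t : 0 <= t -> t < T n w -> X t w = \sum_(j < n) part t j.
Proof.
by move=> t0 tn; rewrite /X /surplus (drift_sum t0 tn) (ito_sum tn) -big_split.
Qed.

Lemma surplus0 : X 0 w = 0.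
Proof.
rewrite (@surplus_sum 1)//; last by rewrite -T0 TS.
rewrite big_ord_recr big_ord0 /part /= T0 (min_idPl (Tge0 1)) minxx !subrr.
by rewrite !mulr0 !addr0.
Qed.

Lemma surplus_cycle k u : 0 <= u <= T k.+1 w - T k w ->
  X (T k w + u) w = X (T k w) w + (c k * u + v k * (W (T k w + u) w - W (T k w) w)).
Proof.
move=> /andP[u0 ut]; have uT : T k w + u <= T k.+1 w by rewrite -lerBrDl.
(* The bound is [T k.+2] because [u] may reach the end of the cycle. *)
have lt1 : T k w + u < T k.+2 w by exact: le_lt_trans (TS _).
have lt2 : T k w < T k.+2 w by exact: lt_trans (TS _) (TS _).
rewrite (surplus_sum _ lt1) ?addr_ge0// (surplus_sum _ lt2)//.
rewrite !big_ord_recr /=.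
have E j : (j < k)%N -> part (T k w + u) j = part (T k w) j.
  move=> jk; have h1 : T j.+1 w <= T k w by exact: Tle.
  have h2 : T j w <= T k w by exact: Tle (ltnW jk).
  by rewrite /part !min_r// ?(le_trans h1) ?(le_trans h2)// lerDl.
rewrite (eq_bigr (fun j : 'I_k => part (T k w) j)); last by move=> j _; exact: E.
rewrite /part (min_idPl uT) (min_r (_ : T k w <= T k w + u)) ?lerDl//.
rewrite (min_l (ltW lt1)) (min_l (ltW lt2)) (min_l (ltW (TS k))) minxx !subrr.
by ring.
Qed.

Let Wbounded M : exists K, forall u, 0 <= u <= M -> `|W u w| <= K.
Proof.
have [M0|M0] := ltP M 0.
  by exists 0 => u /andP[u0 uM]; move: M0; rewrite ltNge (le_trans u0 uM).
have cW : {within `[0, M], continuous (W ^~ w)}.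
  apply: continuous_subspaceW Wc => s /=; rewrite !in_itv /= andbT.
  by case/andP.
have [s _ hs] := EVT_max M0 cW; have [s' _ hs'] := EVT_min M0 cW.
exists (`|W s w| + `|W s' w|) => u uM.
have := hs u; have := hs' u; rewrite in_itv /= uM => /(_ isT) h1 /(_ isT) h2.
rewrite ler_norml; apply/andP; split.
  apply: (le_trans _ h1); rewrite lerNl; apply: le_trans (_ : `|W s' w| <= _).
    by rewrite -normrN ler_norm.
  by rewrite lerDr.
by apply: (le_trans h2); apply: (le_trans (ler_norm _)); rewrite lerDl.
Qed.

(** Ensures that the supremum in the drawdown is not a default value. *)
Lemma surplus_bounded k : has_ubound [set X s w | s in `[0, T k w]].
Proof.
have [K hK] := Wbounded (T k.+1 w).
exists (\sum_(j < k.+1) (`|c j| * (T k.+1 w + T k.+1 w) + `|v j| * (K + K))).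
move=> ? [s /=]; rewrite in_itv /= => /andP[s0 sk] <-.
have sk1 : s < T k.+1 w by exact: le_lt_trans (TS k).
rewrite (surplus_sum s0 sk1); apply: ler_sum => j _.
have mb i : 0 <= Num.min s (T i w) <= T k.+1 w.
  by rewrite le_min s0 Tge0 /= ge_min ltW.
apply: lerD; apply: (le_trans (ler_norm _)); rewrite normrM ler_wpM2l//.
  apply: (le_trans (ler_normB _ _)).
  have h i : `|Num.min s (T i w)| <= T k.+1 w by case/andP: (mb i) => h ?; rewrite ger0_norm.
  by rewrite lerD.
by apply: (le_trans (ler_normB _ _)); rewrite lerD// hK.
Qed.

Lemma drawdown_ge0 z k : 0 <= drawdown eta theta sigma W T B z (T k w) w.
Proof.
rewrite /drawdown subr_ge0 le_max; apply/orP; right.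
apply: ub_le_sup; first exact: surplus_bounded.
by exists (T k w) => //=; rewrite in_itv /= Tge0 lexx.
Qed.

Lemma drawdown0 z : 0 <= z -> drawdown eta theta sigma W T B z (T 0 w) w = z.
Proof.
move=> z0; rewrite /drawdown T0 -/X surplus0 subr0.
rewrite [X in sup X](_ : _ = [set 0]) ?sup1 ?max_l//.
apply/seteqP; split=> x /=.
  move=> [s]; rewrite in_itv /= => s0 <-; have -> : s = 0 by apply/eqP; rewrite eq_le andbC.
  exact: surplus0.
by move=> ->; exists 0; rewrite ?in_itv /= ?lexx// -/X surplus0.
Qed.

(** The running maximum at [T k.+1] is the larger of that at [T k] and of the maximum over the
    cycle. Subtracting the surplus at [T k] turns the former, joined with [z], into the drawdown at
    [T k]. *)
Lemma drawdown_cycle z k :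
  drawdown eta theta sigma W T B z (T k.+1 w) w =
  cycle_step (c k) (v k) (drawdown eta theta sigma W T B z (T k w) w)
    (T k.+1 w - T k w) (fun u => W (T k w + u) w - W (T k w) w).
Proof.
set tau := T k.+1 w - T k w; have tau0 : 0 <= tau by rewrite subr_ge0 ltW.
pose Y u := c k * u + v k * (W (T k w + u) w - W (T k w) w).
have XY u : 0 <= u <= tau -> X (T k w + u) w = X (T k w) w + Y u by exact: surplus_cycle.
have Ttau : T k w + tau = T k.+1 w by rewrite /tau addrC subrK.
have Yc (u : R) (s : nat -> R) : 0 <= u <= tau -> (forall m, 0 <= s m <= tau) ->
    s m @[m --> \oo] --> u -> Y (s m) @[m --> \oo] --> Y u.
  move=> /andP[u0 ut] s0 su; apply: cvgD; first exact: cvgMr.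
  apply: cvgMr; apply: cvgB; last exact: cvg_cst.
  apply: (@within_cvg_seq _ (W ^~ w) _ _ Wc).
  - by rewrite addr_ge0.
  - by move=> m; case/andP: (s0 m) => h _; rewrite addr_ge0.
  - by apply: cvgD => //; exact: cvg_cst.
have [M hM] := surplus_bounded k.+1.
have YM u : 0 <= u <= tau -> Y u <= M - X (T k w) w.
  move=> /[dup] /andP[u0 ut] h; rewrite lerBrDl -XY//; apply: hM.
  by exists (T k w + u) => //=; rewrite in_itv /= addr_ge0//= -Ttau lerD2l.
rewrite /cycle_step (ereal_sup_grid tau0 Yc YM) -/(Y tau).
set y := sup _; set Sk := sup [set X s w | s in `[0, T k w]].
have hsY : has_sup [set Y u | u in `[0, tau]].
  split; first by exists (Y 0), 0 => //=; rewrite in_itv /= lexx.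
  by exists (M - X (T k w) w) => ? [u /=]; rewrite in_itv /= => /YM h <-.
have hsX j : has_sup [set X s w | s in `[0, T j w]].
  split; last exact: surplus_bounded.
  by exists (X 0 w), 0 => //=; rewrite in_itv /= lexx Tge0.
have supE : sup [set X s w | s in `[0, T k.+1 w]] = Num.max Sk (X (T k w) w + y).
  apply/eqP; rewrite eq_le; apply/andP; split.
    apply: ge_sup; first exact: (hsX k.+1).1.
    move=> ? [s /=]; rewrite in_itv /= => /andP[s0 s1] <-; rewrite le_max.
    have [sk|ks] := leP s (T k w); apply/orP; [left|right].
      apply: ub_le_sup; first exact: (hsX k).2.
      by exists s => //=; rewrite in_itv /= s0.
    have st : 0 <= s - T k w <= tau by rewrite subr_ge0 (ltW ks)/= lerBlDl Ttau.
    have := XY _ st; rewrite addrC subrK => ->; rewrite lerD2l.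
    by apply: ub_le_sup; [exact: hsY.2|exists (s - T k w) => //=; rewrite in_itv].
  rewrite ge_max; apply/andP; split.
    apply: ge_sup; first exact: (hsX k).1.
    move=> ? [s /=]; rewrite in_itv /= => /andP[s0 s1] <-.
    apply: ub_le_sup; first exact: (hsX k.+1).2.
    by exists s => //=; rewrite in_itv /= s0 (le_trans s1)// ltW.
  rewrite -lerBrDl; apply: ge_sup; first exact: hsY.1.
  move=> ? [u /=]; rewrite in_itv /= => ut <-; rewrite lerBrDl -XY//.
  apply: ub_le_sup; first exact: (hsX k.+1).2.
  case/andP: ut => u0 ut.
  by exists (T k w + u) => //=; rewrite in_itv /= addr_ge0//= -Ttau lerD2l.
rewrite /drawdown -/X supE -Ttau XY ?lexx ?tau0// -EFin_max /=.
rewrite opprD addrA; congr (_ - _).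
by rewrite maxA -/Sk addr_maxl [X (T k w) w + y]addrC addrK.
Qed.

End piecewise_surplus.

(** * The filtration at arrival times *)

Lemma limn_esup_shift (R : realType) (u : (\bar R)^nat) (n : nat) :
  limn_esup (fun m => u (m + n)%N) = limn_esup u.
Proof.
rewrite !limn_esup_lim; apply: cvg_lim => //.
have -> : esups (fun m => u (m + n)%N) = (fun m => esups u (m + n)%N).
  apply/funext => m; rewrite /esups /=; congr ereal_sup.
  apply/seteqP; split=> _ [j /= mj <-].
    by exists (j + n)%N => //=; rewrite leq_add2r.
  exists (j - n)%N => /=; first by rewrite leq_subRL ?(leq_trans _ mj) ?leq_addl// addnC.
  by rewrite subnK// (leq_trans _ mj)// leq_addl.
rewrite cvg_shiftn; exact: is_cvg_esups.
Qed.

Section smallest_filtration_facts.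
Context d (Omega : measurableType d) (R : realType) (P : probability Omega R).
Context (W : R -> Omega -> R).
Context (F : probability (measurableTypeR R) R) (T : nat -> Omega -> R).
Hypothesis bmW : standard_brownian_motion P W.
Hypothesis rtT : renewal_times P F T.

Let Ft := smallest_filtration W T.

Lemma smallest_filtration_salg t : 0 <= t -> sigma_algebra setT (Ft t).
Proof.
move=> t0; split.
- by move=> G [sG mG iG] rG aW aN; exact: (salg_0 (sG t t0)).
- move=> A FA G fG rG aW aN; rewrite setTD; have [sG _ _] := fG.
  by apply: (salg_C (sG t t0)); exact: FA.
- move=> A FA G fG rG aW aN; have [sG _ _] := fG.
  by apply: (salg_U (sG t t0)) => n; exact: FA.
Qed.

Lemma smallest_filtration_le s t : 0 <= s -> s <= t -> Ft s `<=` Ft t.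
Proof.
move=> s0 st A FA G fG rG aW aN; have [_ _ iG] := fG.
exact: (iG _ _ s0 st) (FA G fG rG aW aN).
Qed.

Lemma smallest_filtration_right t A : 0 <= t -> (forall s, t < s -> Ft s A) -> Ft t A.
Proof.
move=> t0 FA G fG rG aW aN; rewrite (rG t t0) => s /=; rewrite in_itv /= andbT => ts.
exact: FA.
Qed.

Lemma smallest_filtration_W t B : 0 <= t -> measurable B -> Ft t (W t @^-1` B).
Proof. by move=> t0 mB G fG rG aW aN; exact: aW. Qed.

Lemma smallest_filtration_arrival k t : 0 <= t -> Ft t [set w | T k w <= t].
Proof.
move=> t0; case: k => [|k].
  rewrite [X in Ft t X](_ : _ = setT); first exact: (salg_T (smallest_filtration_salg t0)).
  by apply/seteqP; split=> w //= _; rewrite (rt_start rtT).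
move=> G fG rG aW aN; rewrite [X in G t X](_ : _ = counting_process T t @^-1` `[k.+1%:R%:E, +oo[).
  by apply: aN => //; exact: emeasurable_itv.
by apply/seteqP; split=> w /=; rewrite in_itv /= andbT (counting_process_ge rtT).
Qed.

Definition arrival_salg k := stopped_sigma_algebra Ft (T k).

Lemma arrival_salgP k : sigma_algebra setT (arrival_salg k).
Proof.
split.
- split=> // t t0; rewrite set0I; exact: (salg_0 (smallest_filtration_salg t0)).
- move=> A [mA FA]; rewrite setTD; split; first exact: measurableC.
  move=> t t0; have sF := smallest_filtration_salg t0.
  rewrite [X in Ft t X](_ : _ = [set w | T k w <= t] `\` (A `&` [set w | T k w <= t])).
    by apply: (salg_D sF); [exact: smallest_filtration_arrival|exact: FA].
  apply/seteqP; split=> w /= [h1 h2]; split=> //; first by move=> [].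
  by move=> Aw; apply: h2; split.
- move=> A FA; split; first by apply: bigcupT_measurable => n; case: (FA n).
  move=> t t0; rewrite setI_bigcupl; apply: (salg_U (smallest_filtration_salg t0)) => n.
  by case: (FA n) => _; exact.
Qed.

Definition arrival_type k := g_sigma_algebraType (arrival_salg k).

Lemma arrival_measurableP k d' (Y : measurableType d') (f : Omega -> Y) :
  measurable_fun (setT : set (arrival_type k)) f <->
  (forall A, measurable A -> arrival_salg k (f @^-1` A)).
Proof. by apply: measurable_fun_salgE; exact: arrival_salgP. Qed.

Lemma arrival_salg_le j k : (j <= k)%N -> arrival_salg j `<=` arrival_salg k.
Proof.
move=> jk A [mA FA]; split => // t t0; have sF := smallest_filtration_salg t0.
rewrite [X in Ft t X](_ : _ = (A `&` [set w | T j w <= t]) `&` [set w | T k w <= t]).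
  by apply: (salg_I sF); [exact: FA|exact: smallest_filtration_arrival].
apply/seteqP; split=> w /= => [[h1 h2]|[[h1 _] h2]]; split=> //.
by split=> //; apply: le_trans h2; exact: (renewal_le rtT).
Qed.

Lemma arrival_measurable_le j k d' (Y : measurableType d') (f : Omega -> Y) : (j <= k)%N ->
  measurable_fun (setT : set (arrival_type j)) f ->
  measurable_fun (setT : set (arrival_type k)) f.
Proof.
move=> jk /arrival_measurableP h; apply/arrival_measurableP => A mA.
by apply: (arrival_salg_le jk); exact: h.
Qed.

Lemma arrival_measurable_measurable k d' (Y : measurableType d') (f : Omega -> Y) :
  measurable_fun (setT : set (arrival_type k)) f -> measurable_fun setT f.
Proof.
move=> /arrival_measurableP h _ A mA; rewrite setTI.
by case: (h A mA).
Qed.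

Lemma arrival_measurable_time k : measurable_fun (setT : set (arrival_type k)) (T k).
Proof.
apply: (measurability _ (RGenOInfty.measurableE R)) => _ [_ [a ->] <-].
rewrite setTI; apply: sub_sigma_algebra; split.
  by rewrite -[X in measurable X]setTI; apply: (rt_measurable rtT).
move=> t t0; have sF := smallest_filtration_salg t0.
have [ta|at_] := leP t a.
  rewrite [X in Ft t X](_ : _ = set0); first exact: (salg_0 sF).
  apply/seteqP; split=> w //=; rewrite in_itv /= andbT => -[h1 h2].
  by move: h1; rewrite ltNge (le_trans h2 ta).
have [a0|a0] := ltP a 0.
  rewrite [X in Ft t X](_ : _ = [set w | T k w <= t]); first exact: smallest_filtration_arrival.
  apply/seteqP; split=> w /=; first by case.
  by move=> h; split=> //; rewrite in_itv /= andbT (lt_le_trans a0)// (renewal_ge0 rtT).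
rewrite [X in Ft t X](_ : _ = [set w | T k w <= t] `\` [set w | T k w <= a]).
  apply: (salg_D sF); first exact: smallest_filtration_arrival.
  by apply: (smallest_filtration_le a0 (ltW at_)); exact: smallest_filtration_arrival.
apply/seteqP; split=> w /=; rewrite in_itv /= andbT => -[h1 h2]; split=> //.
  by apply/negP; rewrite -ltNge.
by move/negP: h2; rewrite -ltNge.
Qed.

(** Where [T k <= t], the terms may look past [t], by less and less as [m] grows; right-continuity
    removes the excess in the limit. *)
Lemma arrival_measurable_limit k (f : nat -> Omega -> \bar R) :
  (forall m, measurable_fun setT (f m)) ->
  (forall t s, 0 <= t -> t < s -> exists n, forall m B, (n <= m)%N -> measurable B ->
     Ft s (f m @^-1` B `&` [set w | T k w <= t])) ->
  measurable_fun (setT : set (arrival_type k)) (fun w => limn_esup (f ^~ w)).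
Proof.
move=> mf Ff; apply/arrival_measurableP => A mA; split.
  by rewrite -[X in measurable X]setTI; apply: (measurable_fun_limn_esup mf).
move=> t t0; apply: smallest_filtration_right => // s ts.
have s0 : 0 <= s by exact: le_trans (ltW ts).
have sF := smallest_filtration_salg s0.
have [n hn] := Ff t s t0 ts.
pose D := [set w | T k w <= t].
have FD : Ft s D by apply: (smallest_filtration_le t0 (ltW ts)); exact: smallest_filtration_arrival.
(* Dropping [n] terms and putting 0 off [D] makes every term measurable at time [s], with the same
   limit superior on [D]. *)
pose h m w := if T k w <= t then f (m + n)%N w else 0%E.
have mh m : measurable_fun (setT : set (g_sigma_algebraType (Ft s))) (h m).
  apply: (proj2 (measurable_fun_salgE (h m) sF)) => B mB.
  have FB : Ft s (f (m + n)%N @^-1` B `&` D) by apply: hn => //; rewrite leq_addl.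
  have [B0|B0] := pselect (B 0%E).
    rewrite [X in Ft s X](_ : _ = (f (m + n)%N @^-1` B `&` D) `|` ~` D).
      rewrite -[X in Ft s X]setCK setCU setCK; apply: (salg_C sF); apply: (salg_I sF) => //.
      exact: (salg_C sF).
    apply/seteqP; split=> w; rewrite /h /D /=.
      by case: ifPn => [Tw Bw|/negP Tw _]; [left|right].
    by case=> [[Bw ->]//|/negP/negbTE ->].
  rewrite [X in Ft s X](_ : _ = f (m + n)%N @^-1` B `&` D)//.
  apply/seteqP; split=> w; rewrite /h /D /=.
    by case: ifPn => //.
  by case=> Bw ->.
have mL := measurable_fun_limn_esup mh.
have FL := proj1 (measurable_fun_salgE _ sF) mL A mA.
rewrite [X in Ft s X](_ : _ = ((fun w => limn_esup (h ^~ w)) @^-1` A) `&` D).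
  exact: (salg_I sF).
apply/seteqP; split=> w /= [h1 h2]; split=> //; move: h1.
  rewrite -(limn_esup_shift _ n); congr (A _); congr limn_esup.
  by apply/funext => m; rewrite /h ifT.
rewrite -[in X in _ -> X](limn_esup_shift _ n); congr (A _); congr limn_esup.
by apply/funext => m; rewrite /h ifT.
Qed.

(* The limit superior makes the value of [W] at a random time measurable for
   the filtration, whose sigma-algebras need not contain the null sets. *)
Definition hat_W (u : R) (w : Omega) : R :=
  fine (limn_esup (fun m => (W (grid_succ m u) w)%:E)).

Lemma hat_WE u w : {within `[0, +oo[%classic, continuous (W ^~ w)} -> 0 <= u ->
  hat_W u w = W u w.
Proof.
move=> Wc u0; rewrite /hat_W.
have : (W (grid_succ m u) w)%:E @[m --> \oo] --> (W u w)%:E.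
  apply: cvg_EFin; first by apply: nearW.
  apply: (@within_cvg_seq _ (W^~ w) _ _ Wc) => //.
    by move=> m; rewrite divr_ge0.
  exact: cvg_grid_succ.
by move=> /cvg_limn_einf_sup [_ ->].
Qed.

(** The samples are taken at most [1 / (m + 1)] after [U], so where [T k <= t] they are known at
    time [s] once the mesh is below [s - t]. *)
Lemma arrival_measurable_hat_W k (U : Omega -> R) :
  measurable_fun (setT : set (arrival_type k)) U ->
  (forall w, 0 <= U w <= T k w) ->
  measurable_fun (setT : set (arrival_type k)) (fun w => hat_W (U w) w).
Proof.
move=> mU hU; have mU' := arrival_measurable_measurable mU.
rewrite /hat_W; apply: measurableT_comp => //.
apply: arrival_measurable_limit => [m|t s t0 ts].
  apply/measurable_EFinP.
  apply: (@measurable_fun_index _ _ _ _ (fun w => Num.truncn (U w * m.+1%:R))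
    (fun j w => W (j.+1%:R / m.+1%:R) w)).
    by move=> j; apply: measurable_truncn_eq; exact: measurable_funM.
  by move=> j; apply: (bm_measurable bmW); rewrite divr_ge0.
have ts0 : 0 < s - t by rewrite subr_gt0.
have [n _ hn] : \forall n \near \oo, harmonic n < s - t.
  have := @cvg_harmonic R => /cvgrPdist_lt /(_ _ ts0); apply: filterS => n.
  by rewrite sub0r normrN ger0_norm ?harmonic_ge0.
exists n => m B nm mB; have {}hn : m.+1%:R^-1 < s - t by exact: (hn m nm).
have s0 : 0 <= s by exact: le_trans (ltW ts).
have sF := smallest_filtration_salg s0.
rewrite [X in Ft s X](_ : _ = \bigcup_(j in [set j | j.+1%:R / m.+1%:R <= s])
  (([set w | Num.truncn (U w * m.+1%:R) = j] `&` [set w | T k w <= t]) `&`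
   (EFin \o W (j.+1%:R / m.+1%:R)) @^-1` B)).
  apply: (salg_U_cond sF) => j /= js; apply: (salg_I sF).
    apply: (smallest_filtration_le t0 (ltW ts)).
    have mj : (arrival_salg k) [set w | Num.truncn (U w * m.+1%:R) = j].
      have := @measurable_truncn_eq R _ (arrival_type k) (fun w => U w * m.+1%:R) j.
      rewrite /measurable /= (sigma_algebra_id (arrival_salgP k)); apply.
      exact: measurable_funM.
    by case: mj => _; exact.
  apply: (smallest_filtration_le _ js); first by rewrite divr_ge0.
  rewrite (_ : _ @^-1` B = W (j.+1%:R / m.+1%:R) @^-1` (EFin @^-1` B))//.
  apply: smallest_filtration_W; first by rewrite divr_ge0.
  by rewrite -[X in measurable X]setTI; exact: EFin_measurable.
apply/seteqP; split=> w /=.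
  move=> [Bw Tt]; exists (Num.truncn (U w * m.+1%:R)) => //=.
  have /andP[u0 uT] := hU w.
  have := grid_succ_le m u0; rewrite /grid_succ => h; apply: (le_trans h).
  by rewrite -lerBrDl (le_trans (ltW hn))// lerD2l lerN2 (le_trans uT).
by move=> [j js [[<- Tt] Bw]].
Qed.

End smallest_filtration_facts.

(** Over an arbitrary measurable type, as it is applied both to the sigma-algebra at [T k.+1] and to
    functions of the noise. *)
Lemma measurable_cycle_step d (X : measurableType d) (R : realType)
  (c v z tau : X -> R) (p : X -> R -> R) :
  measurable_fun setT c -> measurable_fun setT v -> measurable_fun setT z ->
  measurable_fun setT tau ->
  (forall q, measurable_fun setT (fun x => p x (Num.min (grid_time R q) (tau x)))) ->
  measurable_fun setT (fun x => p x (tau x)) ->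
  measurable_fun setT (fun x => cycle_step (c x) (v x) (z x) (tau x) (p x)).
Proof.
move=> mc mv mz mt mq mp; apply: measurable_funB; last first.
  by apply: measurable_funD; exact: measurable_funM.
apply: measurableT_comp => //; apply: measurable_maxe; first exact/measurable_EFinP.
apply: measurable_ereal_sup => q; apply/measurable_EFinP; apply: measurable_funD.
  apply: measurable_funM => //; apply: measurable_minr => //.
exact: measurable_funM.
Qed.

(** * One cycle as a function of the noise *)

Section noise_functional.
Context (R : realType).

(* Recovers the increment over [0, u] from the increments over the grids. *)
Definition noise_path (y : path_space R (nat * nat)%type) (u : R) : R :=
  fine (limn_esup (fun m => (y (m, (Num.truncn (u * m.+1%:R)).+1))%:E)).

Lemma measurable_noise_path d (X : measurableType d) (u : X -> R)
    (y : X -> path_space R (nat * nat)%type) :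
  measurable_fun setT u -> measurable_fun setT y ->
  measurable_fun setT (fun x => noise_path (y x) (u x)).
Proof.
move=> mu my; apply: measurableT_comp => //.
apply: measurable_fun_limn_esup => m; apply/measurable_EFinP.
apply: (@measurable_fun_index _ _ _ _ (fun x => Num.truncn (u x * m.+1%:R))
  (fun j x => y x (m, j.+1))).
  by move=> j; apply: measurable_truncn_eq; exact: measurable_funM.
by move=> j; exact: (measurableT_comp (measurable_coord (m, j.+1)) my).
Qed.

Lemma noise_path_brownian d (Omega : measurableType d) (W : R -> Omega -> R) (s u : R) w :
  {within `[0, +oo[%classic, continuous (W ^~ w)} -> 0 <= s -> 0 <= u ->
  noise_path (brownian_noise W s w) u = W (s + u) w - W s w.
Proof.
move=> Wc s0 u0; rewrite /noise_path.
have : (W (s + grid_succ m u) w - W s w)%:E @[m --> \oo] --> (W (s + u) w - W s w)%:E.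
  apply: cvg_EFin; first by apply: nearW.
  apply: cvgB; last exact: cvg_cst.
  apply: (@within_cvg_seq _ (W^~ w) _ _ Wc) => //.
  - by rewrite addr_ge0.
  - by move=> m; rewrite addr_ge0// divr_ge0.
  - by apply: cvgD; [exact: cvg_cst|exact: cvg_grid_succ].
by move=> /cvg_limn_einf_sup [_ h]; rewrite [limn_esup _]h.
Qed.

Context (eta theta sigma : R).

Definition noise_step (z b : R) (y : R * path_space R (nat * nat)%type) : R :=
  cycle_step (drift eta theta b) (volatility sigma b) z y.1 (noise_path y.2).

Lemma measurable_drift : measurable_fun setT (drift eta theta).
Proof.
apply: measurable_funB => //; apply: measurable_funM => //.
by apply: measurable_funB.
Qed.

Lemma measurable_volatility : measurable_fun setT (volatility sigma).
Proof. exact: measurable_funM. Qed.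

Lemma measurable_noise_step d (X : measurableType d) (z b : X -> R)
    (y : X -> R * path_space R (nat * nat)%type) :
  measurable_fun setT z -> measurable_fun setT b -> measurable_fun setT y ->
  measurable_fun setT (fun x => noise_step (z x) (b x) (y x)).
Proof.
move=> mz mb my.
have m1 : measurable_fun setT (fun x => (y x).1) by exact: measurableT_comp measurable_fst my.
have m2 : measurable_fun setT (fun x => (y x).2) by exact: measurableT_comp measurable_snd my.
apply: measurable_cycle_step => //.
- exact: measurableT_comp measurable_drift mb.
- exact: measurableT_comp measurable_volatility mb.
- move=> q; apply: measurable_noise_path => //.
  exact: measurable_minr.
- exact: measurable_noise_path.
Qed.

End noise_functional.

(** * An adapted version of the drawdown *)

Section hat_drawdown.
Context d (Omega : measurableType d) (R : realType) (P : probability Omega R).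
Context (W : R -> Omega -> R).
Context (F : probability (measurableTypeR R) R) (T : nat -> Omega -> R).
Context (eta theta sigma : R).
Hypothesis bmW : standard_brownian_motion P W.
Hypothesis rtT : renewal_times P F T.

Definition hat_step k (z b : R) (w : Omega) : R :=
  cycle_step (drift eta theta b) (volatility sigma b) z (gap T k w)
    (fun u => hat_W W (T k w + u) w - hat_W W (T k w) w).

Lemma arrival_measurable_hat_step k (z b : Omega -> R) :
  measurable_fun (setT : set (arrival_type W T k)) z ->
  measurable_fun (setT : set (arrival_type W T k)) b ->
  measurable_fun (setT : set (arrival_type W T k.+1)) (fun w => hat_step k (z w) (b w) w).
Proof.
move=> mz mb.
have up (f : Omega -> R) : measurable_fun (setT : set (arrival_type W T k)) f ->
    measurable_fun (setT : set (arrival_type W T k.+1)) f.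
  exact: (arrival_measurable_le rtT (leqnSn k)).
have mT : measurable_fun (setT : set (arrival_type W T k.+1)) (T k).
  by apply: up; exact: (arrival_measurable_time rtT).
have mg : measurable_fun (setT : set (arrival_type W T k.+1)) (gap T k).
  by apply: measurable_funB => //; exact: (arrival_measurable_time rtT).
have mW0 : measurable_fun (setT : set (arrival_type W T k.+1)) (fun w => hat_W W (T k w) w).
  apply: (arrival_measurable_hat_W bmW rtT) => // w.
  by rewrite (renewal_ge0 rtT) (renewal_le rtT).
apply: (@measurable_cycle_step _ (arrival_type W T k.+1)) => //.
- by apply: (measurableT_comp (@measurable_drift R eta theta)); exact: up.
- by apply: (measurableT_comp (@measurable_volatility R sigma)); exact: up.
- exact: up.
- move=> q; apply: measurable_funB => //.
  apply: (arrival_measurable_hat_W bmW rtT (U := fun w => T k w + Num.min (grid_time R q) (gap T k w))).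
    by apply: measurable_funD => //; exact: measurable_minr.
  move=> w; rewrite addr_ge0 ?(renewal_ge0 rtT) ?le_min ?grid_time_ge0 ?(ltW (gap_gt0 rtT _ _))//=.
  by rewrite -lerBrDl ge_min lexx orbT.
- apply: measurable_funB => //.
  apply: (arrival_measurable_hat_W bmW rtT (U := fun w => T k w + gap T k w)).
    exact: measurable_funD.
  move=> w; rewrite addr_ge0 ?(renewal_ge0 rtT) ?(ltW (gap_gt0 rtT _ _))//=.
  by rewrite /gap addrC subrK.
Qed.

(** Bridge between the two forms of a cycle: [hat_step] is the adapted one, [noise_step] the one to
    which independence applies. *)
Lemma hat_step_noise k z b w : {within `[0, +oo[%classic, continuous (W ^~ w)} ->
  hat_step k z b w = noise_step eta theta sigma z b (cycle_noise W T k w).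
Proof.
move=> Wc; apply: eq_cycle_step; first exact: ltW (gap_gt0 rtT k w).
move=> u /andP[u0 _]; have T0 := renewal_ge0 rtT k w.
by rewrite /= noise_path_brownian// !hat_WE// addr_ge0.
Qed.

Lemma hat_step_drawdown k z (B : R -> Omega -> R) (b : nat -> R) w :
  {within `[0, +oo[%classic, continuous (W ^~ w)} ->
  (forall k s, T k w <= s < T k.+1 w -> B s w = b k) ->
  drawdown eta theta sigma W T B z (T k.+1 w) w =
  hat_step k (drawdown eta theta sigma W T B z (T k w) w) (b k) w.
Proof.
move=> Wc Bb; rewrite (drawdown_cycle _ _ _ (rt_start rtT w) (rt_increasing rtT ^~ w) Bb Wc).
apply: eq_cycle_step; first exact: ltW (gap_gt0 rtT k w).
move=> u /andP[u0 _]; have T0 := renewal_ge0 rtT k w.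
by rewrite !hat_WE// addr_ge0.
Qed.

(** Defined also where the path is irregular, so that measurable feedback of it yields admissible
    controls at every outcome. *)
Fixpoint hat_drawdown (b : nat -> Omega -> R) (z : R) (k : nat) (w : Omega) : R :=
  if k is k'.+1 then hat_step k' (hat_drawdown b z k' w) (b k' w) w else z.

Lemma hat_drawdownE (B : R -> Omega -> R) (b : nat -> Omega -> R) z k w : 0 <= z ->
  {within `[0, +oo[%classic, continuous (W ^~ w)} ->
  (forall k s, T k w <= s < T k.+1 w -> B s w = b k w) ->
  drawdown eta theta sigma W T B z (T k w) w = hat_drawdown b z k w.
Proof.
move=> z0 Wc Bb; elim: k => [|k ih].
  by rewrite (@drawdown0 _ _ eta theta sigma W T B (b^~ w) w (rt_start rtT w) (rt_increasing rtT ^~ w) Bb).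
by rewrite (hat_step_drawdown _ _ Wc Bb) ih.
Qed.

Lemma arrival_measurable_hat_drawdown (b : nat -> Omega -> R) z k :
  (forall j, (j < k)%N -> measurable_fun (setT : set (arrival_type W T j)) (b j)) ->
  measurable_fun (setT : set (arrival_type W T k)) (hat_drawdown b z k).
Proof.
elim: k => [|k ih] mb; first exact: measurable_cst.
apply: arrival_measurable_hat_step; last exact: mb.
by apply: ih => j jk; apply: mb; exact: ltnW.
Qed.

Lemma step_processE (b : nat -> Omega -> R) k s w :
  T k w <= s < T k.+1 w -> step_process T b s w = b k w.
Proof.
move=> /andP[ks sk]; apply: cvg_lim => //; apply: cvg_near_cst.
exists k.+1 => // m /= km; rewrite /series /= (bigD1_seq k) ?iota_uniq//=; last first.
  by rewrite mem_index_iota.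
rewrite indicE mem_set ?mulr1/= ?in_itv/= ?ks// big1 ?addr0// => j jk.
rewrite indicE memNset ?mulr0//= in_itv /= => /andP[js sj].
case: (ltngtP j k) jk => // [jk|kj] _.
  by move: sj; rewrite ltNge (le_trans _ ks)// (renewal_le rtT).
by move: sk; rewrite ltNge (le_trans _ js)// (renewal_le rtT).
Qed.

End hat_drawdown.

(** * Verification *)

(** Monotonicity is assumed on the half-line only, hence the truncation at 0; preimages of rays are
    intervals. *)
Lemma measurable_nondecreasing_ereal (R : realType) (G : R -> \bar R) :
  (forall y y' : R, (0 <= y)%R -> (y <= y')%R -> (G y <= G y')%E) ->
  measurable_fun (setT : set R) (fun z => G (Num.max z 0)).
Proof.
move=> Gm; apply: (measurability _ (ErealGenOInfty.measurableE R)) => _ [_ [x ->] <-].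
rewrite setTI; apply: is_interval_measurable => a b /=.
rewrite !in_itv /= !andbT => Ga Gb c /andP[ac cb].
rewrite in_itv /= andbT (lt_le_trans Ga)// Gm ?le_max ?lexx ?orbT//.
by case: (leP a 0) => _; rewrite ?lexx ?orbT ?ac.
Qed.

(* By monotonicity in [z], a control that is good for some [q >= z] with [G q]
   close to [G z] is good for [z]; countably many [q] are enough, namely the
   rationals and the maxima of the level sets of [G]. *)
Lemma monotone_selector (R : realType) (G : R -> \bar R) (g : R -> R -> \bar R) (eps C : R) :
  0 < eps ->
  (forall y : R, (0 <= y)%R -> (0 <= G y <= C%:E)%E) ->
  (forall y y' : R, (0 <= y)%R -> (y <= y')%R -> (G y <= G y')%E) ->
  (forall (y y' b : R), (0 <= y)%R -> (y <= y')%R -> (g y b <= g y' b)%E) ->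
  (forall y : R, (0 <= y)%R -> exists b, 0 <= b <= 1 /\ (g y b <= G y + eps%:E)%E) ->
  exists beta : R -> R, [/\ measurable_fun setT beta, forall z, 0 <= beta z <= 1 &
    forall z : R, (0 <= z)%R -> (g z (beta z) <= G z + (eps + eps)%:E)%E].
Proof.
move=> eps0 GC Gm gm near_opt.
(* Within one level, values of [G] differ by less than [eps]. *)
pose level (j : nat) := [set y | 0 <= y /\ ((j%:R * eps)%:E <= G y < (j.+1%:R * eps)%:E)%E].
pose q (i : nat + rat) : R := `|match i with inl j => sup (level j) | inr rho => ratr rho end|.
have q0 i : 0 <= q i by rewrite /q.
pose bq i := sval (cid (near_opt (q i) (q0 i))).
have bqP i : 0 <= bq i <= 1 /\ (g (q i) (bq i) <= G (q i) + eps%:E)%E.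
  by rewrite /bq; case: cid.
pose G' z := G (Num.max z 0).
have mG' : measurable_fun setT G' by exact: measurable_nondecreasing_ereal.
pose OK n z := if @unpickle (nat + rat)%type n is Some i
  then (Num.max z 0 <= q i) && (G (q i) <= G' z + eps%:E)%E else false.
have OKex z : exists n, OK n z.
  have {}OKex : exists i, (Num.max z 0 <= q i) && (G (q i) <= G' z + eps%:E)%E; last first.
    by case: OKex => i hi; exists (pickle i); rewrite /OK pickleK.
  rewrite /G'; set z' := Num.max z 0; have z'0 : 0 <= z' by rewrite le_max lexx orbT.
  have /andP[G0 GlC] := GC z' z'0.
  have Gfin : G z' \is a fin_num by rewrite ge0_fin_numE// (le_lt_trans GlC)// ltry.
  pose x := fine (G z'); have xE : G z' = x%:E by rewrite fineK.
  have x0 : 0 <= x by rewrite -lee_fin -xE.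
  pose j := Num.truncn (x / eps).
  have /andP[jx xj] : j%:R <= x / eps < j.+1%:R.
    by apply: Num.Theory.truncn_itv; rewrite divr_ge0// ltW.
  have lz : level j z'.
    by split=> //; rewrite xE lee_fin lte_fin -ler_pdivlMr// jx -ltr_pdivrMr.
  have Glev y : level j y -> (G y <= G z' + eps%:E)%E.
    move=> [_ /andP[_ /ltW h]]; apply: (le_trans h).
    rewrite xE -EFinD lee_fin -natr1 mulrDl mul1r lerD2r -ler_pdivlMr//.
  (* If the level extends beyond [z'], a rational in between works; otherwise [z'] is its
     maximum. *)
  have [[y [ly zy]]|nobig] := pselect (exists y, level j y /\ z' < y).
    have [rho] := rat_in_itvoo zy; rewrite in_itv /= => /andP[zr ry].
    exists (inr rho); rewrite /q ger0_norm ?(le_trans z'0 (ltW zr))// (ltW zr) /=.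
    apply: le_trans (Glev y ly); apply: Gm; last exact: ltW.
    exact: le_trans (ltW zr).
  have supz : sup (level j) = z'.
    have ubz : ubound (level j) z'.
      by move=> y ly; rewrite leNgt; apply/negP => zy; apply: nobig; exists y.
    apply/eqP; rewrite eq_le; apply/andP; split.
      by apply: ge_sup => //; exists z'.
    by apply: ub_le_sup => //; exists z'.
  by exists (inl j); rewrite /q supz ger0_norm// lexx /=; apply: Glev.
(* The least valid index depends measurably on [z], each validity set being measurable. *)
pose idx z := ex_minn (OKex z).
pose bn n := if @unpickle (nat + rat)%type n is Some i then bq i else 0.
have mOK n : measurable [set z | OK n z].
  rewrite /OK; case: unpickle => [i|]; last first.
    by rewrite [X in measurable X](_ : _ = set0)//; apply/seteqP; split.
  rewrite [X in measurable X](_ : _ = [set z | Num.max z 0 <= q i] `&`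
    (fun z => G' z + eps%:E)%E @^-1` `[G (q i), +oo[%classic).
    apply: measurableI.
      rewrite [X in measurable X](_ : _ = `]-oo, q i]%classic); first exact: measurable_itv.
      by apply/seteqP; split=> y /=; rewrite in_itv /= ge_max q0 andbT.
    rewrite -[X in measurable X]setTI; apply: emeasurable_funD => //.
    exact: emeasurable_itv.
  by apply/seteqP; split=> y /=; rewrite in_itv /= andbT => /andP.
exists (fun z => bn (idx z)); split.
- apply: (@measurable_fun_index _ _ _ _ idx (fun n _ => bn n)) => [n|n]; last exact: measurable_cst.
  rewrite [X in measurable X](_ : _ = [set z | OK n z] `&`
    \bigcap_(m in `I_n) ~` [set z | OK m z]).
    apply: measurableI => //; apply: fin_bigcap_measurable; first exact: finite_II.
    by move=> m _; exact: measurableC.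
  apply/seteqP; split=> z /=; rewrite /idx; case: ex_minnP => m OKm mmin.
    by move=> <-; split=> // k /= km OKk; move: km; rewrite ltnNge mmin.
  move=> [OKn nOK]; apply/eqP; rewrite eqn_leq mmin//= leqNgt; apply/negP => mn.
  exact: (nOK m mn).
- by move=> z; rewrite /bn; case: unpickle => [i|]; [case: (bqP i)|rewrite lexx ler01].
- move=> z z0; rewrite /idx; case: ex_minnP => n + _; rewrite /OK /bn.
  case: unpickle => // i /andP[]; rewrite /G' max_l// => zq Gq.
  apply: (le_trans (gm _ _ _ z0 zq)); apply: (le_trans (bqP i).2).
  by rewrite EFinD addeA leeD2r.
Qed.

Section verification.
Context d (Omega : measurableType d) (R : realType) (P : probability Omega R).
Context (W : R -> Omega -> R).
Context (F : probability (measurableTypeR R) R) (T : nat -> Omega -> R).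
Context (eta theta sigma dcrit r : R).
Hypothesis Pc : measure_is_complete P.
Hypothesis bmW : standard_brownian_motion P W.
Hypothesis rtT : renewal_times P F T.
Hypothesis WN : independent_systems P (sigma_generated `[0, +oo[ W)
    (sigma_generated `[0, +oo[ (counting_process T)).
Hypothesis r0 : 0 < r.
Context (N0 : set Omega).
Hypotheses (mN0 : measurable N0) (PN0 : P N0 = 0%E).
Hypothesis Wc : forall w, ~ N0 w -> {within `[0, +oo[%classic, continuous (W ^~ w)}.

Definition discount (k : nat) (w : Omega) : R := expR (- r * T k w).
Definition constant_drawdown (z b : R) (w : Omega) : R :=
  drawdown eta theta sigma W T (fun _ _ => b) z (T 1%N w) w.

Local Notation e := (discount 1).
Local Notation K := constant_drawdown.

Lemma measurable_discount k : measurable_fun setT (discount k).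
Proof.
apply: measurableT_comp => //; apply: measurable_funM => //.
exact: (rt_measurable rtT).
Qed.

Lemma discount_ge0 k w : 0 <= discount k w. Proof. exact: expR_ge0. Qed.

Let PT : P setT = 1%E. Proof. exact: (@probability_setT _ _ _ P). Qed.

Let intc (a : \bar R) : (\int[P]_w (cst a w) = a)%E.
Proof. by rewrite integral_cst// [X in (a * X)%E](_ : _ = 1%E) ?mule1. Qed.

Let discount_le1 k w : discount k w <= 1.
Proof.
rewrite -expR0 ler_expR mulNr oppr_le0; apply: mulr_ge0; first exact: ltW.
exact: (renewal_ge0 rtT).
Qed.

Lemma integral_discount_fin k : (\int[P]_w (discount k w)%:E)%E \is a fin_num.
Proof.
rewrite ge0_fin_numE; last by apply: integral_ge0 => w _; rewrite lee_fin discount_ge0.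
apply: (@le_lt_trans _ _ (\int[P]_w (cst 1%E w))%E); last by rewrite intc ltry.
by apply: ge0_le_integral_nomeas => w; rewrite lee_fin ?discount_ge0 ?discount_le1.
Qed.

Let l := fine (\int[P]_w (e w)%:E)%E.

Let lE : (\int[P]_w (e w)%:E)%E = l%:E.
Proof. by rewrite /l fineK// integral_discount_fin. Qed.

(** The discount is below 1 everywhere. Were its mean 1, the non-negative [1 - e] would vanish
    almost everywhere, against total mass 1. *)
Lemma discount_lt1 : l < 1.
Proof.
have e1 w : e w < 1.
  rewrite -expR0 ltr_expR mulNr oppr_lt0 mulr_gt0//.
  by have := gap_gt0 rtT 0%N w; rewrite /gap (rt_start rtT) subr0.
have l1 : l <= 1.
  rewrite -lee_fin -lE.
  apply: (@le_trans _ _ (\int[P]_w (cst 1%E w))%E); last by rewrite intc.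
  by apply: ge0_le_integral_nomeas => w; rewrite lee_fin ?discount_ge0 ?discount_le1.
rewrite lt_neqAle l1 andbT; apply/eqP => l1E.
have m1e : measurable_fun setT (fun w => (1 - e w)%:E).
  by apply/measurable_EFinP; apply: measurable_funB => //; exact: measurable_discount.
have h : (\int[P]_w (1 - e w)%:E = 0)%E.
  have : (\int[P]_w ((1 - e w)%:E + (e w)%:E) = 1%:E)%E.
    rewrite (eq_integral (cst 1%E)); last by move=> w _; rewrite -EFinD subrK.
    by rewrite intc.
  rewrite ge0_integralD//.
  - rewrite lE l1E; case: (\int[P]_w (1 - e w)%:E)%E => [x| |]//.
    by rewrite -EFinD => -[x1]; congr (_%:E); lra.
  - by move=> w _; rewrite lee_fin subr_ge0 ltW.
  - by move=> w _; rewrite lee_fin discount_ge0.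
  - by apply/measurable_EFinP; exact: measurable_discount.
have [|N [mN N00 hN]] := (ae_eq_integral_abs P measurableT m1e).1.
  by rewrite -[RHS]h; apply: eq_integral => w _; rewrite gee0_abs// lee_fin subr_ge0 ltW.
have : P setT = 0%E.
  apply: (subset_measure0 measurableT mN _ N00) => w _; apply: hN => /= /(_ I) [/eqP].
  by rewrite subr_eq0 gt_eqF.
by rewrite PT => /eqP; rewrite onee_eq0.
Qed.

Lemma constant_drawdown_ge0 z b w : 0 <= z -> ~ N0 w -> 0 <= K z b w.
Proof.
move=> z0 Nw.
by apply: (@drawdown_ge0 _ _ eta theta sigma W T (fun _ _ => b) (fun _ => b) w
  (rt_start rtT w) (rt_increasing rtT ^~ w) _ (Wc Nw)).
Qed.

Lemma constant_drawdown_le z z' b w : z <= z' -> K z b w <= K z' b w.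
Proof.
move=> zz'; rewrite /K /drawdown lerD2r ge_max !le_max lexx orbT andbT.
by rewrite zz'.
Qed.

Lemma constant_drawdownE z b w : 0 <= z -> ~ N0 w ->
  K z b w = noise_step eta theta sigma z b (cycle_noise W T 0 w).
Proof.
move=> z0 Nw; rewrite -(hat_step_noise _ _ _ rtT)//; last exact: Wc.
have Bb : forall k s, T k w <= s < T k.+1 w -> (fun _ _ => b) s w = (fun _ : nat => b) k by [].
rewrite /K (hat_step_drawdown eta theta sigma rtT 0 z (Wc Nw) Bb).
by rewrite (@drawdown0 _ _ eta theta sigma W T (fun _ _ => b) (fun _ => b) w (rt_start rtT w)
  (rt_increasing rtT ^~ w) Bb).
Qed.

Local Notation cost := (dp_cost P e K).

(** * One strategy against a fixed point *)

Section strategy.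
Context (b : nat -> Omega -> R) (z : R).
Hypothesis z0 : 0 <= z.
Hypothesis mb : forall k, measurable_fun (setT : set (arrival_type W T k)) (b k).

Let D := hat_drawdown W T eta theta sigma b z.

Let mD k : measurable_fun (setT : set (arrival_type W T k)) (D k).
Proof. exact: (arrival_measurable_hat_drawdown eta theta sigma bmW rtT). Qed.

Let mD' k : measurable_fun setT (D k).
Proof. exact: (arrival_measurable_measurable rtT (@mD k)). Qed.

Let DE k w : ~ N0 w -> D k w =
  drawdown eta theta sigma W T (step_process T b) z (T k w) w.
Proof.
move=> Nw; apply/esym.
apply: (hat_drawdownE eta theta sigma rtT k z0 (Wc Nw)) => j s.
exact: (step_processE rtT).
Qed.

Let D0 k w : ~ N0 w -> 0 <= D k w.
Proof.
move=> Nw; rewrite DE//.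
apply: (@drawdown_ge0 _ _ eta theta sigma W T (step_process T b) (b^~ w) w
  (rt_start rtT w) (rt_increasing rtT ^~ w) _ (Wc Nw)) => j s.
exact: (step_processE rtT).
Qed.

Let state k w : R * R * R := (T k w, D k w, b k w).

Let mstate_arrival k : measurable_fun (setT : set (arrival_type W T k)) (state k).
Proof.
apply: measurable_fun_pair => //; apply: measurable_fun_pair => //.
exact: (arrival_measurable_time rtT).
Qed.

Let mstate k : measurable_fun setT (state k).
Proof. exact: (arrival_measurable_measurable rtT (@mstate_arrival k)). Qed.

Let state_noise k A B : measurable A -> measurable B ->
  P (state k @^-1` A `&` cycle_noise W T k @^-1` B) =
  (P (state k @^-1` A) * P (cycle_noise W T 0 @^-1` B))%E.
Proof.
move=> mA mB; apply: (cycle_noise_independent Pc bmW rtT WN mN0 PN0 Wc) => //.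
exact: (proj1 (arrival_measurableP W rtT k (state k)) (@mstate_arrival k) A mA).
Qed.

Section one_cycle.
Variable f : R -> \bar R.
Hypotheses (mf : measurable_fun (setT : set R) f) (f0 : forall y, (0 <= f y)%E).

(** The discount at [T k.+1] is split into the factor known at [T k] and the factor of the fresh
    cycle. *)
Let H (p : (R * R * R) * (R * path_space R (nat * nat)%type)) : \bar R :=
  ((expR (- r * p.1.1.1))%:E *
   ((expR (- r * p.2.1))%:E * f (noise_step eta theta sigma p.1.1.2 p.1.2 p.2)))%E.

Let mH : measurable_fun setT H.
Proof.
have m1 := @measurable_fst _ _ (R * R * R)%type (R * path_space R (nat * nat)%type)%type.
have m2 := @measurable_snd _ _ (R * R * R)%type (R * path_space R (nat * nat)%type)%type.
have m11 := @measurable_fst _ _ (R * R)%type R.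
have m12 := @measurable_snd _ _ (R * R)%type R.
have mexp d' (X : measurableType d') (u : X -> R) : measurable_fun setT u ->
    measurable_fun setT (fun x => (expR (- r * u x))%:E).
  by move=> mu; apply/measurable_EFinP; apply: measurableT_comp => //; exact: measurable_funM.
apply: emeasurable_funM.
  apply: mexp; apply: (measurableT_comp measurable_fst).
  exact: (measurableT_comp measurable_fst m1).
apply: emeasurable_funM; first by apply: mexp; exact: (measurableT_comp measurable_fst m2).
apply: (measurableT_comp mf); apply: measurable_noise_step => //.
  apply: (measurableT_comp measurable_snd).
  exact: (measurableT_comp measurable_fst m1).
exact: (measurableT_comp measurable_snd m1).
Qed.

Let H0 p : (0 <= H p)%E.
Proof. by rewrite /H !mule_ge0 ?lee_fin ?expR_ge0. Qed.

(** A version of the conditional expectation of [discount k.+1 * f (D k.+1)] given the past at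
    [T k]. *)
Definition cycle_cost k w : \bar R := (\int[P]_w' H (state k w, cycle_noise W T 0 w'))%E.

Let mnoise k : measurable_fun setT (cycle_noise W T k).
Proof. exact: (measurable_cycle_noise Pc bmW rtT mN0 PN0 Wc). Qed.

Lemma measurable_cycle_cost k : measurable_fun setT (cycle_cost k).
Proof. exact: (measurable_frozen_integral P (@mstate k) (mnoise 0) mH H0). Qed.

Lemma cycle_cost_ge0 k w : (0 <= cycle_cost k w)%E.
Proof. by apply: integral_ge0 => w' _. Qed.

Lemma cycle_costE k w : ~ N0 w ->
  cycle_cost k w = ((discount k w)%:E * cost f (D k w) (b k w))%E.
Proof.
move=> Nw; pose g w' := ((expR (- r * gap T 0 w'))%:E *
  f (noise_step eta theta sigma (D k w) (b k w) (cycle_noise W T 0 w')))%E.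
have g0 w' : [set: Omega] w' -> (0 <= g w')%E.
  by move=> _; apply: mule_ge0 => //; rewrite lee_fin; exact: expR_ge0.
have mg : measurable_fun setT g.
  apply: emeasurable_funM.
    apply/measurable_EFinP; apply: measurableT_comp => //; apply: measurable_funM => //.
    exact: (measurable_gap rtT).
  by apply: (measurableT_comp mf); apply: measurable_noise_step.
have d0 : (0 <= (discount k w)%:E :> \bar R)%E by rewrite lee_fin; exact: discount_ge0.
have E := @ge0_integralZl _ _ _ P setT measurableT g mg (discount k w)%:E g0 d0.
rewrite [LHS]E; apply: congr1; apply: (eq_integral_off_null mN0 PN0) => w' Nw'; rewrite /g.
rewrite -constant_drawdownE//; last exact: D0.
by rewrite /discount /gap (rt_start rtT) subr0.
Qed.

Lemma next_cycle k :
  (\int[P]_w ((discount k.+1 w)%:E * f (D k.+1 w)) = \int[P]_w cycle_cost k w)%E.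
Proof.
rewrite -(integral_frozen (@mstate k) (mnoise k) (mnoise 0) (@state_noise k) mH H0).
apply: (eq_integral_off_null mN0 PN0) => w Nw.
rewrite /H /= muleA -EFinM -expRD -mulrDr {1}/gap [T k w + _]addrC subrK.
by rewrite -(hat_step_noise _ _ _ rtT)//; exact: Wc.
Qed.

End one_cycle.

(** By [next_cycle] with [f = 1], whose one-step cost is the constant [l]. *)
Lemma expected_discount k : (\int[P]_w (discount k w)%:E)%E = (l ^+ k)%:E.
Proof.
elim: k => [|k ih].
  rewrite expr0 (eq_integral (cst 1%E)) ?intc// => w _.
  by rewrite /discount (rt_start rtT) mulr0 expR0.
have m1 : measurable_fun (setT : set R) (fun _ : R => 1%E : \bar R) by exact: measurable_cst.
have h1 (y : R) : (0 <= (1%E : \bar R))%E by [].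
transitivity (\int[P]_w ((discount k.+1 w)%:E * 1))%E.
  by apply: eq_integral => w _; rewrite mule1.
transitivity (\int[P]_w cycle_cost (fun=> 1%E) k w)%E; first exact: (next_cycle m1 h1 k).
rewrite (@eq_integral_off_null _ _ _ P _ (fun w => l%:E * (discount k w)%:E)%E N0)//.
  rewrite ge0_integralZl_EFin ?ih ?exprS ?EFinM//.
  - by move=> w _; rewrite lee_fin discount_ge0.
  - by apply/measurable_EFinP; exact: measurable_discount.
  - by rewrite -lee_fin -lE; apply: integral_ge0 => w _; rewrite lee_fin discount_ge0.
move=> w Nw; rewrite cycle_costE// muleC; congr (_ * _)%E.
by rewrite /dp_cost -lE; apply: eq_integral => w' _; rewrite mule1.
Qed.

Definition stage_cost k : \bar R :=
  (\int[P]_w (discount k w * (dcrit < D k w)%R%:R)%:E)%E.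

Let mstage k : measurable_fun setT (fun w => (discount k w * (dcrit < D k w)%R%:R)%:E).
Proof.
apply/measurable_EFinP; apply: measurable_funM; first exact: measurable_discount.
rewrite (_ : (fun _ => _) = \1_(D k @^-1` `]dcrit, +oo[)).
  apply: measurable_indic; rewrite -[X in measurable X]setTI.
  by apply: mD' => //; exact: measurable_itv.
apply/funext => w; rewrite indicE; congr (_%:R); congr (nat_of_bool _).
by apply/idP/idP; rewrite inE /= in_itv /= andbT.
Qed.

Let stage_ge0 k w : (0 <= (discount k w * (dcrit < D k w)%R%:R)%:E :> \bar R)%E.
Proof. by rewrite lee_fin mulr_ge0// discount_ge0. Qed.

Lemma stage_cost_ge0 k : (0 <= stage_cost k)%E.
Proof. by apply: integral_ge0 => w _. Qed.

Lemma strategy_valueE :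
  strategy_value P eta theta sigma dcrit r W T (step_process T b) z =
  (\sum_(0 <= k <oo) stage_cost k)%E.
Proof.
rewrite -(integral_nneseries P measurableT mstage (fun k w _ => stage_ge0 k w)).
apply: (eq_integral_off_null mN0 PN0) => w Nw.
by apply: eq_eseriesr => k _; rewrite -DE.
Qed.

Section against_fixpoint.
Context (val : R -> \bar R).
Let C := (1 - l)^-1.
Hypothesis valS : bounded_space C val.
Hypothesis val_mono : forall y y' : R, (0 <= y)%R -> (y <= y')%R -> (val y <= val y')%E.
Hypothesis val_fix : forall y : R, (0 <= y)%R -> val y = dp_op P dcrit e K val y.

(** [D k] may be negative on [N0], whereas the integrands have to be measurable and non-negative
    everywhere. *)
Let val' y := val (Num.max y 0).

Let mval' : measurable_fun (setT : set R) val'.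
Proof. exact: measurable_nondecreasing_ereal. Qed.

Let val'0 y : (0 <= val' y)%E.
Proof. by have /valS/andP[] : 0 <= Num.max y 0 by rewrite le_max lexx orbT. Qed.

Let val'C y : (val' y <= C%:E)%E.
Proof. by have /valS/andP[] : 0 <= Num.max y 0 by rewrite le_max lexx orbT. Qed.

Let val'E y : 0 <= y -> val' y = val y.
Proof. by move=> y0; rewrite /val' max_l. Qed.

Let costE y a : 0 <= y -> cost val' y a = cost val y a.
Proof.
move=> y0; apply: (eq_integral_off_null mN0 PN0) => w Nw.
by rewrite val'E// constant_drawdown_ge0.
Qed.

Definition remaining_value k : \bar R := (\int[P]_w ((discount k w)%:E * val' (D k w)))%E.

Let mremaining k : measurable_fun setT (fun w => ((discount k w)%:E * val' (D k w))%E).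
Proof.
apply: emeasurable_funM; first by apply/measurable_EFinP; exact: measurable_discount.
exact: measurableT_comp mval' (@mD' k).
Qed.

Let remaining_ge0 k w : (0 <= (discount k w)%:E * val' (D k w))%E.
Proof. by rewrite mule_ge0// lee_fin discount_ge0. Qed.

Lemma remaining_value0 : remaining_value 0 = val z.
Proof.
rewrite /remaining_value (eq_integral (cst (val z))).
  exact: intc.
by move=> w _; rewrite /discount (rt_start rtT) mulr0 expR0 mul1e /= val'E.
Qed.

Lemma remaining_value_le k : (remaining_value k <= (C * l ^+ k)%:E)%E.
Proof.
have C0 : 0 <= C by rewrite invr_ge0 subr_ge0 ltW// discount_lt1.
rewrite EFinM -expected_discount -ge0_integralZl_EFin//.
- apply: ge0_le_integral_nomeas => w //.
  by rewrite muleC lee_wpmul2r// lee_fin discount_ge0.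
- by move=> w _; rewrite lee_fin discount_ge0.
- by apply/measurable_EFinP; exact: measurable_discount.
Qed.

Let stageE k w : ~ N0 w -> ((discount k w)%:E * val' (D k w) =
  (discount k w * (dcrit < D k w)%R%:R)%:E +
  (discount k w)%:E * dp_inf P e K val (D k w))%E.
Proof.
move=> Nw; rewrite val'E ?D0// val_fix ?D0// /dp_op ge0_muleDr ?lee_fin//.
apply: (dp_inf_ge0 (N := N0)) => //; try exact: D0.
- exact: discount_ge0.
- by move=> *; exact: constant_drawdown_ge0.
- by move=> y y0; case/andP: (valS y0).
Qed.

(** The equation for [val] at [D k], with the infimum bounded by the cost of the control in use. *)
Lemma remaining_value_step_le : (forall k w, 0 <= b k w <= 1) ->
  forall k, (remaining_value k <= stage_cost k + remaining_value k.+1)%E.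
Proof.
move=> b01 k; rewrite /remaining_value (next_cycle mval' val'0).
rewrite -ge0_integralD//; last 2 first.
- by move=> w _; exact: cycle_cost_ge0.
- exact: measurable_cycle_cost.
apply: ae_ge0_le_integral => //.
- by move=> w _; rewrite adde_ge0// cycle_cost_ge0.
- by apply: emeasurable_funD => //; exact: measurable_cycle_cost.
exists N0; split=> // w /= h; apply: contrapT => Nw; apply: h => _.
rewrite cycle_costE// costE ?D0// stageE//; apply: leeD2l.
apply: lee_wpmul2l; first by rewrite lee_fin discount_ge0.
exact: dp_inf_lb.
Qed.

(** An error [eps] in the decision at [T k] costs [eps * l ^+ k] in expectation. *)
Lemma remaining_value_step_ge (eps : R) : 0 <= eps ->
  (forall k w, ~ N0 w ->
    (cost val (D k w) (b k w) <= dp_inf P e K val (D k w) + eps%:E)%E) ->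
  forall k, (stage_cost k + remaining_value k.+1 <= remaining_value k + (eps * l ^+ k)%:E)%E.
Proof.
move=> eps0 bopt k; rewrite /remaining_value (next_cycle mval' val'0).
rewrite EFinM -expected_discount -ge0_integralZl_EFin//; last 2 first.
- by move=> w _; rewrite lee_fin discount_ge0.
- by apply/measurable_EFinP; exact: measurable_discount.
have me : measurable_fun setT (fun w => (eps%:E * (discount k w)%:E)%E).
  by apply: emeasurable_funM => //; apply/measurable_EFinP; exact: measurable_discount.
have e0 w : (0 <= eps%:E * (discount k w)%:E)%E by rewrite mule_ge0// lee_fin discount_ge0.
rewrite -ge0_integralD//; last 2 first.
- by move=> w _; exact: cycle_cost_ge0.
- exact: measurable_cycle_cost.
rewrite -ge0_integralD//.
apply: ae_ge0_le_integral => //.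
- by move=> w _; rewrite adde_ge0// cycle_cost_ge0.
- by apply: emeasurable_funD => //; exact: measurable_cycle_cost.
- by move=> w _; rewrite adde_ge0.
- exact: emeasurable_funD.
exists N0; split=> // w /= h; apply: contrapT => Nw; apply: h => _.
rewrite cycle_costE// costE ?D0// stageE// -addeA; apply: leeD2l.
rewrite [(eps%:E * _)%E]muleC -ge0_muleDr ?lee_fin//; last first.
  apply: (dp_inf_ge0 (N := N0)) => //; try exact: D0.
  - exact: discount_ge0.
  - by move=> *; exact: constant_drawdown_ge0.
  - by move=> y y0; case/andP: (valS y0).
by apply: lee_wpmul2l; [rewrite lee_fin discount_ge0|exact: bopt].
Qed.

End against_fixpoint.
End strategy.

Let K0 (y a : R) w : 0 <= y -> ~ N0 w -> 0 <= K y a w.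
Proof. exact: constant_drawdown_ge0. Qed.

(** * The value function is the fixed point *)

Section value.
Context (val : R -> \bar R).
Let C := (1 - l)^-1.
Hypothesis valS : bounded_space C val.
Hypothesis val_mono : forall y y' : R, (0 <= y)%R -> (y <= y')%R -> (val y <= val y')%E.
Hypothesis val_fix : forall y : R, (0 <= y)%R -> val y = dp_op P dcrit e K val y.

Let C0 : 0 < C. Proof. by rewrite invr_gt0 subr_gt0 discount_lt1. Qed.
Let l0 : 0 <= l.
Proof. by rewrite -lee_fin -lE; apply: integral_ge0 => w _; rewrite lee_fin discount_ge0. Qed.

Let val0 (y : R) : 0 <= y -> (0 <= val y)%E. Proof. by case/valS/andP. Qed.

(** The one-cycle inequalities telescope, and the remaining value after [n] cycles is at most
    [C * l ^+ n]. *)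
Lemma fixpoint_le_strategy_value B z : 0 <= z -> strategies W T B ->
  (val z <= strategy_value P eta theta sigma dcrit r W T B z)%E.
Proof.
move=> z0 [b [b01 bG ->]].
have mb k : measurable_fun (setT : set (arrival_type W T k)) (b k).
  by apply: (proj2 (arrival_measurableP W rtT k (b k))); exact: bG.
rewrite (strategy_valueE z0 mb).
have step n : (val z <= \sum_(0 <= k < n) stage_cost b z k + remaining_value b z val n)%E.
  elim: n => [|n ih]; first by rewrite big_geq// add0e remaining_value0.
  have st := remaining_value_step_le z0 mb valS val_mono val_fix b01 n.
  rewrite big_nat_recr; last by [].
  by rewrite -addeA; apply: (le_trans ih); exact: (leeD2l _ st).
apply/lee_addgt0Pr => eps eps0.
have cvgC : (C * l ^+ n) @[n --> \oo] --> (0 : R).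
  rewrite -[X in _ --> X](mulr0 C); apply: cvgMr.
  by apply: cvg_expr; rewrite ger0_norm ?discount_lt1.
have /cvgrPdist_lt /(_ _ eps0) [n _ /(_ n (leqnn n))] := cvgC.
rewrite sub0r normrN ger0_norm ?mulr_ge0 ?exprn_ge0 ?(ltW C0)// => h.
apply: (le_trans (step n)); apply: leeD.
  by apply: nneseries_lim_ge => k _ _; exact: stage_cost_ge0.
apply: (le_trans (remaining_value_le z0 mb valS n)).
by rewrite lee_fin ltW.
Qed.

Lemma near_optimal_strategy z eps : 0 <= z -> 0 < eps -> exists2 B, strategies W T B &
  (strategy_value P eta theta sigma dcrit r W T B z <= val z + eps%:E)%E.
Proof.
(* The selector loses [del + del] per decision; the discounted total is at most [(del + del) * C],
   which is [eps]. *)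
move=> z0 eps0; pose del := eps / C / 2.
have del0 : 0 < del by rewrite !divr_gt0.
have inf_bound (y : R) : 0 <= y -> (0 <= dp_inf P e K val y <= (l * C)%:E)%E.
  by move=> y0; apply: (dp_inf_bounded (measurable_discount 1) (discount_ge0 1)
    (integral_discount_fin 1) mN0 PN0 K0 discount_lt1 valS y0).
have [|||beta [mbeta beta01 betaP]] := @monotone_selector R (dp_inf P e K val) (cost val)
    del (l * C) del0 inf_bound.
- by move=> y y' y0 yy'; apply: (dp_inf_mono (discount_ge0 1) mN0 PN0 K0 constant_drawdown_le).
- by move=> y y' a y0 yy'; apply: (dp_cost_mono (discount_ge0 1) mN0 PN0 K0 constant_drawdown_le).
- move=> y y0; have /andP[i0 iC] := inf_bound y y0.
  have ifin : dp_inf P e K val y \is a fin_num.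
    by rewrite ge0_fin_numE// (le_lt_trans iC)// ltry.
  have [_ [a a01 <-] ha] := lb_ereal_inf_adherent del0 ifin.
  by exists a; split; [move: a01 => /=; rewrite in_itv|exact: ltW].
(* State and feedback control depend on each other: the state is defined with [beta] inlined, and
   [xE] identifies it as the state under [b]. *)
pose x := fix x (k : nat) (w : Omega) : R :=
  if k is k'.+1 then hat_step W T eta theta sigma k' (x k' w) (beta (x k' w)) w else z.
pose b k w := beta (x k w).
have xE k : x k = hat_drawdown W T eta theta sigma b z k.
  by apply/funext => w; elim: k => [//|k ih] /=; rewrite -ih.
have mx k : measurable_fun (setT : set (arrival_type W T k)) (x k).
  elim: k => [|k ih]; first exact: measurable_cst.
  apply: (arrival_measurable_hat_step eta theta sigma bmW rtT) => //.
  exact: (measurableT_comp mbeta ih).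
have mb k : measurable_fun (setT : set (arrival_type W T k)) (b k).
  exact: (measurableT_comp mbeta (mx k)).
exists (step_process T b).
  exists b; split=> [k w|k A mA|//]; first exact: beta01.
  exact: (proj1 (arrival_measurableP W rtT k (b k)) (mb k) A mA).
rewrite (strategy_valueE z0 mb).
have bopt k w : ~ N0 w -> (cost val (hat_drawdown W T eta theta sigma b z k w) (b k w) <=
    dp_inf P e K val (hat_drawdown W T eta theta sigma b z k w) + (del + del)%:E)%E.
  move=> Nw; rewrite /b xE; apply: betaP.
  rewrite -(hat_drawdownE (B := step_process T b) eta theta sigma rtT k z0 (Wc Nw)).
    apply: (@drawdown_ge0 _ _ eta theta sigma W T (step_process T b) (b^~ w) w
      (rt_start rtT w) (rt_increasing rtT ^~ w) _ (Wc Nw)) => j s.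
    exact: (step_processE rtT).
  by move=> j s; exact: (step_processE rtT).
have dd0 : 0 < del + del by rewrite addr_gt0.
have step n : (\sum_(0 <= k < n) stage_cost b z k + remaining_value b z val n <=
    val z + (\sum_(k < n) (del + del) * l ^+ k)%:E)%E.
  elim: n => [|n ih].
    by rewrite big_geq// add0e big_ord0 adde0 remaining_value0.
  have st := remaining_value_step_ge z0 mb valS val_mono val_fix (ltW dd0) bopt n.
  rewrite big_nat_recr//= big_ord_recr /= EFinD -addeA.
  apply: (le_trans (leeD2l _ st)).
  by rewrite addeA [leRHS]addeA leeD2r.
have geo n : \sum_(k < n) (del + del) * l ^+ k <= eps.
  rewrite -mulr_sumr.
  have : (\sum_(k < n) l ^+ k) * (1 - l) <= 1.
    have -> : (\sum_(k < n) l ^+ k) * (1 - l) = 1 - l ^+ n.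
      elim: n => [|n ih]; first by rewrite big_ord0 mul0r expr0 subrr.
      by rewrite big_ord_recr /= mulrDl ih exprS; ring.
    by rewrite gerBl exprn_ge0.
  rewrite -ler_pdivlMr ?subr_gt0 ?discount_lt1// mul1r -/C => h.
  apply: (le_trans (ler_wpM2l (ltW dd0) h)).
  have -> : del + del = eps / C by rewrite /del -splitr.
  by rewrite divfK ?gt_eqF.
apply: lime_le; first by apply: is_cvg_nneseries => k _ _; exact: stage_cost_ge0.
apply: nearW => n; apply: (@le_trans _ _ (val z + (\sum_(k < n) (del + del) * l ^+ k)%:E)%E).
  apply: le_trans (step n); rewrite leeDl//.
  apply: integral_ge0 => w _; rewrite mule_ge0 ?lee_fin ?discount_ge0//.
  by apply: val0; rewrite le_max lexx orbT.
by rewrite leeD2l// lee_fin.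
Qed.

Lemma value_function_fixpoint z : 0 <= z ->
  value_function P eta theta sigma dcrit r W T z = val z.
Proof.
move=> z0; apply/eqP; rewrite eq_le; apply/andP; split.
  apply/lee_addgt0Pr => eps eps0.
  have [B sB hB] := near_optimal_strategy z0 eps0.
  by apply: le_trans hB; apply: ereal_inf_lbound; exists B.
by apply/ereal_infP => _ [B sB <-]; exact: fixpoint_le_strategy_value.
Qed.

End value.

Lemma dpe_dp_op f : dynamic_programming_equation P eta theta sigma dcrit r W T f <->
  forall z : R, 0 <= z -> f z = dp_op P dcrit e K f z.
Proof. by []. Qed.

Lemma value_function_solution :
  let v := value_function P eta theta sigma dcrit r W T in
  [/\ bounded_space (1 - l)^-1 v,
      dynamic_programming_equation P eta theta sigma dcrit r W T v &
      forall f, bounded_space (1 - l)^-1 f ->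
        dynamic_programming_equation P eta theta sigma dcrit r W T f ->
        forall z, 0 <= z -> f z = v z].
Proof.
move=> v.
have [val [valS val_mono val_fix]] := dp_fixpoint_exists dcrit (measurable_discount 1)
  (discount_ge0 1) (integral_discount_fin 1) mN0 PN0 K0 constant_drawdown_le discount_lt1.
have vE z : 0 <= z -> v z = val z.
  exact: (value_function_fixpoint valS val_mono val_fix).
have vS : bounded_space (1 - l)^-1 v by move=> z z0; rewrite vE//; exact: valS.
have vop z : 0 <= z -> v z = dp_op P dcrit e K v z.
  move=> z0; rewrite vE// val_fix// /dp_op; congr (_ + _)%E; congr ereal_inf.
  (* [v] and [val] agree on the half-line, where the drawdown stays off [N0]. *)
  have cE a : cost val z a = cost v z a.
    apply: (eq_integral_off_null mN0 PN0) => w Nw.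
    by rewrite vE// constant_drawdown_ge0.
  by apply/seteqP; split=> _ [a a01 <-]; exists a.
split=> // f fS /dpe_dp_op fop z z0.
exact: (dp_fixpoint_unique (measurable_discount 1) (discount_ge0 1)
  (integral_discount_fin 1) mN0 PN0 K0 discount_lt1 fS vS fop vop z0).
Qed.

End verification.

Theorem theorem2p6 (d0 : measure_display) (Omega : measurableType d0)
    (R : realType) (P : probability Omega R)
    (W : R -> Omega -> R) (F : probability (measurableTypeR R) R)
    (T : nat -> Omega -> R) (eta theta sigma dcrit r : R) :
  measure_is_complete P ->
  standard_brownian_motion P W ->
  renewal_times P F T ->
  independent_systems P (sigma_generated `[0, +oo[ W)
    (sigma_generated `[0, +oo[ (counting_process T)) ->
  eta < theta -> 0 < sigma -> 0 < dcrit -> 0 < r ->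
  let S := bounded_space (1 - laplace_T1 P r T)^-1 in
  let v := value_function P eta theta sigma dcrit r W T in
  let dpe := dynamic_programming_equation P eta theta sigma dcrit r W T in
  [/\ S v, dpe v &
    forall f : R -> \bar R, S f -> dpe f -> forall z, 0 <= z -> f z = v z].
Proof.
move=> Pc bmW rtT WN _ _ _ r0 S v dpe.
have [N0 [mN0 PN0 hN0]] := bm_continuous bmW.
have Wc w : ~ N0 w -> {within `[0, +oo[%classic, continuous (W ^~ w)}.
  by move=> Nw; apply: contrapT => h; apply: Nw; exact: hN0.
have lE : laplace_T1 P r T = fine (\int[P]_w (discount T r 1 w)%:E)%E.
  by rewrite /laplace_T1 unlock.
rewrite /S lE.
exact: (value_function_solution eta theta sigma dcrit Pc bmW rtT WN r0 mN0 PN0 Wc).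
Qed.
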